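(* As $H\to\infty$, $N_{V_4}(H)+N_{C_4}(H)\ll H^2\log H$.
   Context: Let $\mathcal S_H$ be the set of monic quartic polynomials $X^4+aX^3+bX^2+cX+d$ with $a,b,c,d\in\mathbb Z\cap[-H,H]$ that are irreducible over $\mathbb Q$. For a group $G$, $N_G(H)=\#\{f\in\mathcal S_H: G_f\simeq G\}$, where $G_f$ is the Galois group of $f$ over $\mathbb Q$. $V_4$ is the Klein four group and $C_4$ the cyclic group of order 4. *)

(* Defs.v *)
From HB Require Import structures.
From mathcomp Require Import all_boot all_order all_algebra all_fingroup all_solvable all_field.
From Stdlib Require Import ClassicalEpsilon.
Set Implicit Arguments. Unset Strict Implicit. Unset Printing Implicit Defensive.
Import GRing.Theory Num.Theory.
Local Open Scope ring_scope.

Definition decb (P : Prop) : bool :=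
  if excluded_middle_informative P then true else false.

Definition quartic (a b c d : int) : {poly rat} :=
  'X^4 + (a%:~R)%:P * 'X^3 + (b%:~R)%:P * 'X^2 + (c%:~R)%:P * 'X + (d%:~R)%:P.

Definition rootsC (p : {poly rat}) : seq algC :=
  sval (closed_field_poly_normal (map_poly (ratr : rat -> algC) p)).

(* Galois group of p over Q, as a permutation group on the (indexed) roots:
   the permutations of the roots induced by field automorphisms of algC
   (every automorphism of the splitting field extends to algC). *)
Definition galset (p : {poly rat}) : {set {perm 'I_(size (rootsC p))}} :=
  [set s : {perm 'I_(size (rootsC p))} | decb (exists sigma : {rmorphism algC -> algC},
                   forall i : 'I_(size (rootsC p)),
                     sigma (nth 0 (rootsC p) i) = nth 0 (rootsC p) (s i))].

Definition galgrp (p : {poly rat}) := (<<galset p>>)%G.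

Definition V4 : {set 'Z_2 * 'Z_2} := setX (Zp 2) (Zp 2).
Definition C4 : {set 'Z_4} := Zp 4.

Definition box (H : nat) : seq int := [seq (x%:Z - H%:Z)%R | x <- iota 0 (2 * H + 1)].

Definition quad (H : nat) : seq (int * int * int * int) :=
  [seq (ab.1, ab.2, cd.1, cd.2) | ab <- [seq (a, b) | a <- box H, b <- box H],
                                     cd <- [seq (c, d) | c <- box H, d <- box H]].

Definition f_of (t : int * int * int * int) : {poly rat} :=
  let: (a, b, c, d) := t in quartic a b c d.

Definition N_V4 (H : nat) : nat :=
  count (fun t => decb (irreducible_poly (f_of t)) && (galgrp (f_of t) \isog V4)) (quad H).

Definition N_C4 (H : nat) : nat :=
  count (fun t => decb (irreducible_poly (f_of t)) && (galgrp (f_of t) \isog C4)) (quad H).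

(* Main.v *)
Require Import Defs.
From HB Require Import structures.
From mathcomp Require Import all_boot all_order all_algebra all_fingroup all_solvable all_field.
From mathcomp Require Import ring lra zify.
From mathcomp Require Import reals.

(* Let r0, ..., r3 be the roots.  A quadratic subfield of the splitting field gives an integer
   root x = r0 r1 + r2 r3 of the cubic resolvent, with x = O(H), and the integer
   A = (r0 + r1 - r2 - r3)^2 = a^2 - 4 b + 4 x.  If A = 0, then 8 c = 4 a b - a^3, and there are
   O(H^2 log H) such quartics.  In general the product of the roots is O(H), so one root is
   O(sqrt (H / R)), where R = sqrt (|A| + H); hence a lies near a number depending only on
   the square roots attached to the resolvent, and these leave O(sqrt (H / R)) choices for a.

   For V4 there are three such integers A1, A2, A3, whose product is a square and whose
   differences are O(H).  Write them, up to sign, as al be m1^2, al ga m2^2, be ga m3^2 with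
   be <= al <= ga.  Then al m2 = O(R), while ga and m3 are confined to short intervals once
   al, be, m1, m2 are fixed; the sum over these four variables is O(H^2 sum 1/al).

   For C4 write A = k m^2 with k squarefree.  Then eta = r0 - r2 and eta' = r1 - r3 give
   eta^2 + eta'^2 = k s, eta^2 - eta'^2 = d sqrt k, 2 eta eta' = w sqrt k with k s^2 = d^2 + w^2.
   Two non-proportional null vectors of content g of this form have polar product at least
   g^2, which separates the slopes w / (s sqrt k + d), and so bounds the number of (s, d, w) in
   a dyadic range of k s by 1 + O(H / (g sqrt k)).  Summing over g, k and the dyadic ranges
   gives O(H^2 log H). *)

Set Implicit Arguments. Unset Strict Implicit. Unset Printing Implicit Defensive.
Import Order.TTheory GRing.Theory Num.Theory.

(** * Squarefree parts *)

Local Open Scope nat_scope.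

(** The obstacle is to end with a single logarithm. An interval of length D may hold [1 + D]
    integers, so each nested count splits into several terms with their own powers of the
    parameters, kept separate until the last sum. Logarithms are represented by harmonic numbers
    with one common cutoff [N], at least [176 * H ^ 2]. In the Klein case, the harmonic sum over
    [m1] is multiplied by a double series in [al] and [be] that converges because [be <= al]. In the
    cyclic case, the sums over [g] and [k] produce two logarithms in one term, but that term carries
    only [H ^ (7/4)], and the missing [H ^ (1/4)] absorbs one of them. The dyadic ranges have ratio
    16 because the length of the interval for [a] is a fourth root: with [e ^ 4 = H], it is of order
    [e / 2 ^ j] in the range [j]. The Galois group enters only at the start: quantities fixed by all
    automorphisms of [algC] are rational and, being algebraic integers, they are integers. After
    that, the argument uses only integer data and the sizes of the complex roots. *)

Definition squarefree (k : nat) : Prop := forall d, d ^ 2 %| k -> d = 1.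

Lemma squarefree_part (n : nat) : 0 < n ->
  exists k m, [/\ n = k * m ^ 2, 0 < k, 0 < m & squarefree k].
Proof.
elim/ltn_ind: n => n IH n0.
have [/existsP[d /andP[d1 /dvdnP[q nq]]]|/existsPn nod] :=
  boolP [exists d : 'I_n.+1, (1 < d) && (d ^ 2 %| n)].
  have q0 : 0 < q by move: n0; rewrite nq muln_gt0 => /andP[].
  have [|k [m [qk k0 m0 sk]]] := IH q _ q0.
    by rewrite nq -[X in X < _]muln1 ltn_pmul2l // (ltn_sqr 1 d).
  exists k, (m * d); split => //; first by rewrite expnMn mulnA -qk -nq.
  by rewrite muln_gt0 m0 ltnW.
exists n, 1; split => //; first by rewrite muln1.
move=> d dn; have d0 : 0 < d.
  by case: d dn => //; rewrite exp0n // dvd0n => /eqP E; rewrite E in n0.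
have dlt : d < n.+1.
  by rewrite ltnS (leq_trans _ (dvdn_leq n0 dn)) // -{1}[d]expn1 leq_pexp2l.
have := nod (Ordinal dlt); rewrite /= dn andbT -leqNgt => d1.
by apply/eqP; rewrite eqn_leq d1.
Qed.

(** With [g] the gcd of [k] and [y], the cofactor [k / g] is coprime to [y / g], so it divides [g];
    its square then divides [k], which forces it to be 1. *)
Lemma squarefree_dvd_sqr (k y : nat) : squarefree k -> k %| y ^ 2 -> k %| y.
Proof.
move=> sk; have [->|k0] := posnP k; first by rewrite !dvd0n expn_eq0 andbT.
move=> dvd; set g := gcdn k y; have g0 : 0 < g by rewrite gcdn_gt0 k0.
have /dvdnP[k' Ek] := dvdn_gcdl k y; have /dvdnP[y' Ey] := dvdn_gcdr k y.
rewrite -/g in Ek Ey.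
have co : coprime k' y'.
  by rewrite /coprime -(eqn_pmul2r g0) mul1n muln_gcdl -Ek -Ey.
have k'g : k' %| g.
  move: dvd; rewrite Ek Ey expnMn -mulnn mulnA dvdn_pmul2r // -mulnA.
  by rewrite !Gauss_dvdr.
have /sk k'1 : k' ^ 2 %| k by rewrite Ek -mulnn dvdn_mul.
by rewrite Ek k'1 mul1n dvdn_gcdr.
Qed.

Lemma squarefree_dvd (k k' : nat) : k' %| k -> squarefree k -> squarefree k'.
Proof. by move=> dvd sk d dk'; apply: sk; apply: dvdn_trans dvd. Qed.

(** Only [A1] and [A2] are split into squarefree part and square: [al] is the gcd of the squarefree
    parts, [be] and [ga] are the coprime cofactors. Removing the square of [al * m1 * m2] shows that
    [be * ga * A3] is a square, and squarefreeness puts [be * ga] inside its root. *)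
Lemma square_product_param (A1 A2 A3 s : nat) :
  0 < A1 -> 0 < A2 -> 0 < A3 -> A1 * A2 * A3 = s ^ 2 ->
  exists al be ga m1 m2 m3, [/\ A1 = al * be * m1 ^ 2, A2 = al * ga * m2 ^ 2
    & A3 = be * ga * m3 ^ 2].
Proof.
move=> /squarefree_part[k1 [m1 [-> k10 m10 sk1]]] /squarefree_part[k2 [m2 [-> k20 m20 sk2]]].
move=> A30 E; pose al := gcdn k1 k2.
have al0 : 0 < al by rewrite gcdn_gt0 k10.
have /dvdnP[be Ebe] := dvdn_gcdl k1 k2; have /dvdnP[ga Ega] := dvdn_gcdr k1 k2.
rewrite -/al in Ebe Ega.
have co : coprime be ga.
  by rewrite /coprime -(eqn_pmul2r al0) mul1n muln_gcdl -Ebe -Ega.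
have be0 : 0 < be by move: k10; rewrite Ebe muln_gt0 => /andP[].
have ga0 : 0 < ga by move: k20; rewrite Ega muln_gt0 => /andP[].
have {}E : (al * m1 * m2) ^ 2 * (be * ga * A3) = s ^ 2.
  by rewrite -E Ebe Ega; ring.
have P0 : 0 < al * m1 * m2 by rewrite !muln_gt0 al0 m10.
have /dvdnP[y Ey] : al * m1 * m2 %| s.
  by rewrite -(@dvdn_pexp2r _ _ 2) // -E dvdn_mulr.
have {}E : be * ga * A3 = y ^ 2.
  apply/eqP; rewrite -(eqn_pmul2l (_ : 0 < (al * m1 * m2) ^ 2)) ?expn_gt0 ?P0 //.
  by rewrite E Ey expnMn mulnC.
have dbe : be %| y.
  apply: squarefree_dvd_sqr; last by rewrite -E -mulnA dvdn_mulr.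
  by apply: (squarefree_dvd _ sk1); rewrite Ebe dvdn_mulr.
have dga : ga %| y.
  apply: squarefree_dvd_sqr; last by rewrite -E (mulnC be) -mulnA dvdn_mulr.
  by apply: (squarefree_dvd _ sk2); rewrite Ega dvdn_mulr.
have /dvdnP[m3 Em3] : be * ga %| y by rewrite Gauss_dvd // dbe.
exists al, be, ga, m1, m2, m3; split; [by rewrite Ebe (mulnC al)|by rewrite Ega (mulnC al)|].
apply/eqP; rewrite -(eqn_pmul2l (_ : 0 < be * ga)) ?muln_gt0 ?be0 // E Em3.
by apply/eqP; ring.
Qed.

Local Open Scope ring_scope.

(** * Galois action on the roots *)

Lemma irreducible_rat_separable (p : {poly rat}) :
  irreducible_poly p -> separable_poly p.
Proof.
move=> [sp irr_p]; rewrite unlock coprimep_def.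
have := irr_p (gcdp p p^`()); rewrite dvdp_gcdl => Hg; apply: contraT => sz1.
have /(eqp_dvdl (p^`())) := Hg sz1 isT; rewrite dvdp_gcdr => /esym /dvdp_leq Hle.
have p0 : p != 0 by rewrite -size_poly_gt0 ltnW.
have nz : p^`() != 0.
  apply/eqP=> /polyP/(_ (size p).-2); rewrite coef0 coef_deriv.
  have -> : (size p).-2.+1 = (size p).-1 by case: (size p) sp => [|[|n]].
  apply/eqP; rewrite mulrn_eq0 -lead_coefE lead_coef_eq0 (negPf p0) orbF.
  by case: (size p) sp => [|[|n]].
by have := leq_ltn_trans (Hle nz) (lt_size_deriv p0); rewrite ltnn.
Qed.

(** The conjugates of [z] generate a number field that is Galois over the rationals. Each of its
    automorphisms extends to [algC], so [z] is fixed by the whole Galois group. *)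
Lemma Crat_fixed_aut (z : algC) :
  (forall nu : {rmorphism algC -> algC}, nu z = z) -> z \in Crat.
Proof.
move=> fix_z; have [p [Dp mon_p] dv_p] := minCpolyP z.
have [r Dr] := closed_field_poly_normal (map_poly ratr p : {poly algC}).
rewrite lead_coef_map (monicP mon_p) rmorph1 scale1r in Dr.
have pz0 : root (map_poly ratr p) z by rewrite dv_p.
have rz : z \in r by rewrite -root_prod_XsubC -Dr.
have [Qr [QrC [rr Drr genQr]]] := num_field_exists r.
have [zz rr_zz Dz] : exists2 zz, zz \in rr & QrC zz = z.
  by move: rz; rewrite -Drr => /mapP[zz]; exists zz.
have Sinj_poly q : map_poly QrC (map_poly (in_alg Qr) q) = map_poly ratr q.
  rewrite -map_poly_comp; apply: eq_map_poly => a.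
  by rewrite /= rmorphZ_num rmorph1 mulr1.
have Dprr : map_poly (in_alg Qr) p = \prod_(x <- rr) ('X - x%:P).
  apply: (map_poly_inj QrC); rewrite Sinj_poly Dr -Drr big_map rmorph_prod /=.
  by apply: eq_bigr => i _; rewrite map_polyXsubC.
have Kp : map_poly (in_alg Qr) p \is a polyOver 1%VS.
  by apply/polyOverP=> i; rewrite coef_map /= memvZ ?mem1v.
have splitQr : splitting_field_axiom Qr.
  exists (map_poly (in_alg Qr) p) => //.
  by exists rr => //; rewrite Dprr eqpxx.
have irr_p : irreducible_poly p.
  apply/(subfx_irreducibleP pz0 (monic_neq0 mon_p))=> q qz0 nzq.
  by rewrite dvdp_leq // -dv_p.
pose Ls := FieldExt_isSplittingField.Build rat Qr splitQr.
pose L : splittingFieldType rat := HB.pack Qr Ls.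
have galL : galois 1 {: L}.
  apply/splitting_galoisField; exists (map_poly (in_alg Qr) p); split => //.
    by rewrite separable_map irreducible_rat_separable.
  by exists rr => //; rewrite Dprr eqpxx.
have /galois_fixedField fixL := galL.
have : (zz : L) \in fixedField 'Gal({:L} / 1)%g.
  apply/fixedFieldP; first exact: memvf.
  move=> x _; have [nu Dnu] := extend_algC_subfield_aut QrC (x : {rmorphism L -> L}).
  by apply: (fmorph_inj QrC); rewrite Dnu Dz fix_z.
rewrite fixL => /vlineP[a Da]; apply/CratP; exists a.
by rewrite -Dz Da rmorphZ_num rmorph1 mulr1.
Qed.

Lemma decbP (P : Prop) : reflect P (decb P).
Proof.
by rewrite /decb; case: ClassicalEpsilon.excluded_middle_informative => H; constructor.
Qed.

Lemma enum4 (T : finType) : #|T| = 4%N ->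
  exists x0 x1 x2 x3 : T, uniq [:: x0; x1; x2; x3] /\
    forall y, y \in [:: x0; x1; x2; x3].
Proof.
rewrite cardE; have := enum_uniq T; have := mem_enum T.
case: (enum T) => [|x0 [|x1 [|x2 [|x3 [|]]]]] // Hm U _.
by exists x0, x1, x2, x3; split => // y; rewrite Hm.
Qed.

Section Actions.
Import GroupScope.

(** Transitivity and commutativity make the action regular: an element with a fixed point is
    trivial. A nontrivial involution therefore exchanges two disjoint pairs, and the image of [x0]
    decides which ones. *)
Lemma klein_action (T : finType) (G : {group {perm T}}) :
    #|T| = 4%N -> abelian G -> {in G, forall s, s * s = 1} ->
    (forall x y, exists2 s : {perm T}, s \in G & s x = y) ->
  exists x0 x1 x2 x3 : T, uniq [:: x0; x1; x2; x3] /\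
   (forall s : {perm T}, s \in G -> (s x0, s x1, s x2, s x3) \in
     [:: (x0, x1, x2, x3); (x1, x0, x3, x2); (x2, x3, x0, x1); (x3, x2, x1, x0)]).
Proof.
move=> cT abG G2 trG; have [x0 [x1 [x2 [x3 [U all4]]]]] := enum4 cT.
exists x0, x1, x2, x3; split => // s Gs.
have fixall x : s x = x -> forall y, s y = y.
  move=> sx y; have [u Gu <-] := trG x y.
  by rewrite -!permM (centsP abG u Gu s Gs) permM sx.
have ss x : s (s x) = x by rewrite -permM G2 ?perm1.
have swap a b c e : uniq [:: a; b; c; e] -> (forall y, y \in [:: a; b; c; e]) ->
    s a = b -> [/\ s b = a, s c = e & s e = c].
  rewrite /= !inE !negb_or => /and4P[/and3P[nab nac _] /andP[nbc _] _ _] all_ sa.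
  have sb : s b = a by rewrite -sa ss.
  suff sc : s c = e by rewrite -{2}sc ss.
  have := all_ (s c); rewrite !inE => /or4P[] /eqP // sc.
  - by case/eqP: nbc; apply: (@perm_inj _ s); rewrite sc sb.
  - by case/eqP: nac; apply: (@perm_inj _ s); rewrite sc sa.
  - by case/eqP: nab; rewrite -sa (fixall c).
have [n01 [n02 n03]] : x0 != x1 /\ x0 != x2 /\ x0 != x3.
  by move: U; rewrite /= !inE !negb_or => /and4P[/and3P[-> -> ->]].
have := all4 (s x0); rewrite !inE => /or4P[] /eqP s0.
- by have fx := fixall x0 s0; rewrite !fx eqxx.
- by have [-> -> ->] := swap x0 x1 x2 x3 U all4 s0; rewrite s0 eqxx orbT.
- have p : perm_eq [:: x0; x1; x2; x3] [:: x0; x2; x1; x3].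
    by apply/seq.permP=> P /=; rewrite (addnCA (P x1)).
  have [|y|-> -> ->] // := swap x0 x2 x1 x3 _ _ s0; last by rewrite s0 eqxx !orbT.
    by rewrite -(perm_uniq p).
  by rewrite -(perm_mem p).
- have p : perm_eq [:: x0; x1; x2; x3] [:: x0; x3; x1; x2].
    by apply/seq.permP=> P /=; rewrite !addn0 (addnA (P x1)) (addnC (P x3)).
  have [|y|-> -> ->] // := swap x0 x3 x1 x2 _ _ s0; last by rewrite s0 eqxx !orbT.
    by rewrite -(perm_uniq p).
  by rewrite -(perm_mem p).
Qed.

(** Any point serves as [x0], the others being its successive images under a generator; transitivity
    makes these exhaust the four points. *)
Lemma cyclic_action (T : finType) (G : {group {perm T}}) :
    #|T| = 4%N -> cyclic G -> #|G| = 4%N ->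
    (forall x y, exists2 s : {perm T}, s \in G & s x = y) ->
  exists x0 x1 x2 x3 : T, uniq [:: x0; x1; x2; x3] /\
   (forall s : {perm T}, s \in G -> (s x0, s x1, s x2, s x3) \in
     [:: (x0, x1, x2, x3); (x1, x2, x3, x0); (x2, x3, x0, x1); (x3, x0, x1, x2)]).
Proof.
move=> cT /cyclicP[g defG] oG trG; have [x0 _] := enum4 cT.
have g4 : g ^+ 4 = 1 by rewrite -oG defG expg_order.
have memG s : s \in G -> exists2 k, (k < 4)%N & s = g ^+ k.
  rewrite defG => /cyclePmin[k]; rewrite -[#[g]]/#|<[g]>| -defG oG; by exists k.
exists x0, (g x0), (g (g x0)), (g (g (g x0))).
have g4x : g (g (g (g x0))) = x0.
  by have := congr1 (fun u : {perm T} => u x0) g4; rewrite !expgS expg0 !permM !perm1.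
have E k x : (g ^+ k) x = iter k g x by rewrite permX.
split; last first.
  move=> s /memG[k k4 ->]; rewrite !E !inE.
  by case: k k4 => [|[|[|[|k]]]] // _ /=; rewrite ?g4x eqxx ?orbT.
set l := [:: _; _; _; _].
have sub : {subset [seq x | x <- enum T] <= l}.
  move=> y _; have [s /memG[k k4 ->] <-] := trG x0 y.
  by rewrite E !inE; case: k k4 => [|[|[|[|k]]]] // _ /=; rewrite eqxx ?orbT.
apply: (@leq_size_uniq _ (enum T)); rewrite ?enum_uniq -?cardE ?cT //.
by move=> y ye; apply: sub; rewrite map_id.
Qed.
End Actions.

Lemma Crat_poly (q : {poly algC}) :
  (forall nu : {rmorphism algC -> algC}, map_poly nu q = q) ->
  exists q0 : {poly rat}, q = map_poly ratr q0.
Proof.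
move=> fixq; have qQ i : q`_i \in Crat.
  by apply: Crat_fixed_aut => nu; rewrite -[in RHS](fixq nu) coef_map.
exists (map_poly getCrat q); rewrite -map_poly_comp map_poly_id // => x.
by move=> /(nthP 0)[i _ <-] /=; apply: getCratK.
Qed.

(** Transitivity is where irreducibility enters: the product of the factors ['X - r] over one orbit
    is fixed by every automorphism, hence rational, and it is a nonconstant divisor of [p]. *)
Lemma galois_roots (p : {poly rat}) : irreducible_poly p -> p \is monic ->
  [/\ map_poly ratr p = \prod_(i < size (rootsC p)) ('X - ((rootsC p)`_i)%:P),
      uniq (rootsC p),
      forall nu : {rmorphism algC -> algC}, exists2 s, s \in galgrp p &
        forall i : 'I_(size (rootsC p)), nu (rootsC p)`_i = (rootsC p)`_(s i)
    & forall i j : 'I_(size (rootsC p)), exists2 s, s \in galgrp p & s i = j].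
Proof.
move=> irr_p mon_p.
have Dp : map_poly ratr p = \prod_(z <- rootsC p) ('X - z%:P) :> {poly algC}.
  rewrite /rootsC; case: closed_field_poly_normal => r /= Dr.
  by rewrite {1}Dr lead_coef_map (monicP mon_p) rmorph1 scale1r.
have Ur : uniq (rootsC p).
  by rewrite -separable_prod_XsubC -Dp separable_map irreducible_rat_separable.
set r := rootsC p in Dp Ur *.
have nuP nu : exists2 s, s \in galgrp p &
    forall i : 'I_(size r), (nu : {rmorphism algC -> algC}) r`_i = r`_(s i).
  have nuroot i : (i < size r)%N -> nu r`_i \in r.
    move=> ir; rewrite -root_prod_XsubC -Dp.
    have -> : map_poly ratr p = map_poly nu (map_poly ratr p).
      by rewrite -map_poly_comp; apply: eq_map_poly => a /=; rewrite fmorph_rat.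
    by rewrite fmorph_root Dp root_prod_XsubC mem_nth.
  have idx (i : 'I_(size r)) : (index (nu (nth 0%R r i)) r < size r)%N.
    by rewrite index_mem nuroot.
  pose f (i : 'I_(size r)) := Ordinal (idx i).
  have finj : injective f.
    move=> i j /(congr1 (fun k : 'I_(size r) => r`_k)) /=.
    rewrite !nth_index ?nuroot // => /fmorph_inj/eqP.
    by rewrite nth_uniq // => /eqP/val_inj.
  have fP (i : 'I_(size r)) : nu r`_i = r`_(perm finj i) by rewrite permE /= nth_index ?nuroot.
  exists (perm finj) => //; apply: mem_gen; rewrite inE; apply/decbP.
  by exists nu.
have Dp' : map_poly ratr p = \prod_(i < size r) ('X - (r`_i)%:P) :> {poly algC}.
  by rewrite Dp (big_nth 0) big_mkord.
split => // i j.
pose O := orbit 'P (galgrp p) i.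
pose q : {poly algC} := \prod_(k in O) ('X - (r`_k)%:P).
have [|q0 Dq] := @Crat_poly q.
  move=> nu; rewrite /q rmorph_prod /=; have [s Gs sP] := nuP nu.
  rewrite [RHS](reindex_inj (@perm_inj _ s)) /=; apply: eq_big => [k|k _].
    by rewrite -[s k]/(aperm k s) /O (@orbit_actr _ _ (perm_action _) _ _ i k Gs).  
  by rewrite map_polyXsubC sP.
have q0p : q0 %| p.
  rewrite -(dvdp_map (ratr : {rmorphism rat -> algC})) /= -Dq Dp' (bigID (mem O)) /=.
  exact: dvdp_mulr.
have szq : size q0 = #|O|.+1.
  rewrite -(size_map_poly (ratr : {rmorphism rat -> algC})) /= -Dq /q.
  by rewrite size_prod_XsubC_ord || rewrite -big_enum /= size_prod_XsubC -cardE.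
have Oi : i \in O by apply: orbit_refl.
have /eqp_size szp : q0 %= p.
  apply: irr_p.2 => //; rewrite szq eqSS -lt0n; apply/card_gt0P; by exists i.
have Ofull : O = setT.
  apply/eqP; rewrite eqEcard subsetT /= cardsT card_ord.
  rewrite -ltnS -szq szp -(size_map_poly (ratr : {rmorphism rat -> algC})) /= Dp.
  by rewrite size_prod_XsubC.
have : j \in O by rewrite Ofull inE.
by case/orbitP=> s Gs <-; exists s.
Qed.

(** * Integer invariants fixed by the Galois action *)

Definition vieta (a b c d : int) (r0 r1 r2 r3 : algC) : Prop :=
  [/\ a%:~R = - (r0 + r1 + r2 + r3),
      b%:~R = r0 * r1 + r0 * r2 + r0 * r3 + r1 * r2 + r1 * r3 + r2 * r3,
      c%:~R = - (r0 * r1 * r2 + r0 * r1 * r3 + r0 * r2 * r3 + r1 * r2 * r3)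
    & d%:~R = r0 * r1 * r2 * r3].

Lemma map_quartic (a b c d : int) :
  map_poly ratr (quartic a b c d) = 'X^4 + (a%:~R)%:P * 'X^3 + (b%:~R)%:P * 'X^2
     + (c%:~R)%:P * 'X + (d%:~R)%:P :> {poly algC}.
Proof.
by rewrite /quartic !mul_polyC !rmorphD /= !map_polyZ /= !(map_polyXn, map_polyX, map_polyC) /= !ratr_int.
Qed.

Lemma size_quartic (a b c d : int) : size (quartic a b c d) = 5%N.
Proof.
rewrite /quartic -!addrA size_polyDl size_polyXn // ltnS.
apply/leq_sizeP=> j; rewrite !coefD !coefCM !coefXn coefX coefC.
by case: j => [|[|[|[|j]]]] // _; rewrite !mulr0 !addr0.
Qed.

Lemma quartic_monic (a b c d : int) : quartic a b c d \is monic.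
Proof.
rewrite monicE lead_coefE size_quartic /quartic /= !coefD !coefCM !coefXn coefX coefC /=.
by rewrite !mulr0 !addr0.
Qed.

Lemma vietaP (a b c d : int) (r0 r1 r2 r3 : algC) :
  map_poly ratr (quartic a b c d) =
    ('X - r0%:P) * ('X - r1%:P) * ('X - r2%:P) * ('X - r3%:P) ->
  vieta a b c d r0 r1 r2 r3.
Proof.
rewrite map_quartic => E.
have {}E : 'X^4 + (a%:~R)%:P * 'X^3 + (b%:~R)%:P * 'X^2
     + (c%:~R)%:P * 'X + (d%:~R)%:P =
   'X^4 + (- (r0 + r1 + r2 + r3))%:P * 'X^3
   + (r0 * r1 + r0 * r2 + r0 * r3 + r1 * r2 + r1 * r3 + r2 * r3)%:P * 'X^2
   + (- (r0 * r1 * r2 + r0 * r1 * r3 + r0 * r2 * r3 + r1 * r2 * r3))%:P * 'X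
   + (r0 * r1 * r2 * r3)%:P :> {poly algC}.
  by rewrite E !(rmorphN, rmorphD, rmorphM) /=; ring.
split.
- have := congr1 (coefp 3) E; rewrite /= !coefD !coefCM !coefXn coefX !coefC /=.
  by rewrite !mulr0 !mulr1 !add0r !addr0.
- have := congr1 (coefp 2) E; rewrite /= !coefD !coefCM !coefXn coefX !coefC /=.
  by rewrite !mulr0 !mulr1 !add0r !addr0.
- have := congr1 (coefp 1) E; rewrite /= !coefD !coefCM !coefXn coefX !coefC /=.
  by rewrite !mulr0 !mulr1 !add0r !addr0.
- have := congr1 (coefp 0) E; rewrite /= !coefD !coefCM !coefXn coefX !coefC /=.
  by rewrite !mulr0 !add0r.
Qed.

(** The list [l] of admissible images is polymorphic so that one list can be read both on indices,
    where the permutation group acts, and on roots, where automorphisms act. The first hypothesis is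
    its naturality. *)
Lemma quartic_Galois_action (a b c d : int) (l : forall T, T -> T -> T -> T -> seq (T * T * T * T)) :
    (forall (n : nat) (h : 'I_n -> algC) x0 x1 x2 x3 y0 y1 y2 y3,
       (y0, y1, y2, y3) \in l 'I_n x0 x1 x2 x3 ->
       (h y0, h y1, h y2, h y3) \in l algC (h x0) (h x1) (h x2) (h x3)) ->
    irreducible_poly (quartic a b c d) ->
    (forall G : {group {perm 'I_(size (rootsC (quartic a b c d)))}},
       G = galgrp (quartic a b c d) ->
       #|'I_(size (rootsC (quartic a b c d)))| = 4%N ->
       (forall x y, exists2 s : {perm _}, s \in G & s x = y) ->
       exists x0 x1 x2 x3, uniq [:: x0; x1; x2; x3] /\
         forall s : {perm _}, s \in G -> (s x0, s x1, s x2, s x3) \in l _ x0 x1 x2 x3) ->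
  exists r0 r1 r2 r3 : algC, [/\ vieta a b c d r0 r1 r2 r3, uniq [:: r0; r1; r2; r3]
    & forall nu : {rmorphism algC -> algC},
        (nu r0, nu r1, nu r2, nu r3) \in l _ r0 r1 r2 r3].
Proof.
move=> lmap irr_f HG; set f := quartic a b c d in irr_f HG *.
have [Df Ur nuP trG] := galois_roots irr_f (quartic_monic _ _ _ _).
have szr : size (rootsC f) = 4%N.
  apply/eqP; rewrite -eqSS -(size_quartic a b c d).
  rewrite -[X in _ == X](size_map_poly (ratr : {rmorphism rat -> algC})) /= Df.
  by rewrite -big_enum /= size_prod_XsubC -cardE card_ord.
have [|x0 [x1 [x2 [x3 [Ux actG]]]]] := HG _ erefl _ trG; first by rewrite card_ord.
pose h (i : 'I_(size (rootsC f))) := (rootsC f)`_i.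
have hinj : injective h.
  by move=> i j /eqP; rewrite /h nth_uniq // => /eqP/val_inj.
have full : perm_eq (enum 'I_(size (rootsC f))) [:: x0; x1; x2; x3].
  rewrite perm_sym; apply: uniq_perm; rewrite ?enum_uniq //.
  have [//||_ //] := uniq_min_size Ux (s2 := enum 'I_(size (rootsC f))).
    by move=> y _; rewrite mem_enum.
  by rewrite -cardE card_ord; apply: eq_leq; apply: szr.
exists (h x0), (h x1), (h x2), (h x3); split.
- apply: vietaP; rewrite Df -big_enum /= (perm_big _ full) /=.
  by rewrite !big_cons big_nil mulr1 !mulrA.
- by rewrite -[[:: h x0; _; _; _]]/(map h [:: x0; x1; x2; x3]) map_inj_uniq.
- move=> nu; have [s Gs sP] := nuP nu; have E i : nu (h i) = h (s i) by apply: sP.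
  by rewrite !E; apply/lmap/actG.
Qed.

Definition klein_orbit T (x0 x1 x2 x3 : T) :=
  [:: (x0, x1, x2, x3); (x1, x0, x3, x2); (x2, x3, x0, x1); (x3, x2, x1, x0)].
Definition cyclic_orbit T (x0 x1 x2 x3 : T) :=
  [:: (x0, x1, x2, x3); (x1, x2, x3, x0); (x2, x3, x0, x1); (x3, x0, x1, x2)].

Lemma V4_roots (a b c d : int) :
    irreducible_poly (quartic a b c d) -> (galgrp (quartic a b c d) \isog V4)%g ->
  exists r0 r1 r2 r3 : algC, [/\ vieta a b c d r0 r1 r2 r3, uniq [:: r0; r1; r2; r3]
    & forall nu : {rmorphism algC -> algC},
        (nu r0, nu r1, nu r2, nu r3) \in klein_orbit r0 r1 r2 r3].
Proof.
move=> irr_f isoG; apply: quartic_Galois_action => //.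
  move=> n h x0 x1 x2 x3 y0 y1 y2 y3; rewrite !inE.
  by case/or4P=> /eqP[-> -> -> ->]; rewrite eqxx ?orbT.
move=> G defG c4 trG; move: isoG; rewrite -defG => /isogP[phi injphi imphi].
have mphi x y : x \in G -> y \in G -> phi x = phi y -> x = y.
  by move=> Gx Gy; apply: (injmP injphi).
apply: klein_action => //.
  apply/centsP=> x Gx y Gy; apply: mphi; rewrite ?groupM // !morphM //.
  by case: (phi x) (phi y) => u1 u2 [v1 v2]; congr (_, _); apply: Zp_mulgC.
move=> x Gx; apply: mphi; rewrite ?groupM ?group1 // morphM // morph1.
case: (phi x) => u v; congr (_, _).
  by case: u => [[|[|m]]] // ?; apply: val_inj.
by case: v => [[|[|m]]] // ?; apply: val_inj.
Qed.

Lemma C4_roots (a b c d : int) :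
    irreducible_poly (quartic a b c d) -> (galgrp (quartic a b c d) \isog C4)%g ->
  exists r0 r1 r2 r3 : algC, [/\ vieta a b c d r0 r1 r2 r3, uniq [:: r0; r1; r2; r3]
    & forall nu : {rmorphism algC -> algC},
        (nu r0, nu r1, nu r2, nu r3) \in cyclic_orbit r0 r1 r2 r3].
Proof.
move=> irr_f isoG; apply: quartic_Galois_action => //.
  move=> n h x0 x1 x2 x3 y0 y1 y2 y3; rewrite !inE.
  by case/or4P=> /eqP[-> -> -> ->]; rewrite eqxx ?orbT.
move=> G defG c4 trG; move: isoG; rewrite -defG => isoG.
have cycZ : cyclic (Zp 4) by apply/cyclicP; exists Zp1; rewrite /Zp /= Zp_cycle.
apply: cyclic_action => //.
  by rewrite (isog_cyclic isoG).
by rewrite (card_isog isoG) /C4 card_Zp.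
Qed.

Lemma vieta_Aint (a b c d : int) (r0 r1 r2 r3 : algC) : vieta a b c d r0 r1 r2 r3 ->
  [/\ r0 \in Aint, r1 \in Aint, r2 \in Aint & r3 \in Aint].
Proof.
case=> Ea Eb Ec Ed.
suff rootA r : r ^+ 4 + a%:~R * r ^+ 3 + b%:~R * r ^+ 2 + c%:~R * r + d%:~R = 0 ->
    r \in Aint by split; apply: rootA; rewrite Ea Eb Ec Ed; ring.
move=> r0'; pose p : {poly algC} := map_poly ratr (quartic a b c d).
apply: (@root_monic_Aint p).
- rewrite /root /p map_quartic !mul_polyC !hornerE; apply/eqP; rewrite -r0'.
  by rewrite /=; ring.
- by rewrite /p map_monic quartic_monic.
- apply/polyOverP=> i; rewrite /p map_quartic !coefD !coefCM !coefXn coefX coefC.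
  by case: (i == 0%N); rewrite !rpredD ?rpredM ?rpred_nat ?rpred_int ?rpred0.
Qed.

Lemma int_fixed (z : algC) : z \in Aint ->
  (forall nu : {rmorphism algC -> algC}, nu z = z) -> exists n : int, n%:~R = z.
Proof.
move=> Az fz; have /intrP[n ->] := Cint_rat_Aint (Crat_fixed_aut fz) Az.
by exists n.
Qed.

(** A double transposition preserves each of the three ways to split the roots into two pairs, so
    the whole cubic resolvent splits over the integers. *)
Lemma V4_int (a b c d : int) :
    irreducible_poly (quartic a b c d) -> (galgrp (quartic a b c d) \isog V4)%g ->
  exists r0 r1 r2 r3 : algC, vieta a b c d r0 r1 r2 r3 /\
  exists x1 x2 x3 : int, [/\ x1%:~R = r0 * r1 + r2 * r3, x2%:~R = r0 * r2 + r1 * r3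
    & x3%:~R = r0 * r3 + r1 * r2].
Proof.
move=> irr_f isoG; have [r0 [r1 [r2 [r3 [V _ act]]]]] := V4_roots irr_f isoG.
exists r0, r1, r2, r3; split => //; have [A0 A1 A2 A3] := vieta_Aint V.
have [||x1 E1] := @int_fixed (r0 * r1 + r2 * r3); first by rewrite rpredD ?rpredM.
  move=> nu; have := act nu; rewrite !inE rmorphD !rmorphM /=.
  by case/or4P=> /eqP[-> -> -> ->]; ring.
have [||x2 E2] := @int_fixed (r0 * r2 + r1 * r3); first by rewrite rpredD ?rpredM.
  move=> nu; have := act nu; rewrite !inE rmorphD !rmorphM /=.
  by case/or4P=> /eqP[-> -> -> ->]; ring.
have [||x3 E3] := @int_fixed (r0 * r3 + r1 * r2); first by rewrite rpredD ?rpredM.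
  move=> nu; have := act nu; rewrite !inE rmorphD !rmorphM /=.
  by case/or4P=> /eqP[-> -> -> ->]; ring.
by exists x1, x2, x3.
Qed.

(** A generator sends [r0 - r2] to [r1 - r3] and [r1 - r3] to [r2 - r0]. It changes the sign of
    [r0 + r2 - r1 - r3], of the difference of the two squares and of the product of the two
    differences, so products of two of these quantities are invariant; [x] pairs the opposite roots
    of the 4-cycle. *)
Lemma C4_int (a b c d : int) :
    irreducible_poly (quartic a b c d) -> (galgrp (quartic a b c d) \isog C4)%g ->
  exists r0 r1 r2 r3 : algC, [/\ vieta a b c d r0 r1 r2 r3, r0 != r2, r1 != r3 &
  exists x n1 n2 : int, [/\ x%:~R = r0 * r2 + r1 * r3,
    n1%:~R = (r0 + r2 - r1 - r3) * ((r0 - r2) ^+ 2 - (r1 - r3) ^+ 2)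
    & n2%:~R = (r0 + r2 - r1 - r3) * (2 * (r0 - r2) * (r1 - r3))]].
Proof.
move=> irr_f isoG; have [r0 [r1 [r2 [r3 [V U act]]]]] := C4_roots irr_f isoG.
exists r0, r1, r2, r3; have [A0 A1 A2 A3] := vieta_Aint V.
move: U; rewrite /= !inE !negb_or => /and4P[/and3P[_ n02 _] /andP[_ n13] _ _].
split => //.
have [||x E] := @int_fixed (r0 * r2 + r1 * r3); first by rewrite rpredD ?rpredM.
  move=> nu; have := act nu; rewrite !inE rmorphD !rmorphM /=.
  by case/or4P=> /eqP[-> -> -> ->]; ring.
have Ath : r0 + r2 - r1 - r3 \in Aint by rewrite !rpredB ?rpredD.
have [||n1 E1] := @int_fixed ((r0 + r2 - r1 - r3) * ((r0 - r2) ^+ 2 - (r1 - r3) ^+ 2)).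
- by rewrite rpredM // rpredB // rpredX // rpredB.
- move=> nu; have := act nu; rewrite !inE !(rmorphM, rmorphB, rmorphD, rmorphXn) /=.
  by case/or4P=> /eqP[-> -> -> ->]; ring.
have [||n2 E2] := @int_fixed ((r0 + r2 - r1 - r3) * (2 * (r0 - r2) * (r1 - r3))).
- by rewrite rpredM // rpredM ?rpredB // rpredM ?rpredB // rpred_nat.
- move=> nu; have := act nu; rewrite !inE !(rmorphM, rmorphB, rmorphD, rmorph_nat) /=.
  by case/or4P=> /eqP[-> -> -> ->]; ring.
by exists x, n1, n2.
Qed.

(** * The smallest root and the resolvent *)

(** With [m] and [M] the least and greatest absolute values, [M * m ^ 3 <= H] and [X <= 16 * M ^ 2].
    If [m >= 1] these give the bound with 17 in place of 41; if [m <= 1] it reduces to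
    [X + H <= 41 * H ^ 2]. Fourth powers keep the statement free of radicals. *)
Lemma small_root (r : 'I_4 -> algC) (H X : nat) : (0 < H)%N ->
    `|\prod_i r i| <= H%:R -> X%:R <= (\sum_i `|r i|) ^+ 2 -> (X <= 40 * H ^ 2)%N ->
  exists i, `|r i| ^+ 4 * (X + H)%:R <= (41 * H ^ 2)%:R.
Proof.
move=> H0 prod_le X_le XH.
have real_r (i : 'I_4) : xpredT i -> `|r i| \is Num.real by rewrite normr_real.
have [i _ min_i] := @real_arg_minP _ _ ord0 xpredT (fun i => `|r i|) isT real_r.
have [j _ max_j] := @real_arg_maxP _ _ ord0 xpredT (fun i => `|r i|) isT real_r.
set m := `|r i| in min_i; set M := `|r j| in max_j.
have m0 : 0 <= m by rewrite normr_ge0.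
have M0 : 0 <= M by rewrite normr_ge0.
have mM : m <= M by apply: min_i.
have prod_ge : M * m ^+ 3 <= H%:R.
  apply: le_trans prod_le; rewrite normr_prod (bigD1 j) //= ler_wpM2l //.
  have <- : \prod_(k : 'I_4 | k != j) m = m ^+ 3.
    by rewrite prodr_const cardC1 card_ord.
  by apply: ler_prod => k _; rewrite m0 min_i.
have {X_le} X_le : X%:R <= 16 * M ^+ 2.
  apply: le_trans X_le _; have -> : 16 * M ^+ 2 = (4 * M) ^+ 2 by ring.
  rewrite ler_sqr ?nnegrE ?mulr_ge0 ?sumr_ge0 //.
  apply: le_trans (_ : \sum_(k < 4) M <= _); first by apply: ler_sum => k _; apply: max_j.
  by rewrite sumr_const card_ord mulr_natl.
exists i; rewrite -/m.
have HR : (1 : algC) <= H%:R by rewrite ler1n.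
have H0' : (0 : algC) <= H%:R by rewrite ler0n.
have X0 : (0 : algC) <= X%:R by rewrite ler0n.
have [m1|m1] := real_leP (real_r i isT) (real1 _); rewrite -/m in m1.
  apply: le_trans (_ : (X + H)%:R <= _).
    by rewrite ler_piMl ?ler0n // exprn_ile1.
  by rewrite ler_nat -[41%N]/(40 + 1)%N mulnDl mul1n leq_add // -mulnn leq_pmulr.
have m1' : 1 <= m by apply: ltW.
have e1 : m ^+ 4 * X%:R <= 16 * H%:R ^+ 2.
  apply: le_trans (_ : m ^+ 4 * (16 * M ^+ 2) <= _).
    by rewrite ler_wpM2l ?exprn_ge0.
  apply: le_trans (_ : 16 * (M * m ^+ 3) ^+ 2 <= _).
    have -> : 16 * (M * m ^+ 3) ^+ 2 = m ^+ 2 * (m ^+ 4 * (16 * M ^+ 2)) by ring.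
    by rewrite ler_peMl ?exprn_ege1 // !mulr_ge0 ?exprn_ge0.
  by rewrite ler_wpM2l // ler_sqr ?nnegrE ?mulr_ge0 ?exprn_ge0.
have e2 : m ^+ 4 * H%:R <= H%:R ^+ 2.
  rewrite [_ ^+ 2]expr2 ler_wpM2r //; apply: le_trans prod_ge.
  by rewrite exprS ler_wpM2r ?exprn_ge0.
rewrite natrD mulrDr natrM natrX; apply: le_trans (lerD e1 e2) _.
rewrite -[X in _ + X]mul1r -mulrDl ler_wpM2r ?exprn_ge0 //.
by rewrite -[16]/(16%:R) -[1]/(1%:R) -natrD ler_nat.
Qed.

Definition sgn (e : bool) : algC := (-1) ^+ e.

Lemma sqrtC_sgn (z : algC) : exists e, z = sgn e * sqrtC (z ^+ 2).
Proof.
have /orP[/eqP E|/eqP E] : (z == sqrtC (z ^+ 2)) || (z == - sqrtC (z ^+ 2)).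
  by rewrite -eqf_sqr sqrtCK.
- by exists false; rewrite /sgn mul1r.
- by exists true; rewrite /sgn expr1 mulN1r.
Qed.

(* For [tau] the part of [a] made of square roots attached to the resolvent, [a - tau] is
   [-4] times a root, so this expresses that one root is small. *)
Definition near_centre (H X : nat) (a : int) (tau : algC) : Prop :=
  `|a%:~R - tau| ^+ 4 * (X + H)%:R <= (11 ^ 4 * H ^ 2)%:R.

Lemma near_centre_root (H X : nat) (a : int) (r tau : algC) :
  a%:~R - tau = - (4 * r) -> `|r| ^+ 4 * (X + H)%:R <= (41 * H ^ 2)%:R ->
  near_centre H X a tau.
Proof.
move=> E; rewrite /near_centre E normrN normrM exprMn normr_nat => le.
(* [4 ^ 4 * 41 = 10496] is rounded up to the fourth power [11 ^ 4 = 14641]. *)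
have le4 : ((4 ^ 4 * (41 * H ^ 2))%:R : algC) <= (11 ^ 4 * H ^ 2)%:R.
  by rewrite ler_nat mulnA leq_mul2r orbC.
apply: le_trans le4.
by rewrite -mulrA [X in _ <= X]natrM natrX ler_wpM2l ?exprn_ge0 ?ler0n.
Qed.

(** The constant comes from [(u + v) ^ 4 <= 8 * (u ^ 4 + v ^ 4)] and [8 * 2 * 11 ^ 4 = 22 ^ 4]. *)
Lemma near_centre_dist (H X : nat) (a a' : int) (tau : algC) :
  near_centre H X a tau -> near_centre H X a' tau ->
  (`|a - a'| ^ 4 * (X + H) <= 22 ^ 4 * H ^ 2)%N.
Proof.
rewrite /near_centre => h h'; set u := `|_| in h; set v := `|_| in h'.
have le : `|a - a'|%N%:R <= u + v :> algC.
  rewrite natr_absz -[X in X <= _]ger0_norm ?intr_norm ?ler0n ?normr_ge0 //.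
  have -> : `|(a - a')%:~R : algC| = `|(a%:~R - tau) - (a'%:~R - tau)|.
    by rewrite rmorphB /=; congr `|_|; ring.
  by rewrite normr_id; apply: ler_normB.
have u0 : 0 <= u by rewrite normr_ge0.
have v0 : 0 <= v by rewrite normr_ge0.
have le4 : `|a - a'|%N%:R ^+ 4 <= 8 * (u ^+ 4 + v ^+ 4).
  apply: le_trans (_ : (u + v) ^+ 4 <= _).
    by rewrite lerXn2r // nnegrE ?addr_ge0 ?ler0n.
  have sq2 (x y : algC) : x \is Num.real -> y \is Num.real ->
      (x + y) ^+ 2 <= 2 * (x ^+ 2 + y ^+ 2).
    move=> rx ry; rewrite -subr_ge0.
    have -> : 2 * (x ^+ 2 + y ^+ 2) - (x + y) ^+ 2 = (x - y) ^+ 2 by ring.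
    by rewrite real_exprn_even_ge0 // rpredB.
  have -> : (u + v) ^+ 4 = ((u + v) ^+ 2) ^+ 2 by ring.
  have ru : u \is Num.real by rewrite normr_real.
  have rv : v \is Num.real by rewrite normr_real.
  apply: le_trans (_ : (2 * (u ^+ 2 + v ^+ 2)) ^+ 2 <= _).
    by rewrite ler_sqr ?sq2 ?nnegrE ?mulr_ge0 ?addr_ge0 ?exprn_ge0 ?addr_ge0.
  rewrite exprMn; have -> : 8 * (u ^+ 4 + v ^+ 4)
    = 2 ^+ 2 * (2 * ((u ^+ 2) ^+ 2 + (v ^+ 2) ^+ 2)) by ring.
  by rewrite ler_wpM2l ?exprn_ge0 // sq2 ?rpredX.
rewrite -(ler_nat algC) natrM natrX.
apply: le_trans (_ : 8 * (u ^+ 4 + v ^+ 4) * (X + H)%:R <= _).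
  by rewrite ler_wpM2r ?ler0n.
have -> : (22 ^ 4 * H ^ 2)%N = (8 * (11 ^ 4 * H ^ 2 + 11 ^ 4 * H ^ 2))%N.
  by rewrite addnn -mul2n -[22%N]/(2 * 11)%N expnMn !mulnA.
by rewrite -mulrA (mulrDl (u ^+ 4)) [X in _ <= X]natrM ler_wpM2l ?ler0n // (natrD _ (11 ^ 4 * H ^ 2)%N) lerD.
Qed.

(** The cubic is the resolvent of the quartic. Its lower coefficients are at most [h], [5 * h ^ 2]
    and [6 * h ^ 3], and beyond [4 * h] the lower terms stay below the cube because
    [1/4 + 5/16 + 6/64 < 1]. *)
Lemma resolvent_root_bound (H : nat) (a b c d x : int) : (0 < H)%N ->
  `|a| <= H%:Z -> `|b| <= H%:Z -> `|c| <= H%:Z -> `|d| <= H%:Z ->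
  x ^+ 3 - b * x ^+ 2 + (a * c - 4 * d) * x - (a ^+ 2 * d - 4 * b * d + c ^+ 2) = 0 ->
  `|x| <= 4 * H%:Z.
Proof.
move=> H0 ha hb hc hd E; rewrite leNgt; apply/negP=> lt.
set h := H%:Z in ha hb hc hd lt; have h1 : 1 <= h by rewrite /h; lia.
have Ex : `|x| ^+ 3 <= h * `|x| ^+ 2 + 5 * h ^+ 2 * `|x| + 6 * h ^+ 3.
  have -> : `|x| ^+ 3 = `|b * x ^+ 2 - (a * c - 4 * d) * x +
      (a ^+ 2 * d - 4 * b * d + c ^+ 2)|.
    by rewrite -normrX; congr `|_|; move/eqP: E; rewrite subr_eq0 => /eqP <-; ring.
  apply: le_trans (ler_normD _ _) _; apply: lerD.
    apply: le_trans (ler_normB _ _) _; apply: lerD.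
      by rewrite normrM normrX ler_wpM2r ?exprn_ge0.
    rewrite normrM ler_wpM2r //; apply: le_trans (ler_normB _ _) _.
    rewrite !normrM; have := ler_pM (normr_ge0 a) (normr_ge0 c) ha hc.
    have : h <= h ^+ 2 by rewrite expr2 ler_peMl // (le_trans ler01).
    rewrite (_ : `|4| = 4) // -(expr2 h).
    by move: (h ^+ 2) (`|a| * `|c|) `|d| hd => h2 ac d' hd'; lia.
  apply: le_trans (ler_normD _ _) _.
  apply: le_trans (lerD (ler_normB _ _) (lexx _)) _.
  rewrite !(normrM, normrX) (_ : `|4| = 4) //.
  have e1 := ler_pM (normr_ge0 b) (normr_ge0 d) hb hd.
  have e2 : `|c| ^+ 2 <= h ^+ 2 by rewrite lerXn2r ?nnegrE ?normr_ge0 //; lia.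
  have e3 : `|a| ^+ 2 * `|d| <= h ^+ 2 * h.
    by rewrite ler_pM ?exprn_ge0 // lerXn2r ?nnegrE ?normr_ge0 //; lia.
  have e4 : h ^+ 2 <= h ^+ 3 by rewrite ler_weXn2l.
  by lra.
set y := `|x| in lt Ex.
have y0 : 0 <= y by rewrite normr_ge0.
have e1 : 4 * h * y ^+ 2 <= y ^+ 3.
  by rewrite [y ^+ 3]exprS ler_wpM2r ?exprn_ge0 // ltW.
have e2 : 4 * h ^+ 2 * y <= h * y ^+ 2.
  have -> : 4 * h ^+ 2 * y = (h * y) * (4 * h) by ring.
  have -> : h * y ^+ 2 = (h * y) * y by ring.
  by rewrite ler_wpM2l ?mulr_ge0 // ?ltW //; lia.
have e3 : 4 * h ^+ 3 <= h ^+ 2 * y.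
  have -> : 4 * h ^+ 3 = h ^+ 2 * (4 * h) by ring.
  by rewrite ler_wpM2l ?exprn_ge0 // ?ltW //; lia.
have e4 : 1 <= h ^+ 3 by rewrite exprn_ege1.
by lra.
Qed.

Lemma resolvent_disc_bound (h a b x : int) : a ^+ 2 <= h ^+ 2 -> 0 <= a ^+ 2 ->
  h <= h ^+ 2 -> `|b| <= h -> `|x| <= 4 * h -> `|a ^+ 2 - 4 * b + 4 * x| <= 21 * h ^+ 2.
Proof. by move=> ? ? ? /ler_normlP[? ?] /ler_normlP[? ?]; apply/ler_normlP; split; lra. Qed.

Lemma resolvent_disc_diff (h a b x y : int) : `|x| <= 4 * h -> `|y| <= 4 * h ->
  `|a ^+ 2 - 4 * b + 4 * x - (a ^+ 2 - 4 * b + 4 * y)| <= 32 * h.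
Proof. by move=> /ler_normlP[? ?] /ler_normlP[? ?]; apply/ler_normlP; split; lra. Qed.

(** * Integer data attached to a Klein quartic *)

Definition box4 (H : nat) (t : int * int * int * int) : Prop :=
  let: (a, b, c, d) := t in
  [/\ `|a| <= H%:Z, `|b| <= H%:Z, `|c| <= H%:Z & `|d| <= H%:Z].

(** [A1], [A2], [A3] are the squares of [r0 + r1 - r2 - r3] and its two analogues; the numbers [x1],
    [x2], [x3] are the roots of the cubic resolvent. Closeness to the centre is recorded for all
    three heights, which makes the notion symmetric and lets the invariants be reordered. The signs
    are existential because they depend on which root is small. *)
Definition v4data (H : nat) (t : int * int * int * int) (A1 A2 A3 : int) : Prop :=
  let: (a, b, c, d) := t in
  [/\ exists x1 x2 x3 : int, [/\ A1 = a ^+ 2 - 4 * b + 4 * x1, A2 = a ^+ 2 - 4 * b + 4 * x2,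
        A3 = a ^+ 2 - 4 * b + 4 * x3, x1 + x2 + x3 = b
        & x1 * x2 + x1 * x3 + x2 * x3 = a * c - 4 * d],
      [/\ `|A1 - A2| <= 32 * H%:Z, `|A1 - A3| <= 32 * H%:Z & `|A2 - A3| <= 32 * H%:Z],
      [/\ `|A1| <= 21 * H%:Z ^+ 2, `|A2| <= 21 * H%:Z ^+ 2 & `|A3| <= 21 * H%:Z ^+ 2],
      A1 * A2 * A3 = (a ^+ 3 - 4 * a * b + 8 * c) ^+ 2
    & forall A, A \in [:: A1; A2; A3] -> exists e1 e2 e3, near_centre H `|A| a
        (sgn e1 * sqrtC A1%:~R + sgn e2 * sqrtC A2%:~R + sgn e3 * sqrtC A3%:~R)].

Lemma v4data_swap12 H t A1 A2 A3 : v4data H t A1 A2 A3 -> v4data H t A2 A1 A3.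
Proof.
case: t => [[[a b] c] d] [[x1 [x2 [x3 [E1 E2 E3 E4 E5]]]] [n1 n2 n3] [m1 m2 m3] P N].
split => //.
- exists x2, x1, x3; split => //; [rewrite -E4; ring|rewrite -E5; ring].
- by rewrite distrC.
- by rewrite (mulrC A2).
- move=> A hA; have [|e1 [e2 [e3 h]]] := N A; first by move: hA; rewrite !inE orbCA.
  by exists e2, e1, e3; rewrite (addrC (sgn e2 * _)).
Qed.

Lemma v4data_swap23 H t A1 A2 A3 : v4data H t A1 A2 A3 -> v4data H t A1 A3 A2.
Proof.
case: t => [[[a b] c] d] [[x1 [x2 [x3 [E1 E2 E3 E4 E5]]]] [n1 n2 n3] [m1 m2 m3] P N].
split => //.
- exists x1, x3, x2; split => //; [rewrite -E4; ring|rewrite -E5; ring].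
- by rewrite (distrC A3).
- by rewrite mulrAC.
- move=> A hA; have [|e1 [e2 [e3 h]]] := N A; first by move: hA; rewrite !inE (orbC (A == A3)).
  by exists e1, e3, e2; rewrite addrAC.
Qed.

Lemma V4_data (H : nat) (t : int * int * int * int) : (0 < H)%N -> box4 H t ->
    irreducible_poly (f_of t) -> (galgrp (f_of t) \isog V4)%g ->
  exists A1 A2 A3, v4data H t A1 A2 A3.
Proof.
move=> H0; case: t => [[[a b] c] d] /= [ha hb hc hd] irr_f isoG.
have [r0 [r1 [r2 [r3 [[Va Vb Vc Vd] [x1 [x2 [x3 [X1 X2 X3]]]]]]]]] := V4_int irr_f isoG.
pose res (x : int) := x ^+ 3 - b * x ^+ 2 + (a * c - 4 * d) * x
  - (a ^+ 2 * d - 4 * b * d + c ^+ 2).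
have toC (u v : int) : (u%:~R = v%:~R :> algC) -> u = v by move/intr_inj.
have R1 : res x1 = 0.
  by apply: toC; rewrite /res !(rmorphB, rmorphD, rmorphM, rmorphXn) /= X1 Va Vb Vc Vd; ring.
have R2 : res x2 = 0.
  by apply: toC; rewrite /res !(rmorphB, rmorphD, rmorphM, rmorphXn) /= X2 Va Vb Vc Vd; ring.
have R3 : res x3 = 0.
  by apply: toC; rewrite /res !(rmorphB, rmorphD, rmorphM, rmorphXn) /= X3 Va Vb Vc Vd; ring.
have := resolvent_root_bound H0 ha hb hc hd R1.
have := resolvent_root_bound H0 ha hb hc hd R2.
have := resolvent_root_bound H0 ha hb hc hd R3.
move=> B3 B2 B1.
have aa : a ^+ 2 <= H%:Z ^+ 2 
  by rewrite -[a ^+ 2]ger0_norm ?sqr_ge0 // normrX lerXn2r ?nnegrE ?normr_ge0.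
have a0 : 0 <= a ^+ 2 by apply: sqr_ge0.
have HH : H%:Z <= H%:Z ^+ 2 by rewrite expr2 ler_peMl //; lia.
pose A (x : int) := a ^+ 2 - 4 * b + 4 * x.
have AB x : `|x| <= 4 * H%:Z -> `|A x| <= 21 * H%:Z ^+ 2 by apply: resolvent_disc_bound.
exists (A x1), (A x2), (A x3); split.
- exists x1, x2, x3; split => //; apply: toC.
    by rewrite !rmorphD /= X1 X2 X3 Vb; ring.
  by rewrite !(rmorphB, rmorphD, rmorphM) /= X1 X2 X3 Va Vc Vd; ring.
- by split; apply: resolvent_disc_diff.
- by split; apply: AB.
- apply: toC; rewrite /A !(rmorphB, rmorphD, rmorphM, rmorphXn) /= X1 X2 X3 Va Vb Vc; ring.
pose t1 := r0 + r1 - r2 - r3; pose t2 := r0 + r2 - r1 - r3; pose t3 := r0 + r3 - r1 - r2.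
have T1 : t1 ^+ 2 = (A x1)%:~R.
  by rewrite /A /t1 !(rmorphB, rmorphD, rmorphM, rmorphXn) /= X1 Va Vb; ring.
have T2 : t2 ^+ 2 = (A x2)%:~R.
  by rewrite /A /t2 !(rmorphB, rmorphD, rmorphM, rmorphXn) /= X2 Va Vb; ring.
have T3 : t3 ^+ 2 = (A x3)%:~R.
  by rewrite /A /t3 !(rmorphB, rmorphD, rmorphM, rmorphXn) /= X3 Va Vb; ring.
have [f1 F1] := sqrtC_sgn t1; have [f2 F2] := sqrtC_sgn t2; have [f3 F3] := sqrtC_sgn t3.
rewrite T1 in F1; rewrite T2 in F2; rewrite T3 in F3.
pose r (i : 'I_4) := [:: r0; r1; r2; r3]`_i.
have prod_r : `|\prod_i r i| <= H%:R.
  rewrite !big_ord_recr big_ord0 /= /r /= mul1r -Vd -intr_norm.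
  by rewrite -[H%:R]/((H%:Z)%:~R) ler_int.
have sum_r : \sum_i `|r i| = `|r0| + `|r1| + `|r2| + `|r3|.
  by rewrite !big_ord_recr big_ord0 /= /r /= add0r.
have four (s : algC) (q : algC) (z1 z2 z3 z4 : algC) : q ^+ 2 = s ->
    (q = z1 + z2 - z3 - z4) -> `|s| <= (`|z1| + `|z2| + `|z3| + `|z4|) ^+ 2.
  move=> <- ->; rewrite normrX lerXn2r ?nnegrE ?addr_ge0 ?normr_ge0 //.
  by rewrite !(le_trans (ler_normB _ _)) ?lerD ?ler_normD // !(le_trans (ler_normB _ _)) ?lerD ?ler_normD.
move=> B hB.
have Bbound : (`|B|%N%:R : algC) <= (\sum_i `|r i|) ^+ 2.
  rewrite natr_absz -[X in X%:~R]/(`|B|) intr_norm sum_r; move: hB; rewrite !inE => /or3P[] /eqP ->.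
  - exact: (four _ _ _ _ _ _ T1 erefl).
  - by have := four _ _ _ _ _ _ T2 erefl; congr (_ <= _ ^+ 2); ring.
  - by have := four _ _ _ _ _ _ T3 erefl; congr (_ <= _ ^+ 2); ring.
have B21 : (`|B| <= 40 * H ^ 2)%N.
  have : `|B| <= 21 * H%:Z ^+ 2.
    by move: hB; rewrite !inE => /or3P[] /eqP ->; apply: AB.
  by rewrite -[H%:Z ^+ 2]/((H ^ 2)%N%:Z); lia.
have [i hi] := small_root H0 prod_r Bbound B21.
(* Whichever root is the small one, four times it is [- a] plus the [t]s with an even number of
   signs changed, and this fixes the signs in the centre. *)
have E0 : 4 * r0 = - a%:~R + t1 + t2 + t3 by rewrite Va /t1 /t2 /t3; ring.
have E1 : 4 * r1 = - a%:~R + t1 - t2 - t3 by rewrite Va /t1 /t2 /t3; ring.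
have E2 : 4 * r2 = - a%:~R - t1 + t2 - t3 by rewrite Va /t1 /t2 /t3; ring.
have E3 : 4 * r3 = - a%:~R - t1 - t2 + t3 by rewrite Va /t1 /t2 /t3; ring.
have sN f : sgn (~~ f) = - sgn f by case: f; rewrite /sgn /= ?expr1 ?opprK.
have := hi; case: i hi => [[|[|[|[|//]]]] i4] _; rewrite /r /= => hi.
- exists f1, f2, f3; apply: near_centre_root hi; rewrite -F1 -F2 -F3 E0; ring.
- exists f1, (~~ f2), (~~ f3); apply: near_centre_root hi; rewrite !sN !mulNr -F1 -F2 -F3 E1; ring.
- exists (~~ f1), f2, (~~ f3); apply: near_centre_root hi; rewrite !sN !mulNr -F1 -F2 -F3 E2; ring.
- exists (~~ f1), (~~ f2), f3; apply: near_centre_root hi; rewrite !sN !mulNr -F1 -F2 -F3 E3; ring.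
Qed.

Definition signed (e : bool) (n : nat) : int := (-1) ^+ e * n%:Z.

Definition v4code (H : nat) t (al be ga m1 m2 m3 : nat) : Prop :=
  exists e1 e2 e3, v4data H t (signed e1 (al * be * m1 ^ 2))
    (signed e2 (al * ga * m2 ^ 2)) (signed e3 (be * ga * m3 ^ 2)).

Lemma v4code_be_ga H t al be ga m1 m2 m3 :
  v4code H t al be ga m1 m2 m3 -> v4code H t al ga be m2 m1 m3.
Proof.
move=> [e1 [e2 [e3 h]]]; exists e2, e1, e3; rewrite (mulnC ga be).
exact: v4data_swap12.
Qed.

Lemma v4code_al_be H t al be ga m1 m2 m3 :
  v4code H t al be ga m1 m2 m3 -> v4code H t be al ga m1 m3 m2.
Proof.
move=> [e1 [e2 [e3 h]]]; exists e1, e3, e2; rewrite (mulnC be al).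
exact: v4data_swap23.
Qed.

Lemma V4_param (H : nat) t A1 A2 A3 : v4data H t A1 A2 A3 -> A1 * A2 * A3 != 0 ->
  exists al be ga m1 m2 m3, [/\ (0 < be)%N && (be <= al)%N, (al <= ga)%N,
    [&& (0 < m1)%N, (0 < m2)%N & (0 < m3)%N] & v4code H t al be ga m1 m2 m3].
Proof.
move=> D; rewrite !mulf_eq0 !negb_or -!absz_gt0 => /andP[/andP[p1 p2] p3].
have [s Es] : exists s, (`|A1| * `|A2| * `|A3|)%N = (s ^ 2)%N.
  case: t D => [[[a b] c] d] [_ _ _ E _]; exists (absz (a ^+ 3 - 4 * a * b + 8 * c)).
  by rewrite -!abszM E abszX.
have [al [be [ga [m1 [m2 [m3 [E1 E2 E3]]]]]]] := square_product_param p1 p2 p3 Es.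
have code : v4code H t al be ga m1 m2 m3.
  exists (A1 < 0), (A2 < 0), (A3 < 0); rewrite /signed -E1 -E2 -E3.
  by rewrite -!intEsign.
move: p1 p2 p3; rewrite E1 E2 E3 !muln_gt0 !andbb.
move=> /andP[/andP[al0 be0] m10] /andP[/andP[_ ga0] m20] /andP[_ m30].
(* Permuting [al], [be], [ga] permutes the three invariants, so the ordering can be imposed by
   symmetry. *)
wlog: al be ga m1 m2 m3 al0 be0 ga0 m10 m20 m30 code {E1 E2 E3} / (be <= al)%N.
  have [le|/ltnW le] := leqP be al; first by move=> W; apply: (W al be ga m1 m2 m3).
  move=> W; apply: (W be al ga m1 m3 m2) => //; exact: v4code_al_be.
wlog: al be ga m1 m2 m3 al0 be0 ga0 m10 m20 m30 code / (al <= ga)%N.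
  have [le|/ltnW le] := leqP al ga; first by move=> W; apply: (W al be ga m1 m2 m3).
  move=> W ba; have [bg|/ltnW gb] := leqP be ga.
    apply: (W ga be al m3 m2 m1) => //.
    exact/v4code_be_ga/v4code_al_be/v4code_be_ga.
  apply: (W be ga al m3 m1 m2) => //.
  exact/v4code_be_ga/v4code_al_be.
move=> ag ba; exists al, be, ga, m1, m2, m3; split => //; first by rewrite be0.
by rewrite m10 m20.
Qed.

(** The sum of the invariants is [3 * a ^ 2 - 8 * b], which gives [b] and then the resolvent roots.
    Their product gives the square of [a ^ 3 - 4 * a * b + 8 * c], hence [c] once the sign is known,
    and the second symmetric function of the resolvent roots gives [d]. *)
Lemma v4data_inj (H : nat) (a b c d b' c' d' A1 A2 A3 : int) :
  v4data H (a, b, c, d) A1 A2 A3 -> v4data H (a, b', c', d') A1 A2 A3 ->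
  (a ^+ 3 - 4 * a * b + 8 * c < 0) = (a ^+ 3 - 4 * a * b' + 8 * c' < 0) ->
  (b, c, d) = (b', c', d').
Proof.
move=> [[x1 [x2 [x3 [E1 E2 E3 E4 E5]]]] _ _ P _].
move=> [[y1 [y2 [y3 [F1 F2 F3 F4 F5]]]] _ _ Q _] sg.
have Eb : b' = b by lra.
rewrite {}Eb in F1 F2 F3 F4 Q sg *.
have G1 : y1 = x1 by lra.
have G2 : y2 = x2 by lra.
have G3 : y3 = x3 by lra.
rewrite {}G1 {}G2 {}G3 in F5.
have Ec : c = c'.
  have : (a ^+ 3 - 4 * a * b + 8 * c) ^+ 2 = (a ^+ 3 - 4 * a * b + 8 * c') ^+ 2.
    by rewrite -P -Q.
  move/eqP; rewrite eqf_sqr => /orP[] /eqP E; first by lra.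
  by move: sg E; case: ltP => h /esym; case: ltP => h' // _ E; lra.
rewrite -Ec in F5 *; have -> : d = d' by lra.
by [].
Qed.

(** [k * m ^ 2] is the square of [r0 + r2 - r1 - r3], and [k * s] is
    [(r0 - r2) ^ 2 + (r1 - r3) ^ 2]. Up to sign, [d * sqrt k] is the difference of these two squares
    and [w * sqrt k] is [2 * (r0 - r2) * (r1 - r3)]. The equations for [b], [c], [e] rewrite the
    quartic in these terms, leaving [a] as the only free coefficient. The sign [p] occurs twice in
    the centre because changing the sign of [sqrt k] exchanges the pairs [r0], [r2] and [r1],
    [r3]. *)
Definition c4data (H : nat) (t : int * int * int * int) (k m : nat) (s d : int) (w : nat) : Prop :=
  let: (a, b, c, e) := t in
  [/\ [&& (0 < k)%N, (0 < m)%N & (0 < w)%N],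
      k%:Z * s ^+ 2 = d ^+ 2 + w%:Z ^+ 2,
      [/\ `|k%:Z * m%:Z ^+ 2 - k%:Z * s| <= 26 * H%:Z, `|k%:Z * s| <= 11 * H%:Z ^+ 2
        & k%:Z * w%:Z ^+ 2 <= 500 * H%:Z ^+ 2],
      [/\ 8 * b = 3 * a ^+ 2 - k%:Z * m%:Z ^+ 2 - 2 * (k%:Z * s),
        16 * c = a ^+ 3 - a * (k%:Z * m%:Z ^+ 2) - 2 * a * (k%:Z * s) - 2 * (m%:Z * k%:Z * d)
        & 256 * e = (a ^+ 2 - k%:Z * m%:Z ^+ 2) ^+ 2
          - 4 * (a ^+ 2 + k%:Z * m%:Z ^+ 2) * (k%:Z * s) - 8 * a * (m%:Z * k%:Z * d)
          + 4 * ((k%:Z * s) ^+ 2 - k%:Z * d ^+ 2)]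
    & exists p q, near_centre H `|k%:Z * s| a (sgn p * (m%:R * sqrtC k%:R)
        + sgn q * (2 * sqrtC (((k%:Z * s)%:~R + sgn p * (d%:~R * sqrtC k%:R)) / 2)))].

(** Comparing squares puts [m] inside [n]; the quotient has square [k * n'], and squarefreeness puts
    [k] inside that quotient. *)
Lemma sqr_multiple (k m : nat) (n n' : int) : (0 < k)%N -> (0 < m)%N -> squarefree k ->
  k%:Z * m%:Z ^+ 2 * n' = n ^+ 2 ->
  exists d : int, n = m%:Z * k%:Z * d /\ n' = k%:Z * d ^+ 2.
Proof.
move=> k0 m0 sk E.
have Ea : (k * m ^ 2 * `|n'| = `|n| ^ 2)%N by have := congr1 absz E; rewrite abszX !abszM.
have dm : (m %| `|n|)%N by rewrite -(@dvdn_pexp2r _ _ 2) // -Ea mulnAC dvdn_mull.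
have /dvdnP[q Eq] := dm.
have Eq2 : (k * `|n'| = q ^ 2)%N.
  apply/eqP; rewrite -(eqn_pmul2r (_ : 0 < m ^ 2)%N) ?expn_gt0 ?m0 //.
  by rewrite -expnMn -Eq -Ea mulnAC.
have /dvdnP[d Ed] : (k %| q)%N by apply: squarefree_dvd_sqr => //; rewrite -Eq2 dvdn_mulr.
have En : n = m%:Z * k%:Z * ((-1) ^+ (n < 0)%R * d%:Z).
  rewrite [LHS]intEsign Eq Ed !PoszM; ring.
exists ((-1) ^+ (n < 0)%R * d%:Z); split => //.
have mk0 : k%:Z * m%:Z ^+ 2 != 0 by rewrite mulf_neq0 ?expf_neq0 //; lia.
apply: (mulfI mk0); rewrite E {1}En; ring.
Qed.

Lemma half_disc_bound (h a b x : int) : a ^+ 2 <= h ^+ 2 -> 0 <= a ^+ 2 ->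
  h <= h ^+ 2 -> `|b| <= h -> `|x| <= 4 * h -> `|a ^+ 2 - 2 * b - 2 * x| <= 11 * h ^+ 2.
Proof. by move=> ? ? ? /ler_normlP[? ?] /ler_normlP[? ?]; apply/ler_normlP; split; lra. Qed.

Lemma half_disc_diff (h b x : int) : `|b| <= h -> `|x| <= 4 * h -> `|6 * x - 2 * b| <= 26 * h.
Proof. by move=> /ler_normlP[? ?] /ler_normlP[? ?]; apply/ler_normlP; split; lra. Qed.

(** Dividing the cubic resolvent by its linear factor at [x] leaves a quadratic with discriminant
    [((r0 - r2) * (r1 - r3)) ^ 2], and the left side is four times that discriminant. The constant
    is generous; later it is compared with [23 ^ 2]. *)
Lemma resolvent_quotient_bound (h a b c e x : int) : `|a| <= h -> `|b| <= h -> `|c| <= h ->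
  `|e| <= h -> h <= h ^+ 2 -> `|x| <= 4 * h ->
  4 * ((b - x) ^+ 2 - 4 * (x ^+ 2 - b * x + (a * c - 4 * e))) <= 500 * h ^+ 2.
Proof.
move=> ha hb hc he hh hx; have h0 : 0 <= h := le_trans (normr_ge0 _) ha.
have e1 : - (a * c) <= h * h.
  by rewrite (le_trans (ler_norm _)) // normrN normrM ler_pM.
have e2 : b * x <= h * (4 * h) by rewrite (le_trans (ler_norm _)) // normrM ler_pM.
have e3 : b ^+ 2 <= h ^+ 2.
  by rewrite -[b ^+ 2]ger0_norm ?sqr_ge0 // normrX lerXn2r ?nnegrE ?normr_ge0.
have e4 : e <= h by move: he => /ler_normlP[].
have e5 : 0 <= x ^+ 2 by apply: sqr_ge0.
have e6 : 0 <= h ^+ 2 by apply: sqr_ge0.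
lra.
Qed.

Lemma C4_data (H : nat) (a b c e : int) : (0 < H)%N -> box4 H (a, b, c, e) ->
    irreducible_poly (quartic a b c e) -> (galgrp (quartic a b c e) \isog C4)%g ->
  a ^+ 3 - 4 * a * b + 8 * c = 0 \/ exists k m s d w, c4data H (a, b, c, e) k m s d w.
Proof.
move=> H0 [ha hb hc hd] irr_f isoG.
have [r0 [r1 [r2 [r3 [[Va Vb Vc Vd] n02 n13 [x [n1 [n2 [X N1 N2]]]]]]]]] := C4_int irr_f isoG.
have toC (u v : int) : (u%:~R = v%:~R :> algC) -> u = v by move/intr_inj.
have Rx : x ^+ 3 - b * x ^+ 2 + (a * c - 4 * e) * x
  - (a ^+ 2 * e - 4 * b * e + c ^+ 2) = 0.
  by apply: toC; rewrite !(rmorphB, rmorphD, rmorphM, rmorphXn) /= X Va Vb Vc Vd; ring.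
have Bx := resolvent_root_bound H0 ha hb hc hd Rx.
pose th := r0 + r2 - r1 - r3; rewrite -/th in N1 N2.
have [A DA] : exists A, A = a ^+ 2 - 4 * b + 4 * x by eexists.
have [S DS] : exists S, S = a ^+ 2 - 2 * b - 2 * x by eexists.
have [W2 DW] : exists W2, W2 = 4 * ((b - x) ^+ 2 - 4 * (x ^+ 2 - b * x + (a * c - 4 * e))).
  by eexists.
have EA : A%:~R = th ^+ 2.
  by rewrite DA /th !(rmorphB, rmorphD, rmorphM, rmorphXn) /= X Va Vb; ring.
have ES : S%:~R = (r0 - r2) ^+ 2 + (r1 - r3) ^+ 2.
  by rewrite DS !(rmorphB, rmorphD, rmorphM, rmorphXn) /= X Va Vb; ring.
have EW : W2%:~R = (2 * (r0 - r2) * (r1 - r3)) ^+ 2.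
  by rewrite DW !(rmorphB, rmorphD, rmorphM, rmorphXn) /= X Va Vb Vc Vd; ring.
have [th0|th0] := eqVneq th 0.
  left; apply: toC; rewrite !(rmorphB, rmorphD, rmorphM, rmorphXn) /= Va Vb Vc.
  have -> : r0 = r1 + r3 - r2 by rewrite -[RHS]addr0 -th0 /th; ring.
  by ring.
right.
have n20 : n2 != 0.
  by rewrite -(intr_eq0 algC) N2 mulf_neq0 // !mulf_neq0 ?subr_eq0 ?pnatr_eq0.
have ENW : A * W2 = n2 ^+ 2 by apply: toC; rewrite rmorphXn rmorphM /= EA EW N2; ring.
have END : A * (S ^+ 2 - W2) = n1 ^+ 2.
  by apply: toC; rewrite !(rmorphXn, rmorphM, rmorphB) /= EA ES EW N1; ring.
(* [A * S ^ 2 = n1 ^ 2 + n2 ^ 2] with [n2] nonzero: the quadratic subfield of a cyclic quartic field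
   is real. *)
have A0 : 0 < A.
  have h1 : 0 <= n1 ^+ 2 by apply: sqr_ge0.
  have h2 : 0 < n2 ^+ 2 by rewrite exprn_even_gt0.
  have : 0 < A * S ^+ 2.
    rewrite (_ : A * S ^+ 2 = n1 ^+ 2 + n2 ^+ 2) ?ltr_wpDl // -END -ENW; ring.
  by apply: contraLR; rewrite -!leNgt => h; rewrite mulr_le0_ge0 ?sqr_ge0.
have [|k [m [Ekm k0 m0 sk]]] := @squarefree_part `|A|; first by rewrite absz_gt0 gt_eqF.
have {}Ekm : A = k%:Z * m%:Z ^+ 2 by rewrite -[A]gtz0_abs // Ekm PoszM.
rewrite Ekm in ENW END.
have [d [En1 Ed]] := sqr_multiple k0 m0 sk END.
have [w [En2 Ew]] := sqr_multiple k0 m0 sk ENW.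
have w0 : w != 0 by apply: contraNneq n20 => w0; rewrite En2 w0 mulr0.
have ES2 : S ^+ 2 = k%:Z * (d ^+ 2 + w ^+ 2) by rewrite mulrDr -Ed -Ew; ring.
have /dvdzP[s Es] : (k%:Z %| S)%Z.
  rewrite dvdzE /=; apply: squarefree_dvd_sqr => //.
  by rewrite -abszX ES2 abszM dvdn_mulr.
rewrite mulrC in Es.
have kZ0 : k%:Z != 0 by lia.
have Econe : k%:Z * s ^+ 2 = d ^+ 2 + w ^+ 2.
  by apply: (mulfI kZ0); rewrite -ES2 Es; ring.
have wabs : `|w|%N%:Z ^+ 2 = w ^+ 2 by rewrite abszE -normrX ger0_norm ?sqr_ge0.
exists k, m, s, d, `|w|%N; split.
- by rewrite k0 m0 absz_gt0.
- by rewrite wabs.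
- have aa : a ^+ 2 <= H%:Z ^+ 2.
    by rewrite -[a ^+ 2]ger0_norm ?sqr_ge0 // normrX lerXn2r ?nnegrE ?normr_ge0.
  have a0 : 0 <= a ^+ 2 by apply: sqr_ge0.
  have HH : H%:Z <= H%:Z ^+ 2 by rewrite expr2 ler_peMl //; lia.
  rewrite wabs -Ekm -Es -Ew; split.
  + rewrite (_ : A - S = 6 * x - 2 * b); last by rewrite DA DS; ring.
    exact: half_disc_diff.
  + by rewrite DS; apply: half_disc_bound.
  + by rewrite DW; apply: resolvent_quotient_bound.
- rewrite -Ekm -Es -En1; split.
  + by rewrite DA DS; ring.
  + by apply: toC; rewrite !(rmorphB, rmorphD, rmorphM, rmorphXn) /= ES EA N1 Va Vc /th; ring.
  + rewrite (_ : k%:Z * d ^+ 2 = S ^+ 2 - W2) //.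
    apply: toC; rewrite !(rmorphB, rmorphD, rmorphM, rmorphXn) /= ES EA N1 EW Va Vd /th; ring.
rewrite -Es.
have [ep Eep] := sqrtC_sgn th.
have sq0 : (0 : algC) <= k%:R by rewrite ler0n.
have Esq : sqrtC (th ^+ 2) = m%:R * sqrtC k%:R.
  by rewrite -EA Ekm rmorphM rmorphXn /= sqrtCM ?nnegrE ?exprn_ge0 ?ler0n // mulrC sqrCK ?ler0n.
rewrite Esq in Eep.
have sg2 f : sgn f * sgn f = 1 by rewrite /sgn -expr2 sqrr_sign.
have ED : (r0 - r2) ^+ 2 - (r1 - r3) ^+ 2 = sgn ep * (d%:~R * sqrtC k%:R).
  apply: (mulfI th0); rewrite -N1 En1 !rmorphM /= Eep.
  rewrite -!pmulrn -{1}(sqrtCK k%:R).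
  transitivity (sgn ep * sgn ep * (m%:R * sqrtC k%:R ^+ 2 * d%:~R)); last by ring.
  by rewrite sg2 mul1r.
pose r (i : 'I_4) := [:: r0; r1; r2; r3]`_i.
have prod_r : `|\prod_i r i| <= H%:R.
  rewrite !big_ord_recr big_ord0 /= /r /= mul1r -Vd -intr_norm.
  by rewrite -[H%:R]/((H%:Z)%:~R) ler_int.
have sum_r : \sum_i `|r i| = `|r0| + `|r1| + `|r2| + `|r3|.
  by rewrite !big_ord_recr big_ord0 /= /r /= add0r.
have Sbound : (`|S|%N%:R : algC) <= (\sum_i `|r i|) ^+ 2.
  rewrite natr_absz -[X in X%:~R]/(`|S|) intr_norm sum_r ES.
  apply: le_trans (ler_normD _ _) _; rewrite !normrX.
  apply: le_trans (_ : (`|r0| + `|r2|) ^+ 2 + (`|r1| + `|r3|) ^+ 2 <= _).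
    by apply: lerD; rewrite lerXn2r ?nnegrE ?addr_ge0 ?normr_ge0 ?ler_normB.
  rewrite -subr_ge0.
  have -> : (`|r0| + `|r1| + `|r2| + `|r3|) ^+ 2 - ((`|r0| + `|r2|) ^+ 2 +
    (`|r1| + `|r3|) ^+ 2) = 2 * ((`|r0| + `|r2|) * (`|r1| + `|r3|)) by ring.
  by rewrite !mulr_ge0 ?addr_ge0 ?normr_ge0.
have S40 : (`|S| <= 40 * H ^ 2)%N.
  have : `|S| <= 11 * H%:Z ^+ 2.
    rewrite DS; apply: half_disc_bound; rewrite ?sqr_ge0 //; last by rewrite expr2 ler_peMl //; lia.
    by rewrite -[a ^+ 2]ger0_norm ?sqr_ge0 // normrX lerXn2r ?nnegrE ?normr_ge0.
  by rewrite -[H%:Z ^+ 2]/((H ^ 2)%N%:Z); clear; lia.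
have [i hi] := small_root H0 prod_r Sbound S40.
have sN f : sgn (~~ f) = - sgn f by case: f; rewrite /sgn /= ?expr1 ?opprK.
have [q Eq] := sqrtC_sgn (r0 - r2); have [q' Eq'] := sqrtC_sgn (r1 - r3).
have h02 : (r0 - r2) ^+ 2 = (S%:~R + sgn ep * (d%:~R * sqrtC k%:R)) / 2.
  by rewrite -ED ES; field.
have h13 : (r1 - r3) ^+ 2 = (S%:~R + sgn (~~ ep) * (d%:~R * sqrtC k%:R)) / 2.
  by rewrite sN mulNr -ED ES; field.
rewrite h02 in Eq; rewrite h13 in Eq'.
have := hi; case: i hi => [[|[|[|[|//]]]] i4] _; rewrite /r /= => hi.
- exists ep, q; apply: near_centre_root hi; rewrite -Eep mulrCA -Eq Va /th; ring.
- exists (~~ ep), q'; apply: near_centre_root hi.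
  by rewrite (mulrCA (sgn q')) -Eq' sN mulNr -Eep Va /th; ring.
- exists ep, (~~ q); apply: near_centre_root hi.
  by rewrite (sN q) mulNr (mulrCA (sgn q)) -Eq -Eep Va /th; ring.
- exists (~~ ep), (~~ q'); apply: near_centre_root hi.
  by rewrite (sN q') mulNr (mulrCA (sgn q')) -Eq' sN mulNr -Eep Va /th; ring.
Qed.

(** * Counting tools *)

Definition cnt (T : Type) (L : seq T) (P : T -> Prop) : nat := count (fun t => decb (P t)) L.

Lemma cnt_le (T : Type) (L : seq T) (P Q : T -> Prop) :
  (forall t, P t -> Q t) -> (cnt L P <= cnt L Q)%N.
Proof.
by move=> PQ; apply: sub_count => t /decbP /PQ /decbP.
Qed.

Lemma cnt_or (T : Type) (L : seq T) (P Q : T -> Prop) :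
  (cnt L (fun t => P t \/ Q t) <= cnt L P + cnt L Q)%N.
Proof.
rewrite /cnt -count_predUI; apply: leq_trans (leq_addr _ _).
by apply: sub_count => t /decbP[] h; apply/orP; [left|right]; apply/decbP.
Qed.

Lemma cnt_exists (T : Type) (K : eqType) (L : seq T) (ks : seq K) (Q : K -> T -> Prop) :
  (forall t x, Q x t -> x \in ks) ->
  (cnt L (fun t => exists x, Q x t) <= \sum_(x <- ks) cnt L (Q x))%N.
Proof.
move=> mem; elim: L => [|t L IH] /=; first by rewrite /cnt big1.
rewrite /cnt /= -/(cnt L _).
have -> : (\sum_(x <- ks) count (fun t0 => decb (Q x t0)) (t :: L)
   = \sum_(x <- ks) decb (Q x t) + \sum_(x <- ks) cnt L (Q x))%N.
  by rewrite -big_split.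
apply: leq_add IH; case: decbP => // -[x Qx].
have xk := mem _ _ Qx; rewrite (big_rem x) //=.
by case: decbP.
Qed.

(** The residues modulo [D + 1] are distinct, since two elements differ by less than the modulus. *)
Lemma size_int_spread (s : seq int) (D : nat) : uniq s ->
  {in s &, forall x y, (`|x - y| <= D)%N} -> (size s <= D.+1)%N.
Proof.
move=> us sp; pose g (x : int) := `|(x %% D.+1%:Z)%Z|%N.
rewrite -(size_map g) -(size_iota 0 D.+1); apply: uniq_leq_size.
  rewrite map_inj_in_uniq // => x y xs ys /eqP.
  rewrite /g -eqz_nat !gez0_abs ?modz_ge0 // eqz_mod_dvd dvdzE /= => dv.
  apply/eqP; rewrite -subr_eq0 -absz_eq0; apply: contraLR (sp _ _ xs ys) => nz.
  by rewrite -ltnNge dvdn_leq // lt0n.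
move=> _ /mapP[x _ ->]; rewrite mem_iota /= add0n /g -ltz_nat gez0_abs ?modz_ge0 //.
by rewrite ltz_pmod.
Qed.

Section Real.
Variable F : realType.

Lemma cnt_spread (T : eqType) (L : seq T) (P : T -> Prop) (f : T -> int) (D : F) :
    uniq L -> 0 <= D ->
    (forall t t', P t -> P t' -> f t = f t' -> t = t') ->
    (forall t t', P t -> P t' -> (`|f t - f t'|%N)%:R <= D) ->
  (cnt L P)%:R <= 1 + D.
Proof.
move=> uL D0 inj sp; rewrite /cnt -size_filter -(size_map f).
apply: le_trans (_ : ((Num.truncn D).+1)%:R <= _); last first.
  by rewrite -natr1 addrC lerD2l truncn_le.
rewrite ler_nat; apply: size_int_spread.
  rewrite map_inj_in_uniq ?filter_uniq // => t t'.
  by rewrite !mem_filter => /andP[/decbP Pt _] /andP[/decbP Pt' _]; apply: inj.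
move=> _ _ /mapP[t ht ->] /mapP[t' ht' ->]; move: ht ht'.
rewrite !mem_filter => /andP[/decbP Pt _] /andP[/decbP Pt' _].
by rewrite truncn_ge_nat // sp.
Qed.

(** Rounding [f / s] down is injective on separated values and lands in an interval of length
    [rho / s]. *)
Lemma cnt_separated (T : eqType) (L : seq T) (P : T -> Prop) (f : T -> F) (s rho : F) :
    uniq L -> 0 < s -> 0 <= rho ->
    (forall t, P t -> 0 <= f t <= rho) ->
    (forall t t', P t -> P t' -> t <> t' -> s <= `|f t - f t'|) ->
  (cnt L P)%:R <= 1 + rho / s.
Proof.
move=> uL s0 rho0 rg sep.
apply: (@cnt_spread _ L P (fun t => Num.floor (f t / s))); rewrite ?divr_ge0 ?(ltW s0) //.
  move=> t t' Pt Pt' E; apply/eqP; apply: contraT => /eqP ne; have := sep t t' Pt Pt' ne.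
  rewrite leNgt => /negP[].
  have h1 := floor_itv (f t / s); have h2 := floor_itv (f t' / s).
  rewrite E in h1; move: h1 h2 => /andP[a1 b1] /andP[a2 b2].
  have : `|f t / s - f t' / s| < 1.
    by rewrite ltr_norml; move: b1 b2; rewrite !rmorphD /= => b1 b2; apply/andP; split; lra.
  by rewrite -mulrBl normrM (gtr0_norm (x := s^-1)) ?invr_gt0 // ltr_pdivrMr ?mul1r.
move=> t t' Pt Pt'.
have /andP[l1 u1] := rg _ Pt; have /andP[l2 u2] := rg _ Pt'.
have bd (x : F) : 0 <= x -> x <= rho -> (0 <= (Num.floor (x / s))%:~R :> F) /\ ((Num.floor (x / s))%:~R <= rho / s).
  move=> x0 xr; split; first by rewrite ler0z floor_ge0 divr_ge0 ?(ltW s0).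
  by rewrite (le_trans (floor_le _)) // ler_pM2r ?invr_gt0.
rewrite natr_absz -[X in X%:~R]/(`|_ - _|) intr_norm rmorphB /=.
have [p1 q1] := bd _ l1 u1; have [p2 q2] := bd _ l2 u2.
by rewrite ler_norml; apply/andP; split; lra.
Qed.

End Real.

(** * Elementary sums, and counting a union over an integer parameter *)

Section Sums.
Variable F : realType.
Implicit Types (M c D : F) (f B : nat -> F).

Definition harm (n : nat) : F := \sum_(i <- iota 1 n) i%:R^-1.

Lemma sum_iota_recr f a n :
  \sum_(i <- iota a n.+1) f i = \sum_(i <- iota a n) f i + f (a + n)%N.
Proof. rewrite -[in LHS](addn1 n) iotaD big_cat /= big_seq1. reflexivity. Qed.

Lemma sum_iotaS f n : \sum_(i <- iota 1 n.+1) f i = \sum_(i <- iota 1 n) f i + f n.+1.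
Proof. exact: sum_iota_recr. Qed.

Lemma harmS n : harm n.+1 = harm n + n.+1%:R^-1.
Proof. exact: sum_iotaS. Qed.

Lemma harm_ge0 n : 0 <= harm n.
Proof. by apply: sumr_ge0 => i _; rewrite invr_ge0. Qed.

Lemma harm_le m n : (m <= n)%N -> harm m <= harm n.
Proof.
move=> /subnK <-; elim: (n - m)%N => [|k IH]; first by rewrite add0n.
by rewrite addSn harmS (le_trans IH) // lerDl invr_ge0.
Qed.

Lemma harm_ge1 n : (0 < n)%N -> 1 <= harm n.
Proof.
by move=> n0; apply: le_trans (harm_le n0); rewrite /harm /= big_seq1 invr1.
Qed.

Lemma sum_inv_sqrt n : \sum_(i <- iota 1 n) (Num.sqrt i%:R)^-1 <= 2 * Num.sqrt n%:R :> F.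
Proof.
elim: n => [|n IH]; first by rewrite big_nil mulr_ge0 ?sqrtr_ge0.
rewrite sum_iotaS; apply: le_trans (lerD IH (lexx _)) _.
set x := Num.sqrt n%:R; set y := Num.sqrt n.+1%:R.
have x0 : 0 <= x by apply: sqrtr_ge0.
have y0 : 0 < y by rewrite sqrtr_gt0 ltr0n.
have E : y ^+ 2 = x ^+ 2 + 1 by rewrite /x /y !sqr_sqrtr ?ler0n // -natr1.
rewrite -(ler_pM2r y0) mulrDl mulVf ?gt_eqF //.
have : 0 <= (y - x) ^+ 2 by apply: sqr_ge0.
by rewrite sqrrB; lra.
Qed.

Lemma sum_inv_sqr n : \sum_(i <- iota 1 n) (i%:R ^+ 2)^-1 <= 2 :> F.
Proof.
(* Strengthened so that the induction telescopes, each new term being at most the drop of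
   [1 / i]. *)
suff : \sum_(i <- iota 1 n.+1) (i%:R ^+ 2)^-1 <= 2 - n.+1%:R^-1 :> F.
  rewrite sum_iotaS => h.
  have h1 : 0 <= (n.+1%:R ^+ 2)^-1 :> F by rewrite invr_ge0 exprn_ge0.
  have h2 : 0 <= n.+1%:R^-1 :> F by rewrite invr_ge0.
  by apply: le_trans (_ : _ <= 2 - n.+1%:R^-1) _; rewrite ?gerBl // (le_trans _ h) // lerDl.
elim: n => [|n IH]; first by rewrite /= big_seq1 !mulr1n expr1n invr1; lra.
rewrite sum_iotaS /=; apply: le_trans (lerD IH (lexx _)) _.
have step (x : F) : 0 < x -> ((x + 1) ^+ 2)^-1 <= x^-1 - (x + 1)^-1.
  move=> x0; have x1 : 0 < x + 1 by lra.
  have -> : x^-1 - (x + 1)^-1 = ((x + 1) ^+ 2)^-1 + (x * (x + 1) ^+ 2)^-1.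
    by field; rewrite !gt_eqF.
  by rewrite lerDl invr_ge0 mulr_ge0 ?exprn_ge0 // ltW.
have := step n.+1%:R; rewrite ltr0n natr1 => /(_ isT) h.
by move: h; set p := _^-1; set q := _^-1; set r := _^-1; lra.
Qed.

Lemma sum_inv_sqrt3_tail a n : (0 < a)%N ->
  \sum_(i <- iota a n) (i%:R * Num.sqrt i%:R)^-1 <= 3 / Num.sqrt a%:R :> F.
Proof.
move=> a0; have s0 : 0 < (Num.sqrt a%:R : F)^-1 by rewrite invr_gt0 sqrtr_gt0 ltr0n.
(* Strengthened to telescope through [(y ^ 2 * y)^-1 <= 2 / x - 2 / y] when [y ^ 2 = x ^ 2 + 1]. The
   term at [a] is at most [1 / sqrt a], hence 3 instead of 2. *)
suff : \sum_(i <- iota a n.+1) (i%:R * Num.sqrt i%:R)^-1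
    <= 3 / Num.sqrt a%:R - 2 / Num.sqrt (a + n)%:R :> F.
  rewrite sum_iota_recr => h.
  have h1 : 0 <= ((a + n)%:R * Num.sqrt (a + n)%:R)^-1 :> F.
    by rewrite invr_ge0 mulr_ge0 ?sqrtr_ge0.
  have h2 : 0 <= (Num.sqrt (a + n)%:R)^-1 :> F by rewrite invr_ge0 sqrtr_ge0.
  have h3 : 0 <= 2 / Num.sqrt (a + n)%:R :> F by rewrite mulr_ge0.
  by apply: le_trans (_ : _ <= 3 / Num.sqrt a%:R - 2 / Num.sqrt (a + n)%:R) _;
    [rewrite (le_trans _ h) // lerDl|rewrite gerBl].
elim: n => [|n IH].
  rewrite /= big_seq1 addn0 invfM; set u := (Num.sqrt _)^-1 in s0 *.
  have : (a%:R : F)^-1 <= 1 by rewrite invf_le1 ?ler1n ?ltr0n.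
  move=> h; apply: le_trans (_ : 1 * u <= _); last by lra.
  by rewrite ler_wpM2r // ltW.
rewrite sum_iota_recr; apply: le_trans (lerD IH (lexx _)) _.
rewrite !addnS; set b := (a + n)%N; have b0 : (0 < b)%N by rewrite addn_gt0 a0.
have step (x y : F) : 0 < x -> x <= y -> y ^+ 2 = x ^+ 2 + 1 ->
    (y ^+ 2 * y)^-1 <= 2 / x - 2 / y.
  move=> x0 xy E; have y0 : 0 < y := lt_le_trans x0 xy.
  have -> : (y ^+ 2 * y)^-1 = (y - x) * (y + x) / (y ^+ 2 * y).
    have e : (y - x) * (y + x) = 1 by transitivity (y ^+ 2 - x ^+ 2); [ring|rewrite E; ring].
    by rewrite e mul1r.
  rewrite -subr_ge0.
  have -> : 2 / x - 2 / y - (y - x) * (y + x) / (y ^+ 2 * y)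
    = (y - x) * (2 * y ^+ 2 - x * (x + y)) / (x * y ^+ 3).
    by field; rewrite !gt_eqF.
  rewrite divr_ge0 ?mulr_ge0 ?exprn_ge0 ?subr_ge0 // ?ltW //.
  by nra.
have := step (Num.sqrt b%:R) (Num.sqrt b.+1%:R).
rewrite sqrtr_gt0 ltr0n ler_sqrt ?ler0n // ler_nat leqnSn !sqr_sqrtr ?ler0n // natr1.
move=> /(_ b0 isT erefl) h.
apply: le_trans (lerD (lexx _) h) _.
by rewrite addrA subrK.
Qed.

Lemma sum_triangle (f : nat -> nat -> F) N :
  \sum_(x <- iota 1 N) \sum_(y <- iota 1 x) f x y =
  \sum_(y <- iota 1 N) \sum_(x <- iota y (N.+1 - y)) f x y.
Proof.
elim: N => [|N IH]; first by rewrite !big_nil.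
rewrite sum_iotaS IH [RHS]sum_iotaS subSnn /= big_seq1 sum_iotaS addrA; congr (_ + _).
rewrite -big_split /=; apply: eq_big_seq => y; rewrite mem_iota add1n ltnS => /andP[y1 yN].
have yN' : (y <= N.+1)%N by rewrite (leq_trans yN).
by rewrite [in RHS](subSn yN') sum_iota_recr subnKC.
Qed.

(** Summing over [x >= y] first leaves [3 / sqrt y] times [1 / y], a convergent series. The other
    order would meet a harmonic sum inside. *)
Lemma sum_triangle_inv N :
  \sum_(x <- iota 1 N) \sum_(y <- iota 1 x) (x%:R * Num.sqrt x%:R * y%:R)^-1 <= 9 :> F.
Proof.
rewrite sum_triangle.
apply: le_trans (_ : \sum_(y <- iota 1 N) 3 * (y%:R * Num.sqrt y%:R)^-1 <= _).
  rewrite big_seq_cond [X in _ <= X]big_seq_cond; apply: ler_sum => y.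
  rewrite mem_iota andbT => /andP[y1 _].
  apply: le_trans (_ : y%:R^-1 * \sum_(x <- iota y (N.+1 - y)) (x%:R * Num.sqrt x%:R)^-1 <= _).
    by rewrite mulr_sumr; apply: ler_sum => x _; rewrite invfM mulrC.
  by rewrite [in X in _ <= X]invfM mulrCA ler_wpM2l ?invr_ge0 ?ler0n // sum_inv_sqrt3_tail.
rewrite -mulr_sumr; have := @sum_inv_sqrt3_tail 1 N isT.
rewrite mulr1n sqrtr1 divr1; move: (\sum_(_ <- _) _) => u h; lra.
Qed.

Lemma ler_sum_iota f B n : (forall i, (0 < i)%N -> f i <= B i) ->
  \sum_(i <- iota 1 n) f i <= \sum_(i <- iota 1 n) B i.
Proof.
move=> le; rewrite big_seq_cond [X in _ <= X]big_seq_cond; apply: ler_sum => i.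
by rewrite mem_iota andbT => /andP[i1 _]; apply: le.
Qed.

Lemma sum_const c a n : \sum_(i <- iota a n) c = c * n%:R.
Proof. by rewrite big_const_seq count_predT size_iota iter_addr_0 mulr_natr. Qed.

Lemma sum_const_truncn c M : 0 <= c -> 0 <= M ->
  \sum_(i <- iota 1 (Num.truncn M)) c <= c * M.
Proof. by move=> c0 M0; rewrite sum_const ler_wpM2l // truncn_le. Qed.

Lemma sum_inv_sqrt_truncn M : 0 <= M ->
  \sum_(i <- iota 1 (Num.truncn M)) (Num.sqrt i%:R)^-1 <= 2 * Num.sqrt M.
Proof.
move=> M0; apply: le_trans (sum_inv_sqrt _) _; rewrite ler_wpM2l ?ler0n //.
by rewrite ler_sqrt // truncn_le.
Qed.

(** A crude bound, chosen to carry powers instead of logarithms through the nested sums; the loss is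
    recovered from the decay in the next parameter. *)
Lemma sum_inv_le_sqrt M : 0 <= M ->
  \sum_(i <- iota 1 (Num.truncn M)) i%:R^-1 <= 2 * Num.sqrt M.
Proof.
move=> M0; apply: le_trans (sum_inv_sqrt_truncn M0); apply: ler_sum_iota => i i0.
have s0 : 0 < Num.sqrt i%:R :> F by rewrite sqrtr_gt0 ltr0n.
rewrite lef_pV2 ?posrE ?ltr0n // -{2}(sqr_sqrtr (ler0n F i)) expr2.
have s1 : 1 <= Num.sqrt i%:R :> F by rewrite -{1}sqrtr1 ler_sqrt ?ler1n ?ler0n.
by rewrite ler_peMl // ltW.
Qed.

Section Counting.
Variables (T : eqType) (L : seq T).

(** The bound on [cnt L (Q x)] is asked only when some [t] satisfies [Q x t]: such a witness
    supplies the size conditions on the parameters that the bound relies on. *)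
Lemma cnt_exists_le (Q : nat -> T -> Prop) M B :
    (forall x t, Q x t -> (0 < x)%N /\ x%:R <= M) ->
    (forall x t, Q x t -> (cnt L (Q x))%:R <= B x) -> (forall x, (0 < x)%N -> 0 <= B x) ->
  (cnt L (fun t => exists x, Q x t))%:R <= \sum_(x <- iota 1 (Num.truncn M)) B x.
Proof.
move=> bd le B0; apply: le_trans (_ : (\sum_(x <- iota 1 (Num.truncn M)) cnt L (Q x))%:R <= _).
  rewrite ler_nat; apply: cnt_exists => t x /bd[x0 xM].
  by rewrite mem_iota x0 add1n ltnS truncn_ge_nat // (le_trans (ler0n _ _) xM).
rewrite natr_sum; apply: ler_sum_iota => x x0.
have [/hasP[t _ /decbP/le//]|no] := boolP (has (fun t => decb (Q x t)) L).
by rewrite /cnt; move: no; rewrite has_count -leqNgt leqn0 => /eqP ->; apply: B0.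
Qed.

(** The values of [x] lie in a window of length [D] whose position is unknown. The least of them is
    controlled through [a], and the [i]-th after it is at least [i], whence the term
    [2 * sqrt D]. *)
Lemma cnt_exists_window (Q : nat -> T -> Prop) (a : nat) D c1 c2 :
    (0 < a)%N -> 0 <= D -> 0 <= c1 -> 0 <= c2 ->
    (forall x t, Q x t -> (a <= x)%N) ->
    (forall x y t t', Q x t -> Q y t' -> (x <= y)%N -> (y - x)%N%:R <= D) ->
    (forall x t, Q x t -> (cnt L (Q x))%:R <= c1 + c2 / Num.sqrt x%:R) ->
  (cnt L (fun t => exists x, Q x t))%:R
    <= c1 * (1 + D) + c2 * ((Num.sqrt a%:R)^-1 + 2 * Num.sqrt D).
Proof.
move=> a0 D0 c10 c20 ge sp le.
have rhs0 : 0 <= c1 * (1 + D) + c2 * ((Num.sqrt a%:R)^-1 + 2 * Num.sqrt D).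
  by rewrite addr_ge0 ?mulr_ge0 ?addr_ge0 ?invr_ge0 ?mulr_ge0 ?sqrtr_ge0.
have [/decbP ex|/decbP nex] := boolP (decb (exists x t, Q x t)); last first.
  rewrite /cnt (_ : count _ _ = 0%N) //; apply/eqP; rewrite -leqn0 leqNgt -has_count.
  by apply/hasP=> -[t _ /decbP[x Qx]]; apply: nex; exists x, t.
have exb : exists x, decb (exists t, Q x t).
  by case: ex => x [t Qx]; exists x; apply/decbP; exists t.
case: (ex_minnP exb) => x0 /decbP[t0 Q0] minx.
have ax0 := ge _ _ Q0; pose n := Num.truncn D.
apply: le_trans (_ : (\sum_(x <- iota x0 n.+1) cnt L (Q x))%:R <= _).
  rewrite ler_nat; apply: cnt_exists => t x Qx.
  have x0x : (x0 <= x)%N by apply: minx; apply/decbP; exists t.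
  by rewrite mem_iota x0x /= addnS ltnS -leq_subLR truncn_ge_nat // (sp _ _ _ _ Q0 Qx).
apply: le_trans (_ : \sum_(x <- iota x0 n.+1) (c1 + c2 / Num.sqrt x%:R) <= _).
  rewrite natr_sum; apply: ler_sum => x _.
  have [/hasP[t _ /decbP/le//]|no] := boolP (has (fun t => decb (Q x t)) L).
  rewrite /cnt; move: no; rewrite has_count -leqNgt leqn0 => /eqP ->.
  by rewrite addr_ge0 ?mulr_ge0 ?invr_ge0 ?sqrtr_ge0.
have nD : n%:R <= D by rewrite truncn_le.
have a0' : 0 < a%:R :> F by rewrite ltr0n.
rewrite big_split sum_const -mulr_sumr; apply: lerD.
  by rewrite ler_wpM2l // -natr1 addrC lerD2l.
rewrite ler_wpM2l //= big_cons; apply: lerD.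
  by rewrite lef_pV2 ?posrE ?sqrtr_gt0 ?ltr0n ?(leq_trans a0) // ler_sqrt ?ler_nat ?ltr0n ?(leq_trans a0).
apply: le_trans (_ : \sum_(i <- iota 1 n) (Num.sqrt i%:R)^-1 <= _); last exact: sum_inv_sqrt_truncn.
rewrite -[x0.+1]addn1 iotaDl big_map; apply: ler_sum_iota => i i0.
rewrite lef_pV2 ?posrE ?sqrtr_gt0 ?ltr0n ?addn_gt0 ?i0 ?orbT //.
by rewrite ler_sqrt ?ler_nat ?leq_addl // ler0n.
Qed.

End Counting.
End Sums.

(** * Klein quartics *)

(** With [d = n - m], comparing the bounds gives [q * d * (2 * m + d) <= 64 * H]. Multiplying
    [X <= q * m ^ 2 + 32 * H] by [q * d ^ 2] then leads to [64 * 64 + 64 * 33 <= 79 ^ 2]. *)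
Lemma sqr_window (H q X m n : nat) :
  (X <= q * m ^ 2 + 32 * H)%N -> (q * n ^ 2 <= X + 32 * H)%N -> (m <= n)%N ->
  ((n - m) ^ 2 * (q * (X + H)) <= 79 ^ 2 * H ^ 2)%N.
Proof.
move=> h1 h2 /subnK E; move: (n - m)%N E => d E; rewrite -{}E in h2.
have e1 : (q * d * (2 * m + d) <= 64 * H)%N.
  have : (q * (d + m) ^ 2 = q * d * (2 * m + d) + q * m ^ 2)%N by ring.
  by move: (q * (d + m) ^ 2)%N (q * d * _)%N (q * m ^ 2)%N h1 h2 => x y z; lia.
have e2 : (q * d * m <= 64 * H)%N by apply: leq_trans e1; rewrite leq_mul2l; lia.
have e3 : (q * d * d <= 64 * H)%N by apply: leq_trans e1; rewrite leq_mul2l; lia.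
have e4 : (d ^ 2 * (q * (X + H)) <= (q * d * m) ^ 2 + (q * d * d) * (33 * H))%N.
  apply: leq_trans (_ : d ^ 2 * (q * (q * m ^ 2 + 32 * H + H)) <= _)%N.
    by rewrite !leq_mul2l leq_add2r h1 !orbT.
  by apply: eq_leq; ring.
apply: leq_trans e4 _; apply: leq_trans (_ : (64 * H) ^ 2 + (64 * H) * (33 * H) <= _)%N.
  by rewrite leq_add ?leq_sqr // leq_mul2r e3 orbT.
have -> : ((64 * H) ^ 2 + (64 * H) * (33 * H) = (64 * 64 + 64 * 33) * H ^ 2)%N by ring.
by rewrite leq_mul2r orbC.
Qed.

Lemma v4code_facts (H : nat) t al be ga m1 m2 m3 :
  v4code H t al be ga m1 m2 m3 -> let X := (al * be * m1 ^ 2)%N in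
  [/\ (X <= 21 * H ^ 2)%N,
   (al * ga * m2 ^ 2 <= X + 32 * H)%N /\ (X <= al * ga * m2 ^ 2 + 32 * H)%N
   & (be * ga * m3 ^ 2 <= X + 32 * H)%N /\ (X <= be * ga * m3 ^ 2 + 32 * H)%N].
Proof.
case=> e1 [e2 [e3]]; case: t => [[[a b] c] d] [_ [n12 n13 _] [M _ _] _ _] X.
have ns e n : `|signed e n| = n%:Z by rewrite /signed normrMsign.
have dist e f x y : `|signed e x - signed f y| <= 32 * H%:Z ->
    (y <= x + 32 * H)%N /\ (x <= y + 32 * H)%N.
  move=> le; have := le_trans (lerB_dist _ _) le; rewrite distrC in le.
  have := le_trans (lerB_dist _ _) le; rewrite !ns; lia.
split; [|exact: dist n12|exact: dist n13].
by move: M; rewrite ns -[H%:Z ^+ 2]/((H ^ 2)%N%:Z); lia.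
Qed.

Section V4count.
Variable F : realType.
Variables (H : nat) (L : seq (int * int * int * int)).
Hypotheses (H0 : (0 < H)%N) (uL : uniq L).

Definition height (X : nat) : F := Num.sqrt (X + H)%:R.
(** Up to a constant, this is the length of the interval to which [a] is confined once the centre is
    fixed. *)
Definition spread (X : nat) : F := Num.sqrt (H%:R / height X).

Lemma height_gt0 X : 0 < height X.
Proof. by rewrite sqrtr_gt0 ltr0n addn_gt0 H0 orbT. Qed.

Lemma sqr_height X : height X ^+ 2 = (X + H)%:R.
Proof. by rewrite sqr_sqrtr ?ler0n. Qed.

Lemma spread_ge0 X : 0 <= spread X.
Proof. exact: sqrtr_ge0. Qed.

Lemma spread4 X : spread X ^+ 4 * (X + H)%:R = H%:R ^+ 2.
Proof.
have -> : spread X ^+ 4 = (spread X ^+ 2) ^+ 2 by ring.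
rewrite sqr_sqrtr ?divr_ge0 ?ler0n ?(ltW (height_gt0 _)) // -sqr_height.
by field; rewrite gt_eqF // height_gt0.
Qed.

Lemma le_spread (X n : nat) : (n ^ 4 * (X + H) <= 22 ^ 4 * H ^ 2)%N -> n%:R <= 22 * spread X.
Proof.
rewrite -(ler_nat F) (natrM _ (n ^ 4)) (natrM _ (22 ^ 4)) !natrX -(spread4 X) mulrA -exprMn.
rewrite ler_pM2r ?ltr0n ?addn_gt0 ?H0 ?orbT //.
by rewrite ler_pXn2r // nnegrE ?mulr_ge0 ?spread_ge0 ?ler0n.
Qed.

(** The 16 cases are the three signs in the centre and the sign of [a ^ 3 - 4 * a * b + 8 * c]. In
    each case [a] determines the quartic and lies in one short interval. *)
Lemma v4data_count A1 A2 A3 :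
  (cnt L (fun t => v4data H t A1 A2 A3))%:R <= 16 * (1 + 22 * spread `|A1|).
Proof.
pose K : finType := (bool * bool * bool * bool)%type.
pose Q (x : K) (t : int * int * int * int) := let: (e1, e2, e3, sg) := x in
  let: (a, b, c, d) := t in [/\ v4data H t A1 A2 A3, near_centre H `|A1| a
   (sgn e1 * sqrtC A1%:~R + sgn e2 * sqrtC A2%:~R + sgn e3 * sqrtC A3%:~R)
   & (a ^+ 3 - 4 * a * b + 8 * c < 0) = sg].
have le1 x : (cnt L (Q x))%:R <= 1 + 22 * spread `|A1|.
  case: x => [[[e1 e2] e3] sg].
  apply: (cnt_spread (f := fun t => t.1.1.1)) => //; first by rewrite mulr_ge0 ?spread_ge0.
    move=> [[[a b] c] d] [[[a' b'] c'] d'] [V N S] [V' N' S'] /= Ea.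
    rewrite -{}Ea in V' S' *.
    by have [-> -> ->] := v4data_inj V V' (etrans S (esym S')).
  move=> [[[a b] c] d] [[[a' b'] c'] d'] [V N S] [V' N' S'] /=.
  exact/le_spread/(near_centre_dist N N').
apply: le_trans (_ : (\sum_(x <- enum K) cnt L (Q x))%:R <= _).
  rewrite ler_nat; apply: leq_trans (@cnt_exists _ K L _ Q _); last by move=> t x _; rewrite mem_enum.
  apply: cnt_le => -[[[a b] c] d] V; case: (V) => _ _ _ _ N.
  have [|e1 [e2 [e3 h]]] := N A1; first by rewrite mem_head.
  by exists (e1, e2, e3, (a ^+ 3 - 4 * a * b + 8 * c < 0)%R).
rewrite natr_sum; apply: le_trans (_ : \sum_(x <- enum K) (1 + 22 * spread `|A1|) <= _).
  by apply: ler_sum => x _; apply: le1.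
rewrite big_const_seq count_predT -cardE !card_prod card_bool iter_addr_0.
by rewrite [X in _ <= X]mulr_natl.
Qed.

Lemma v4code_count al be ga m1 m2 m3 :
  (cnt L (fun t => v4code H t al be ga m1 m2 m3))%:R
    <= 128 * (1 + 22 * spread (al * be * m1 ^ 2)).
Proof.
pose K : finType := (bool * bool * bool)%type.
pose Q (x : K) t := let: (e1, e2, e3) := x in
  v4data H t (signed e1 (al * be * m1 ^ 2))
    (signed e2 (al * ga * m2 ^ 2)) (signed e3 (be * ga * m3 ^ 2)).
apply: le_trans (_ : (\sum_(x <- enum K) cnt L (Q x))%:R <= _).
  rewrite ler_nat; apply: leq_trans (@cnt_exists _ K L _ Q _); last by move=> t x _; rewrite mem_enum.
  by apply: cnt_le => t [e1 [e2 [e3 V]]]; exists (e1, e2, e3).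
rewrite natr_sum.
apply: le_trans (_ : \sum_(x <- enum K) 16 * (1 + 22 * spread (al * be * m1 ^ 2)) <= _).
  apply: ler_sum => -[[e1 e2] e3] _; apply: le_trans (v4data_count _ _ _) _.
  by rewrite /signed abszMsign.
rewrite big_const_seq count_predT -cardE !card_prod card_bool iter_addr_0.
by rewrite -[X in X <= _]mulr_natl mulrA -natrM.
Qed.

Lemma window_real (q X m n : nat) : (0 < q)%N ->
  (X <= q * m ^ 2 + 32 * H)%N -> (q * n ^ 2 <= X + 32 * H)%N -> (m <= n)%N ->
  (n - m)%N%:R <= 79 * H%:R / (height X * Num.sqrt q%:R).
Proof.
move=> q0 h1 h2 mn; have := sqr_window h1 h2 mn.
have s0 : 0 < Num.sqrt q%:R :> F by rewrite sqrtr_gt0 ltr0n.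
have p0 : 0 < height X * Num.sqrt q%:R by rewrite mulr_gt0 ?height_gt0.
rewrite -(ler_nat F) (natrM _ ((n - m) ^ 2)) (natrM _ q) (natrM _ (79 ^ 2)) !natrX -sqr_height -[X in _ * (X * _)]sqr_sqrtr ?ler0n //.
rewrite ler_pdivlMr // -!exprMn ler_pXn2r // ?nnegrE ?mulr_ge0 ?ler0n ?sqrtr_ge0 //.
by rewrite (mulrC (Num.sqrt _)).
Qed.

End V4count.

(** * Summation over the Klein parameters *)

Section V4sum.
Variable F : realType.
Variables (H : nat) (L : seq (int * int * int * int)).
Hypotheses (H0 : (0 < H)%N) (uL : uniq L).
Local Notation h := (H%:R : F).
Local Notation ht := (@height F H).
Local Notation spr := (@spread F H).

(** The order of the arguments is the order of nesting: [m3] is summed first, then [ga], [m2], [m1],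
    [be] and [al]. *)
Definition v4tuple al be m1 m2 ga m3 (t : int * int * int * int) : Prop :=
  [/\ (0 < be)%N && (be <= al)%N, (al <= ga)%N,
    [&& (0 < m1)%N, (0 < m2)%N & (0 < m3)%N] & v4code H t al be ga m1 m2 m3].

Let c (al be m1 : nat) : F := 128 * (1 + 22 * spr (al * be * m1 ^ 2)).
(** [c2 / sqrt ga] is [c] times the length of the window for [m3]; isolating [ga] gives the shape
    that the sum over [ga] expects. *)
Let c2 (al be m1 : nat) : F :=
  c al be m1 * (79 * h / (ht (al * be * m1 ^ 2) * Num.sqrt be%:R)).

Lemma c_ge0 al be m1 : 0 <= c al be m1.
Proof. by rewrite mulr_ge0 // addr_ge0 // mulr_ge0 // spread_ge0. Qed.

Lemma c2_ge0 al be m1 : 0 <= c2 al be m1.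
Proof. by rewrite mulr_ge0 ?c_ge0 // divr_ge0 ?mulr_ge0 ?sqrtr_ge0 ?ler0n. Qed.

Lemma v4_count_m3 al be m1 m2 ga : (0 < be)%N -> (0 < ga)%N ->
  (cnt L (fun t => exists m3, v4tuple al be m1 m2 ga m3 t))%:R
    <= c al be m1 + c2 al be m1 / Num.sqrt ga%:R.
Proof.
move=> be0 ga0; set X := (al * be * m1 ^ 2)%N.
have bg0 : (0 < be * ga)%N by rewrite muln_gt0 be0.
have s0 n : (0 < n)%N -> 0 < Num.sqrt n%:R :> F by move=> n0; rewrite sqrtr_gt0 ltr0n.
have D0 : 0 <= 79 * h / (ht X * Num.sqrt (be * ga)%:R).
  by rewrite divr_ge0 ?mulr_ge0 ?sqrtr_ge0 ?ler0n.
apply: le_trans (cnt_exists_window (a := 1) (c1 := c al be m1) (c2 := 0) isT D0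
  (c_ge0 _ _ _) (lexx _) _ _ _) _.
- by move=> x t [_ _ /and3P[_ _ ->]].
- move=> x y t t' [_ _ _ V] [_ _ _ V'] xy.
  have [_ _ [_ b1]] := v4code_facts V; have [_ _ [b2 _]] := v4code_facts V'.
  exact: window_real b1 b2 xy.
- move=> x t _; rewrite mul0r addr0; apply: le_trans (v4code_count F H0 uL al be ga m1 m2 x).
  by rewrite ler_nat; apply: cnt_le => t' [].
by rewrite mul0r addr0 mulrDr mulr1 lerD2l /c2 natrM sqrtrM ?ler0n // !invfM !mulrA.
Qed.

(** The window comes from [al * ga * m2 ^ 2] lying within [32 * H] of [al * be * m1 ^ 2]. Here the
    ordering pays: [ga >= al] gives the term [1 / sqrt al]. *)
Lemma v4_count_ga al be m1 m2 : (0 < be <= al)%N -> (0 < m2)%N ->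
  (cnt L (fun t => exists ga m3, v4tuple al be m1 m2 ga m3 t))%:R
    <= c al be m1 * (1 + 64 * h / (al%:R * m2%:R ^+ 2)) +
       c2 al be m1 * ((Num.sqrt al%:R)^-1 + 2 * Num.sqrt (64 * h / (al%:R * m2%:R ^+ 2))).
Proof.
move=> /andP[be0 ba] m20; have al0 : (0 < al)%N := leq_trans be0 ba.
have D0 : 0 <= 64 * h / (al%:R * m2%:R ^+ 2).
  by rewrite divr_ge0 ?mulr_ge0 ?exprn_ge0 ?ler0n.
apply: (cnt_exists_window al0 D0 (c_ge0 _ _ _) (c2_ge0 _ _ _)).
- by move=> x t [m3 []].
- move=> x y t t' [m3 [_ _ _ V]] [m3' [_ _ _ V']] xy.
  have [_ [_ b1] _] := v4code_facts V; have [_ [b2 _] _] := v4code_facts V'.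
  rewrite ler_pdivlMr ?mulr_gt0 ?exprn_gt0 ?ltr0n // -natrX -!natrM ler_nat.
  have -> : ((y - x) * (al * m2 ^ 2) = al * y * m2 ^ 2 - al * x * m2 ^ 2)%N.
    by rewrite mulnBl; congr (_ - _)%N; ring.
  rewrite leq_subLR; apply: leq_trans b2 _.
  by rewrite (_ : 64 = 32 + 32)%N // mulnDl addnA leq_add2r.
- move=> x t [m3 [_ ax _ _]]; apply: v4_count_m3 => //.
  exact: leq_trans ax.
Qed.

(** Naming the square roots [u], [v], [q], [r] turns all terms into rational functions, on which
    [field] can work. *)
Lemma v4_sum_m2 al be m1 : (0 < be <= al)%N -> ht (al * be * m1 ^ 2) <= 5 * h ->
  forall u v q r : F, u = Num.sqrt al%:R -> v = Num.sqrt be%:R -> q = Num.sqrt h ->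
  r = Num.sqrt (ht (al * be * m1 ^ 2)) ->
  \sum_(m2 <- iota 1 (Num.truncn (6 * ht (al * be * m1 ^ 2) / al%:R)))
   (c al be m1 * (1 + 64 * h / (al%:R * m2%:R ^+ 2)) +
       c2 al be m1 * ((Num.sqrt al%:R)^-1 + 2 * Num.sqrt (64 * h / (al%:R * m2%:R ^+ 2))))
  <= 3200 * (18 * q ^+ 2 / u ^+ 2 + 602 * q ^+ 3 / (r * u ^+ 2)
      + 80 * 100 * q ^+ 4 / (r ^+ 2 * v * u ^+ 2)).
Proof.
move=> /andP[be0 ba] R5 u v q r Du Dv Dq Dr; have al0 : (0 < al)%N := leq_trans be0 ba.
rewrite /c2 /c /spread; set R := height _ _ _ in R5 Dr *.
have R0 : 0 < R by apply: height_gt0.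
have u1 : 1 <= u by rewrite Du -{1}sqrtr1 ler_sqrt ?ler0n // ler1n.
have v1 : 1 <= v by rewrite Dv -{1}sqrtr1 ler_sqrt ?ler0n // ler1n.
have q0 : 0 < q by rewrite Dq sqrtr_gt0 ltr0n.
have r0 : 0 < r by rewrite Dr sqrtr_gt0.
have Eal : al%:R = u ^+ 2 by rewrite Du sqr_sqrtr ?ler0n.
have Eh : h = q ^+ 2 by rewrite Dq sqr_sqrtr ?ler0n.
have ER : R = r ^+ 2 by rewrite Dr sqr_sqrtr // ltW.
have u0 : 0 < u by lra.
have v0 : 0 < v by lra.
rewrite -Du -Dv.
have rq : r <= 3 * q.
  rewrite -(@ler_pXn2r _ 2) ?nnegrE ?mulr_ge0 ?(ltW q0) ?(ltW r0) //.
  rewrite -ER; have -> : (3 * q) ^+ 2 = 9 * h by rewrite Eh; ring.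
  have : 0 <= h by rewrite ler0n.
  by lra.
set cc := 128 * (1 + 22 * Num.sqrt (h / R)).
have Ecc : cc = 128 * (1 + 22 * (q / r)).
  by rewrite /cc sqrtrM ?ler0n // sqrtrV ?(ltW R0) // -Dq -Dr.
have qr0 : 0 < q / r by rewrite divr_gt0.
have cc0 : 0 <= cc by rewrite Ecc mulr_ge0 // addr_ge0 // mulr_ge0 // ltW.
(* [3200 = 128 * (3 + 22)], since [r <= 3 * q] absorbs the term 1. *)
have ccle : cc <= 3200 * (q / r).
  have : 1 <= 3 * (q / r) by rewrite mulrA ler_pdivlMr // mul1r.
  by rewrite Ecc; lra.
set e := 79 * q ^+ 2 / (r ^+ 2 * v).
have e0 : 0 <= e by rewrite divr_ge0 ?mulr_ge0 ?exprn_ge0 // ltW.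
pose M := 6 * R / al%:R.
have M0 : 0 <= M by rewrite divr_ge0 ?mulr_ge0 ?(ltW R0) ?ler0n.
have EM : M = 6 * r ^+ 2 / u ^+ 2 by rewrite /M ER Eal.
have sM : Num.sqrt M <= 3 * r / u.
  rewrite -(@ler_pXn2r _ 2) ?nnegrE ?sqrtr_ge0 ?divr_ge0 ?mulr_ge0 ?(ltW r0) ?(ltW u0) //.
  rewrite sqr_sqrtr // EM; have -> : (3 * r / u) ^+ 2 = 9 * r ^+ 2 / u ^+ 2 by field; rewrite gt_eqF.
  by rewrite ler_wpM2r ?invr_ge0 ?exprn_ge0 ?ler_wpM2r ?exprn_ge0 ?ler_nat // ltW.
rewrite -/M.
apply: le_trans (_ : \sum_(m2 <- iota 1 (Num.truncn M))
   (cc * (1 + e / u) + (cc * (64 * q ^+ 2 / u ^+ 2) * (m2%:R ^+ 2)^-1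
    + cc * (e * 16 * q / u) * m2%:R^-1)) <= _).
  apply: ler_sum_iota => m m0; have m0' : 0 < m%:R :> F by rewrite ltr0n.
  have -> : Num.sqrt (64 * h / (al%:R * m%:R ^+ 2)) = 8 * q / (u * m%:R).
    rewrite Eal Eh; have -> : 64 * q ^+ 2 / (u ^+ 2 * m%:R ^+ 2) = (8 * q / (u * m%:R)) ^+ 2.
      by field; rewrite !gt_eqF.
    by rewrite sqrtr_sqr ger0_norm // divr_ge0 ?mulr_ge0 // ltW.
  rewrite ER Eal Eh /e le_eqVlt; apply/orP; left; apply/eqP.
  by field; rewrite !gt_eqF.
rewrite !big_split /=.
have t1 := sum_const_truncn (mulr_ge0 cc0 (addr_ge0 ler01 (divr_ge0 e0 (ltW u0)))) M0.
have t2 : \sum_(i <- iota 1 (Num.truncn M)) cc * (64 * q ^+ 2 / u ^+ 2) * (i%:R ^+ 2)^-1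
    <= cc * (64 * q ^+ 2 / u ^+ 2) * 2.
  rewrite -mulr_sumr ler_wpM2l ?sum_inv_sqr // mulr_ge0 // divr_ge0 ?mulr_ge0 ?exprn_ge0 //; lra.
have t3 : \sum_(i <- iota 1 (Num.truncn M)) cc * (e * 16 * q / u) * i%:R^-1
    <= cc * (e * 16 * q / u) * (2 * (3 * r / u)).
  have k0 : 0 <= cc * (e * 16 * q / u).
    by rewrite mulr_ge0 // divr_ge0 ?(ltW u0) // mulr_ge0 ?(ltW q0) // mulr_ge0.
  by rewrite -mulr_sumr ler_wpM2l // (le_trans (sum_inv_le_sqrt M0)) // ler_wpM2l.
apply: le_trans (lerD t1 (lerD t2 t3)) _.
have -> : cc * (1 + e / u) * M + (cc * (64 * q ^+ 2 / u ^+ 2) * 2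
    + cc * (e * 16 * q / u) * (2 * (3 * r / u)))
  = cc * (6 * r ^+ 2 / u ^+ 2 + 474 * q ^+ 2 / (v * u ^+ 3) + 128 * q ^+ 2 / u ^+ 2
     + 79 * 96 * q ^+ 3 / (r * v * u ^+ 2)).
  by rewrite EM /e; field; rewrite !gt_eqF.
(* [r ^ 2 <= 3 * r * q] gives 18 in the result, [v * u >= 1] merges 474 and 128 into 602, and
   [79 * 96] is rounded to [80 * 100]. *)
apply: le_trans (_ : (3200 * (q / r)) * (6 * (r * (3 * q)) / u ^+ 2 + 602 * q ^+ 2 / u ^+ 2
     + 80 * 100 * q ^+ 3 / (r * v * u ^+ 2)) <= _).
  apply: ler_pM => //.
    by rewrite !addr_ge0 ?divr_ge0 ?mulr_ge0 ?exprn_ge0 // ltW.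
  have a1 : 6 * r ^+ 2 / u ^+ 2 <= 6 * (r * (3 * q)) / u ^+ 2.
    rewrite ler_wpM2r ?invr_ge0 ?exprn_ge0 ?(ltW u0) // ler_wpM2l // expr2 ler_wpM2l //.
    exact: ltW.
  have a2 : 474 * q ^+ 2 / (v * u ^+ 3) <= 474 * q ^+ 2 / u ^+ 2.
    rewrite ler_wpM2l ?mulr_ge0 ?exprn_ge0 ?(ltW q0) // lef_pV2 ?posrE ?mulr_gt0 ?exprn_gt0 //.
    have -> : v * u ^+ 3 = (v * u) * u ^+ 2 by ring.
    by rewrite ler_peMl ?exprn_ge0 ?(ltW u0) // mulr_ege1.
  have a3 : 79 * 96 * q ^+ 3 / (r * v * u ^+ 2) <= 80 * 100 * q ^+ 3 / (r * v * u ^+ 2).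
    rewrite ler_wpM2r ?invr_ge0 ?mulr_ge0 ?exprn_ge0 ?(ltW u0) ?(ltW v0) ?(ltW r0) //.
    by rewrite ler_wpM2r ?exprn_ge0 ?(ltW q0) // -!natrM ler_nat.
  have a4 : 602 * q ^+ 2 / u ^+ 2 = 474 * q ^+ 2 / u ^+ 2 + 128 * q ^+ 2 / u ^+ 2.
    by rewrite -!mulrA -mulrDl -natrD.
  rewrite a4; move: a1 a2 a3; move: (474 * _ / (v * _)) (_ / (_ * _ ^+ 2)) => x y.
  move: (_ / _) (_ / _) (_ / _) (_ / _) (_ / _) => *; lra.
rewrite le_eqVlt; apply/orP; left; apply/eqP; field; rewrite !gt_eqF //.
Qed.

End V4sum.

Section V4total.
Variable F : realType.
Variables (H : nat) (L : seq (int * int * int * int)).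
Hypotheses (H0 : (0 < H)%N) (uL : uniq L).
Local Notation h := (H%:R : F).
Local Notation ht := (@height F H).

Lemma height_le5 X : (X <= 21 * H ^ 2)%N -> ht X <= 5 * h.
Proof.
move=> XH; rewrite -(@ler_pXn2r _ 2) ?nnegrE ?mulr_ge0 ?ler0n ?sqrtr_ge0 //.
rewrite sqr_height exprMn -!natrX -natrM ler_nat.
have : (H <= H ^ 2)%N by rewrite -mulnn leq_pmulr.
by rewrite -[(5 ^ 2)%N]/(25%N); lia.
Qed.

Lemma v4_count_m2 al be m1 : (0 < be <= al)%N ->
  (exists t m2 ga m3, v4tuple H al be m1 m2 ga m3 t) ->
  forall u v q r : F, u = Num.sqrt al%:R -> v = Num.sqrt be%:R -> q = Num.sqrt h ->
  r = Num.sqrt (ht (al * be * m1 ^ 2)) ->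
  (cnt L (fun t => exists m2 ga m3, v4tuple H al be m1 m2 ga m3 t))%:R
  <= 3200 * (18 * q ^+ 2 / u ^+ 2 + 602 * q ^+ 3 / (r * u ^+ 2)
      + 80 * 100 * q ^+ 4 / (r ^+ 2 * v * u ^+ 2)).
Proof.
move=> ba [t [m2 [ga [m3 Qt]]]] u v q r Du Dv Dq Dr.
have X21 : (al * be * m1 ^ 2 <= 21 * H ^ 2)%N by case: Qt => _ _ _ /v4code_facts[].
apply: le_trans (v4_sum_m2 H0 ba (height_le5 X21) Du Dv Dq Dr).
have al0 : (0 < al)%N by case/andP: ba; apply: leq_trans.
apply: cnt_exists_le.
(* The range of [m2] comes from [(al * m2) ^ 2 <= al * ga * m2 ^ 2 <= X + 32 * H <= 36 * (X + H)],
   with [X = al * be * m1 ^ 2]. *)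
- move=> x t' [ga' [m3' [_ ag /and3P[_ x0 _] /v4code_facts[_ [b1 _] _]]]]; split => //.
  rewrite ler_pdivlMr ?ltr0n // -(@ler_pXn2r _ 2) ?nnegrE ?mulr_ge0 ?ler0n ?sqrtr_ge0 //.
  rewrite [X in _ <= X]exprMn sqr_height -natrM -!natrX -natrM ler_nat.
  apply: leq_trans (_ : al * be * m1 ^ 2 + 32 * H <= _)%N; last first.
    by rewrite -[(6 ^ 2)%N]/(36%N); lia.
  by apply: leq_trans b1; rewrite expnMn mulnC leq_mul2r -mulnn leq_mul2l ag !orbT.
- move=> x t' [ga' [m3' [_ _ /and3P[_ x0 _] _]]]; exact: v4_count_ga.
move=> x x0; have D0 : 0 <= 64 * h / (al%:R * x%:R ^+ 2).
  by rewrite divr_ge0 ?mulr_ge0 ?exprn_ge0 ?ler0n.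
rewrite addr_ge0 // mulr_ge0 ?c_ge0 ?c2_ge0 // addr_ge0 ?invr_ge0 ?sqrtr_ge0 //.
by rewrite mulr_ge0 ?sqrtr_ge0.
Qed.

(** The height is at least [sqrt (al * be) * m1], so each factor [1 / r] brings [1 / sqrt m1]. The
    range [m1 <= 5 * h / (u * v)] comes from [21 <= 25], and [3702 = 18 * 5 + 602 * 6]. Only the
    last term meets a harmonic sum. *)
Lemma v4_count_m1 al be : (0 < be <= al)%N ->
  forall u v q : F, u = Num.sqrt al%:R -> v = Num.sqrt be%:R -> q = Num.sqrt h ->
  (cnt L (fun t => exists m1 m2 ga m3, v4tuple H al be m1 m2 ga m3 t))%:R
  <= 3200 * q ^+ 4 * (3702 / (u ^+ 3 * v) + 80 * 100 * harm F (5 * H) / (u ^+ 3 * v ^+ 2)).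
Proof.
move=> ba u v q Du Dv Dq; have /andP[be0 le_ba] := ba.
have al0 : (0 < al)%N := leq_trans be0 le_ba.
have u0 : 0 < u by rewrite Du sqrtr_gt0 ltr0n.
have v0 : 0 < v by rewrite Dv sqrtr_gt0 ltr0n.
have q0 : 0 < q by rewrite Dq sqrtr_gt0 ltr0n.
have u1 : 1 <= u by rewrite Du -{1}sqrtr1 ler_sqrt ?ler0n // ler1n.
have v1 : 1 <= v by rewrite Dv -{1}sqrtr1 ler_sqrt ?ler0n // ler1n.
have Eal : al%:R = u ^+ 2 by rewrite Du sqr_sqrtr ?ler0n.
have Ebe : be%:R = v ^+ 2 by rewrite Dv sqr_sqrtr ?ler0n.
have Eh : h = q ^+ 2 by rewrite Dq sqr_sqrtr ?ler0n.
have uv0 : 0 < u * v by rewrite mulr_gt0.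
pose z := Num.sqrt (u * v).
have z0 : 0 < z by rewrite sqrtr_gt0.
have Ez : u * v = z ^+ 2 by rewrite sqr_sqrtr // ltW.
pose M := 5 * h / (u * v).
have M0 : 0 <= M by rewrite divr_ge0 ?mulr_ge0 ?ler0n // ltW.
pose B (m : nat) := 3200 * (18 * q ^+ 2 / u ^+ 2) + (3200 * (602 * q ^+ 3 / (z * u ^+ 2))
    * (Num.sqrt m%:R)^-1 + 3200 * (80 * 100 * q ^+ 4 / (z ^+ 2 * v * u ^+ 2)) * m%:R^-1).
have k1 : 0 <= 3200 * (18 * q ^+ 2 / u ^+ 2).
  by rewrite mulr_ge0 // divr_ge0 ?exprn_ge0 ?(ltW u0) // mulr_ge0 // exprn_ge0 // ltW.
have k2 : 0 <= 3200 * (602 * q ^+ 3 / (z * u ^+ 2)).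
  by rewrite mulr_ge0 // divr_ge0 // mulr_ge0 ?exprn_ge0 // ltW.
have k3 : 0 <= 3200 * (80 * 100 * q ^+ 4 / (z ^+ 2 * v * u ^+ 2)).
  rewrite mulr_ge0 // divr_ge0 //; first by rewrite mulr_ge0 ?exprn_ge0 ?(ltW q0) // mulr_ge0.
  by rewrite mulr_ge0 ?exprn_ge0 ?(ltW u0) // mulr_ge0 ?exprn_ge0 // ltW.
apply: le_trans (_ : \sum_(m1 <- iota 1 (Num.truncn M)) B m1 <= _).
  apply: cnt_exists_le.
  - move=> x t [m2 [ga [m3 [_ _ /and3P[x0 _ _] /v4code_facts[X21 _ _]]]]]; split => //.
    rewrite ler_pdivlMr // -(@ler_pXn2r _ 2) ?nnegrE ?mulr_ge0 ?ler0n ?(ltW u0) ?(ltW v0) //.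
    rewrite !exprMn -Eal -Ebe -!natrX -!natrM ler_nat mulnC.
    by apply: leq_trans X21 _; rewrite leq_mul2r orbC.
  - move=> x t [m2 [ga [m3 Qt]]]; have x0 : (0 < x)%N by case: Qt => _ _ /and3P[].
    set r := Num.sqrt (ht (al * be * x ^ 2)).
    apply: le_trans (v4_count_m2 ba _ Du Dv Dq (erefl r)) _.
      by exists t, m2, ga, m3.
    have r0 : 0 < r by rewrite sqrtr_gt0 height_gt0.
    have sx0 : 0 < Num.sqrt x%:R :> F by rewrite sqrtr_gt0 ltr0n.
    have zr : z * Num.sqrt x%:R <= r.
      rewrite /z -sqrtrM ?(ltW uv0) // ler_sqrt ?(ltW (height_gt0 _ _ _)) //.
      rewrite -(@ler_pXn2r _ 2) ?nnegrE ?mulr_ge0 ?ler0n ?sqrtr_ge0 ?(ltW u0) ?(ltW v0) //.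
      by rewrite sqr_height !exprMn -Eal -Ebe -!natrX -!natrM ler_nat leq_addr.
    have zx0 : 0 < z * Num.sqrt x%:R by rewrite mulr_gt0.
    have e1 : r^-1 <= z^-1 * (Num.sqrt x%:R)^-1 by rewrite -invfM lef_pV2 ?posrE.
    have e2 : (r ^+ 2)^-1 <= (z ^+ 2)^-1 * x%:R^-1.
      rewrite -{1}(sqr_sqrtr (ler0n F x)) -!exprVn -exprMn -invfM.
      by rewrite lerXn2r ?nnegrE ?invr_ge0 ?(ltW r0) ?(ltW zx0) // invfM.
    rewrite /B -(mulrA 3200 _ (Num.sqrt _)^-1) -(mulrA 3200 _ x%:R^-1) -!mulrDr ler_wpM2l // -addrA lerD2l.
    have u2 : 0 < u ^+ 2 by rewrite exprn_gt0.
    apply: lerD.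
      have -> : 602 * q ^+ 3 / (z * u ^+ 2) * (Num.sqrt x%:R)^-1
        = (602 * q ^+ 3 / u ^+ 2) * (z^-1 * (Num.sqrt x%:R)^-1).
        by field; rewrite !gt_eqF.
      have -> : 602 * q ^+ 3 / (r * u ^+ 2) = (602 * q ^+ 3 / u ^+ 2) * r^-1.
        by field; rewrite !gt_eqF.
      by rewrite ler_wpM2l // divr_ge0 ?(ltW u2) // mulr_ge0 ?exprn_ge0 // ltW.
    have -> : 80 * 100 * q ^+ 4 / (z ^+ 2 * v * u ^+ 2) * x%:R^-1
        = (80 * 100 * q ^+ 4 / (v * u ^+ 2)) * ((z ^+ 2)^-1 * x%:R^-1).
      by field; rewrite !gt_eqF ?ltr0n.
    have -> : 80 * 100 * q ^+ 4 / (r ^+ 2 * v * u ^+ 2)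
       = (80 * 100 * q ^+ 4 / (v * u ^+ 2)) * (r ^+ 2)^-1.
      by field; rewrite !gt_eqF.
    rewrite ler_wpM2l // divr_ge0 //; first by rewrite mulr_ge0 ?exprn_ge0 ?(ltW q0) // mulr_ge0.
    by rewrite mulr_ge0 // ltW.
  move=> x _; rewrite /B addr_ge0 // addr_ge0 // mulr_ge0 ?invr_ge0 ?sqrtr_ge0 //.
rewrite !big_split /=.
have t1 := sum_const_truncn k1 M0.
have sM : Num.sqrt M <= 3 * q / z.
  rewrite -(@ler_pXn2r _ 2) ?nnegrE ?sqrtr_ge0 ?divr_ge0 ?mulr_ge0 ?(ltW q0) ?(ltW z0) //.
  rewrite sqr_sqrtr // /M Eh Ez; have -> : (3 * q / z) ^+ 2 = 9 * q ^+ 2 / z ^+ 2.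
    by field; rewrite gt_eqF.
  by rewrite ler_wpM2r ?invr_ge0 ?exprn_ge0 ?ler_wpM2r ?exprn_ge0 ?ler_nat // ltW.
have t2 : \sum_(i <- iota 1 (Num.truncn M)) 3200 * (602 * q ^+ 3 / (z * u ^+ 2))
    * (Num.sqrt i%:R)^-1 <= 3200 * (602 * q ^+ 3 / (z * u ^+ 2)) * (2 * (3 * q / z)).
  by rewrite -mulr_sumr ler_wpM2l // (le_trans (sum_inv_sqrt_truncn M0)) // ler_wpM2l.
have t3 : \sum_(i <- iota 1 (Num.truncn M)) 3200 * (80 * 100 * q ^+ 4 / (z ^+ 2 * v * u ^+ 2))
    * i%:R^-1 <= 3200 * (80 * 100 * q ^+ 4 / (z ^+ 2 * v * u ^+ 2)) * harm F (5 * H).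
  rewrite -mulr_sumr ler_wpM2l //; apply: (@harm_le F).
  rewrite -(ler_nat F) natrM; apply: (@le_trans _ _ M); first by rewrite truncn_le.
  by rewrite ler_pdivrMr // ler_peMr ?mulr_ge0 ?ler0n // mulr_ege1.
apply: le_trans (lerD t1 (lerD t2 t3)) _.
rewrite le_eqVlt; apply/orP; left; apply/eqP.
rewrite /M -Ez Eh; have -> : 3200 * (602 * q ^+ 3 / (z * u ^+ 2)) * (2 * (3 * q / z))
  = 3200 * (3612 * q ^+ 4 / (z ^+ 2 * u ^+ 2)) by field; rewrite !gt_eqF.
by rewrite -Ez; field; rewrite !gt_eqF.
Qed.

(** In the term without logarithm, the sum of [1 / sqrt be] over [be <= al] leaves [1 / al], which
    creates one. The term that already has a logarithm meets the convergent double series. *)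
Lemma v4_count_total N : (30 * H <= N)%N ->
  (cnt L (fun t => exists al be m1 m2 ga m3, v4tuple H al be m1 m2 ga m3 t))%:R
  <= 3200 * (2 * 3702 + 80 * 100 * 9) * h ^+ 2 * harm F N.
Proof.
move=> NH; set q := Num.sqrt h.
have Eh : h = q ^+ 2 by rewrite /q sqr_sqrtr ?ler0n.
have q0 : 0 <= q by rewrite sqrtr_ge0.
pose b1 := 3200 * q ^+ 4 * 3702; pose b2 := 3200 * q ^+ 4 * (80 * 100 * harm F (5 * H)).
have b10 : 0 <= b1 by rewrite !mulr_ge0 ?exprn_ge0.
have q4 : 0 <= 3200 * q ^+ 4 by apply: mulr_ge0 (ler0n _ _) _; apply: exprn_ge0.
have b20 : 0 <= b2.
  by apply: mulr_ge0 q4 _; apply: mulr_ge0 (harm_ge0 _ _); apply: mulr_ge0; apply: ler0n.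
pose B (al be : nat) := b1 / (Num.sqrt al%:R ^+ 3) * (Num.sqrt be%:R)^-1
   + b2 * (al%:R * Num.sqrt al%:R * be%:R)^-1.
have B0 al be : 0 <= B al be.
  rewrite addr_ge0 // mulr_ge0 ?invr_ge0 ?sqrtr_ge0 //.
    by rewrite divr_ge0 ?exprn_ge0 ?sqrtr_ge0.
  by rewrite mulr_ge0 // mulr_ge0 ?sqrtr_ge0.
apply: le_trans (_ : \sum_(al <- iota 1 (Num.truncn (30 * h))) \sum_(be <- iota 1 al) B al be <= _).
  apply: cnt_exists_le; last by move=> al _; apply: sumr_ge0 => be _; apply: B0.
    move=> al t [be [m1 [m2 [ga [m3 [/andP[be0 ba] ag /and3P[_ m20 _] V]]]]]].
    split; first exact: leq_trans ba.
    have [X21 [b _] _] := v4code_facts V.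
    rewrite -natrM ler_nat -leq_sqr expnMn.
    apply: leq_trans (_ : al * ga * m2 ^ 2 <= _)%N.
      rewrite -[(al ^ 2)%N]muln1; apply: leq_mul; last by rewrite expn_gt0 m20.
      by rewrite -mulnn leq_mul2l ag orbT.
    have HH : (32 * H <= 32 * H ^ 2)%N by rewrite leq_mul2l -mulnn leq_pmulr.
    apply: leq_trans b _; apply: leq_trans (leq_add X21 HH) _.
    by rewrite -mulnDl leq_mul2r orbC.
  move=> al t [be' [m1' [m2' [ga' [m3' Qt']]]]].
  have -> : iota 1 al = iota 1 (Num.truncn (al%:R : F)) by rewrite natrK.
  apply: cnt_exists_le; last by move=> be _; apply: B0.
    by move=> be t1 [m1 [m2 [ga [m3 [/andP[be0 ba] _ _ _]]]]]; split => //; rewrite ler_nat.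
  move=> be t1 [m1 [m2 [ga [m3 [ba _ _ _]]]]].
  apply: le_trans (v4_count_m1 ba erefl erefl erefl) _.
  have /andP[be0 le_ba] := ba; have al0 : (0 < al)%N := leq_trans be0 le_ba.
  rewrite /B /b1 /b2 -/q le_eqVlt; apply/orP; left; apply/eqP.
  set u := Num.sqrt al%:R; set v := Num.sqrt be%:R.
  have u0 : 0 < u by rewrite sqrtr_gt0 ltr0n.
  have v0 : 0 < v by rewrite sqrtr_gt0 ltr0n.
  have -> : al%:R = u ^+ 2 by rewrite sqr_sqrtr ?ler0n.
  have -> : be%:R = v ^+ 2 by rewrite sqr_sqrtr ?ler0n.
  by field; rewrite !gt_eqF.
have HN : harm F (5 * H) <= harm F N.
  by apply: harm_le; apply: leq_trans NH; rewrite leq_mul2r orbC.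
have HM : harm F (Num.truncn (30 * h)) <= harm F N.
  by apply: harm_le; rewrite -natrM natrK.
under eq_bigr do rewrite big_split /=.
rewrite big_split /=.
have s1 : \sum_(al <- iota 1 (Num.truncn (30 * h))) \sum_(be <- iota 1 al)
    b1 / (Num.sqrt al%:R ^+ 3) * (Num.sqrt be%:R)^-1 <= 2 * b1 * harm F N.
  apply: le_trans (_ : 2 * b1 * harm F (Num.truncn (30 * h)) <= _); last first.
    by apply: ler_wpM2l HM; apply: mulr_ge0 b10; apply: ler0n.
  rewrite /harm mulr_sumr; apply: ler_sum_iota => al al0.
  have u0 : 0 < Num.sqrt al%:R :> F by rewrite sqrtr_gt0 ltr0n.
  rewrite -mulr_sumr.
  apply: le_trans (_ : b1 / Num.sqrt al%:R ^+ 3 * (2 * Num.sqrt al%:R) <= _).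
    by rewrite ler_wpM2l ?sum_inv_sqrt // divr_ge0 ?exprn_ge0 ?sqrtr_ge0.
  rewrite -[X in _ <= _ / X](sqr_sqrtr (ler0n F al)) le_eqVlt; apply/orP; left; apply/eqP.
  by field; rewrite gt_eqF.
have s2 : \sum_(al <- iota 1 (Num.truncn (30 * h))) \sum_(be <- iota 1 al)
    b2 * (al%:R * Num.sqrt al%:R * be%:R)^-1 <= b2 * 9.
  under eq_bigr do rewrite -mulr_sumr.
  by rewrite -mulr_sumr ler_wpM2l // sum_triangle_inv.
have s3 : b2 * 9 <= 3200 * q ^+ 4 * (80 * 100 * harm F N) * 9.
  rewrite ler_wpM2r //; apply: ler_wpM2l q4 _ _ _; apply: ler_wpM2l HN.
  by apply: mulr_ge0; apply: ler0n.
apply: le_trans (lerD s1 (le_trans s2 s3)) _.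
rewrite Eh /b1 le_eqVlt; apply/orP; left; apply/eqP; ring.
Qed.

End V4total.

(** * Cyclic quartics *)

(** The vector holds absolute values, [g] is its content and [j] the dyadic range of [k * s]. The
    ratio is 16 because the later estimates involve the fourth root of [k * s / H], which is then of
    order [2 ^ j]. *)
Definition cone (H k j g : nat) (v : nat * nat * nat) : Prop :=
  let: (s, d, w) := v in
  [/\ (k * s ^ 2 = d ^ 2 + w ^ 2)%N, (0 < w)%N, gcdn (gcdn s d) w = g,
      (k * s <= H * 16 ^ j)%N /\ (j = 0%N \/ (H * 16 ^ j < 16 * (k * s))%N)
    & (k * w ^ 2 <= 500 * H ^ 2)%N].

Definition c4tuple (H j k g : nat) (v : nat * nat * nat) (m : nat) t : Prop :=
  cone H k j g v /\ exists e f, c4data H t k m (signed e v.1.1) (signed f v.1.2) v.2.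

Lemma c4data_inj H (a b c e b' c' e' : int) k m s d w :
  c4data H (a, b, c, e) k m s d w -> c4data H (a, b', c', e') k m s d w ->
  (b, c, e) = (b', c', e').
Proof.
move=> [_ _ _ [E1 E2 E3] _] [_ _ _ [F1 F2 F3] _].
have n8 : (8 : int) != 0 by []; have n16 : (16 : int) != 0 by [].
have n256 : (256 : int) != 0 by [].
have -> : b = b' by apply: (mulfI n8); rewrite E1 F1.
have -> : c = c' by apply: (mulfI n16); rewrite E2 F2.
by have -> : e = e' by apply: (mulfI n256); rewrite E3 F3.
Qed.

Lemma C4_param (H : nat) t k m s d w : (0 < H)%N -> c4data H t k m s d w ->
  exists j k g v m, c4tuple H j k g v m t.
Proof.
move=> H0 D; pose v := (`|s|%N, `|d|%N, w).
have [_ Ec [_ _ Bw]] : [/\ [&& (0 < k)%N, (0 < m)%N & (0 < w)%N],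
      k%:Z * s ^+ 2 = d ^+ 2 + w%:Z ^+ 2 &
      [/\ `|k%:Z * m%:Z ^+ 2 - k%:Z * s| <= 26 * H%:Z, `|k%:Z * s| <= 11 * H%:Z ^+ 2
        & k%:Z * w%:Z ^+ 2 <= 500 * H%:Z ^+ 2]] by case: t D => [[[a b] c] e] [].
have w0 : (0 < w)%N by case: t D => [[[a b] c] e] [/and3P[]].
have ex : exists j, (k * `|s| <= H * 16 ^ j)%N.
  exists (k * `|s|)%N; apply: leq_trans (_ : 16 ^ (k * `|s|) <= _)%N.
    exact/ltnW/ltn_expl.
  by rewrite leq_pmull.
case: (ex_minnP ex) => j js minj.
exists j, k, (gcdn (gcdn `|s| `|d|) w), v, m; split; last first.
  by exists (s < 0), (d < 0); rewrite /v /signed /= -!intEsign.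
split => //.
- have sq (z : int) : (`|z| ^ 2)%N%:Z = z ^+ 2.
    by rewrite -[LHS]/(`|z|%N%:Z ^+ 2) abszE -normrX ger0_norm ?sqr_ge0.
  apply/eqP; rewrite -eqz_nat PoszD PoszM !sq Ec; exact: eqxx.
- split => //; case: j js minj => [|j] js minj; [by left|right].
  rewrite ltnNge; apply/negP=> le; suff : (j.+1 <= j)%N by rewrite ltnn.
  apply: minj; rewrite -(@leq_pmul2l 16) // (_ : (16 * (H * 16 ^ j) = H * 16 ^ j.+1)%N) //.
  by rewrite expnS mulnCA.
Qed.

(** The constant 26 is relaxed to 32 so that the window estimate of the Klein case applies to
    [m]. *)
Lemma c4tuple_facts H j k g v m t : c4tuple H j k g v m t ->
  [/\ (0 < k)%N, (0 < m)%N, (k * v.1.1 <= 11 * H ^ 2)%N,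
    (k * m ^ 2 <= k * v.1.1 + 32 * H)%N & (k * v.1.1 <= k * m ^ 2 + 32 * H)%N].
Proof.
case: v => [[s d] w]; case: t => [[[a b] c] e].
move=> [_ [f [f' [/and3P[k0 m0 _] _ [B1 B2 _] _ _]]]]; rewrite /= in B1 B2 *.
have E : `|k%:Z * signed f s| = (k * s)%N%:Z by rewrite normrM /signed normrMsign.
split => //.
- by move: B2; rewrite E -[H%:Z ^+ 2]/((H ^ 2)%N%:Z); lia.
- have := le_trans (lerB_dist _ _) B1; rewrite E.
  by rewrite -[m%:Z ^+ 2]/((m ^ 2)%N%:Z); lia.
rewrite distrC in B1; have := le_trans (lerB_dist _ _) B1; rewrite E.
by rewrite -[m%:Z ^+ 2]/((m ^ 2)%N%:Z); lia.
Qed.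

Lemma cone_gt0 H k j g s d w : cone H k j g (s, d, w) ->
  [/\ (0 < k)%N, (0 < s)%N, (0 < g)%N & (g <= w)%N].
Proof.
move=> [E w0 <- _ _]; have : (0 < k * s ^ 2)%N by rewrite E addn_gt0 orbC expn_gt0 w0.
rewrite !muln_gt0 => /andP[-> /andP[-> _]]; split => //.
  by rewrite gcdn_gt0 w0 orbT.
by rewrite dvdn_leq // dvdn_gcdr.
Qed.

(* Two null vectors of the form [k s ^ 2 - d ^ 2 - w ^ 2] whose polar product vanishes are
   proportional, and equal when they have the same content. *)
Lemma cone_polar H k j g s d w s' d' w' :
  cone H k j g (s, d, w) -> cone H k j g (s', d', w') ->
  (k * s * s' = d * d' + w * w')%N -> (s, d, w) = (s', d', w').
Proof.
move=> Cv [E' w0' G' _ _] P; have [k0 s0 g0 _] := cone_gt0 Cv; case: Cv => [E w0 G _ _].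
have Ed : (d * w' = d' * w)%N.
  have Z : (d%:Z * w'%:Z - d'%:Z * w%:Z) ^+ 2 = 0.
    transitivity ((d ^ 2 + w ^ 2)%N%:Z * (d' ^ 2 + w' ^ 2)%N%:Z - (d * d' + w * w')%N%:Z ^+ 2).
      by rewrite !PoszD !PoszM; ring.
    by rewrite -E -E' -P !PoszM; ring.
  by apply/eqP; rewrite -eqz_nat !PoszM -subr_eq0 -sqrf_eq0 Z.
have Es : (s * w' = s' * w)%N.
  have e2 : (k * (s * w') ^ 2 = k * (s' * w) ^ 2)%N.
    have -> : (k * (s * w') ^ 2 = (d * w') ^ 2 + (w * w') ^ 2)%N.
      by rewrite expnMn mulnA E mulnDl !expnMn.
    by rewrite (expnMn s') mulnA E' Ed !expnMn mulnDl (mulnC (w ^ 2)%N).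
  by move/eqP: e2; rewrite eqn_pmul2l // eqn_sqr => /eqP.
have Ew : w = w'.
  have e : (gcdn (gcdn s d) w * w' = gcdn (gcdn s' d') w' * w)%N.
    by rewrite !muln_gcdl Ed Es (mulnC w).
  by move/eqP: e; rewrite G G' eqn_pmul2l // => /eqP.
rewrite -Ew in Es Ed *; move/eqP: Es; move/eqP: Ed.
by rewrite !eqn_pmul2r // => /eqP -> /eqP ->.
Qed.

(** The polar product is divisible by [g ^ 2], and it does not vanish on distinct vectors of the
    same content. *)
Lemma cone_polar_ge H k j g s d w s' d' w' :
  cone H k j g (s, d, w) -> cone H k j g (s', d', w') -> (s, d, w) <> (s', d', w') ->
  (d * d' + w * w' <= k * s * s')%N -> (g ^ 2 + (d * d' + w * w') <= k * s * s')%N.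
Proof.
move=> C C' ne le; rewrite addnC -leq_subRL //.
have pos : (0 < k * s * s' - (d * d' + w * w'))%N.
  rewrite subn_gt0 ltn_neqAle le andbT; apply/eqP=> E; apply: ne.
  exact: cone_polar C C' (esym E).
have gs x x' : (g %| x -> g %| x' -> g ^ 2 %| x * x')%N.
  by move=> *; rewrite -mulnn dvdn_mul.
have gdvd x y z : gcdn (gcdn x y) z = g -> [/\ g %| x, g %| y & g %| z]%N.
  move=> <-; rewrite dvdn_gcdr.
  by split => //; apply: dvdn_trans (dvdn_gcdl _ _) _; rewrite ?dvdn_gcdl ?dvdn_gcdr.
have [g1 g2 g3] : [/\ g %| s, g %| d & g %| w]%N by case: C => _ _ /gdvd.
have [h1 h2 h3] : [/\ g %| s', g %| d' & g %| w']%N by case: C' => _ _ /gdvd.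
apply: dvdn_leq => //; apply: dvdn_sub.
  by rewrite -mulnA dvdn_mull // gs.
by rewrite dvdn_add // gs.
Qed.

(** * Separation of slopes on the cone *)

Section Cone.
Variable F : realType.
Variables (H : nat).
Hypotheses (H0 : (0 < H)%N).
Local Notation h := (H%:R : F).

(** With [p = s * sqrt k + d] and slope [y = w / p], the cone equation reads
    [w ^ 2 = p * (s * sqrt k - d)], and twice the polar product of two vectors is
    [p * p' * (y - y') ^ 2]. As [p <= P], slopes differ by at least [g / P]. They lie below
    [368 / 16 ^ j], and this power of 16 cancels the one in [P]. *)
Lemma cone_count k j g N : (0 < k)%N -> (0 < g)%N ->
  (cnt (enum [the finType of ('I_N * 'I_N * 'I_N)%type])
    (fun v => cone H k j g (nat_of_ord v.1.1, nat_of_ord v.1.2, nat_of_ord v.2)))%:R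
  <= 1 + 736 * h / (Num.sqrt k%:R * g%:R).
Proof.
move=> k0 g0; pose r := Num.sqrt k%:R : F.
have r0 : 0 < r by rewrite sqrtr_gt0 ltr0n.
have rr : r ^+ 2 = k%:R by rewrite sqr_sqrtr ?ler0n.
have h0 : 0 < h by rewrite ltr0n.
have g0' : 0 < g%:R :> F by rewrite ltr0n.
pose p (s d : nat) := r * s%:R + d%:R.
pose P := 2 * h * 16 ^+ j / r.
have P0 : 0 < P by rewrite divr_gt0 ?mulr_gt0 ?exprn_gt0.
have ps0 s d : (0 < s)%N -> 0 < p s d.
  by move=> s0; rewrite ltr_wpDr ?ler0n // mulr_gt0 ?ltr0n.
have ineq s d w : cone H k j g (s, d, w) ->
    [/\ 0 < p s d, p s d <= P, 0 < w%:R :> F, (p s d) * (r * s%:R - d%:R) = w%:R ^+ 2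
      & w%:R / p s d <= 368 / 16 ^+ j].
  move=> C; have [_ s0 _ _] := cone_gt0 C; case: C => [E w0 _ [ks jj] kw].
  have ER : r ^+ 2 * s%:R ^+ 2 = d%:R ^+ 2 + w%:R ^+ 2 :> F.
    by rewrite rr -!natrX -natrM -natrD E.
  have rs0 : 0 < r * s%:R by rewrite mulr_gt0 ?ltr0n.
  have drs : d%:R <= r * s%:R.
    rewrite -(@ler_pXn2r _ 2) ?nnegrE ?ler0n ?(ltW rs0) // exprMn ER lerDl.
    by rewrite exprn_ge0.
  have wrs : w%:R <= r * s%:R.
    rewrite -(@ler_pXn2r _ 2) ?nnegrE ?ler0n ?(ltW rs0) // exprMn ER lerDr.
    by rewrite exprn_ge0.
  have ks' : r ^+ 2 * s%:R <= h * 16 ^+ j by rewrite rr -!natrX -!natrM ler_nat.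
  have wr : w%:R * r <= 23 * h.
    rewrite -(@ler_pXn2r _ 2) ?nnegrE ?mulr_ge0 ?ler0n ?(ltW r0) // !exprMn rr.
    rewrite -!natrX -!natrM ler_nat mulnC; apply: leq_trans kw _.
    by rewrite leq_mul2r orbC.
  split => //.
  - exact: ps0.
  - rewrite /p /P ler_pdivlMr //; apply: le_trans (_ : (r * s%:R + r * s%:R) * r <= _).
      by rewrite ler_wpM2r ?(ltW r0) // lerD2l.
    have -> : (r * s%:R + r * s%:R) * r = 2 * (r ^+ 2 * s%:R) by ring.
    by rewrite -mulrA ler_wpM2l.
  - by rewrite ltr0n.
  - by rewrite /p; transitivity (r ^+ 2 * s%:R ^+ 2 - d%:R ^+ 2); [ring|rewrite ER; ring].
  apply: le_trans (_ : w%:R / (r * s%:R) <= _).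
    by rewrite ler_wpM2l ?ler0n // lef_pV2 ?posrE ?ps0 // lerDl ler0n.
  (* [368 = 16 * 23], with 23 from [500 <= 23 ^ 2] and 16 from the lower end of the dyadic range.
     For [j = 0] there is no lower end, and [w <= s * sqrt k] suffices. *)
  rewrite ler_pdivrMr //; case: jj => [->|jj].
    by rewrite expr0 divr1 (le_trans wrs) // ler_peMl ?(ltW rs0) // ler1n.
  have jj' : h * 16 ^+ j <= 16 * (r ^+ 2 * s%:R).
    by rewrite rr -!natrX -!natrM ler_nat ltnW.
  rewrite mulrAC ler_pdivlMr ?exprn_gt0 // -(ler_pM2r r0).
  apply: le_trans (_ : 23 * h * 16 ^+ j <= _).
    by rewrite mulrAC ler_wpM2r ?exprn_ge0.
  by rewrite -mulrA; lra.
apply: le_trans (@cnt_separated F _ _ _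
  (fun v => (nat_of_ord v.2)%:R / p (nat_of_ord v.1.1) (nat_of_ord v.1.2))
  (g%:R / P) (368 / 16 ^+ j) (enum_uniq _) _ _ _ _) _.
- by rewrite divr_gt0.
- by rewrite divr_ge0 ?exprn_ge0.
- by move=> [[s d] w] /ineq[p0 _ w0 _ le]; rewrite le divr_ge0 // ltW.
- move=> [[s d] w] [[s' d'] w'] /= C C' ne.
  have {}ne : (nat_of_ord s, nat_of_ord d, nat_of_ord w)
     <> (nat_of_ord s', nat_of_ord d', nat_of_ord w').
    by case=> /val_inj E1 /val_inj E2 /val_inj E3; apply: ne; rewrite E1 E2 E3.
  have [p0 pP w0 pq _] := ineq _ _ _ C; have [p0' pP' w0' pq' _] := ineq _ _ _ C'.
  set x := p s d in p0 pP pq *; set x' := p s' d' in p0' pP' pq' *.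
  set y := w%:R / x; set y' := w'%:R / x'.
  have Eq : 2 * ((k * s * s')%N%:R - (d * d' + w * w')%N%:R) = x * x' * (y - y') ^+ 2.
    have -> : x * x' * (y - y') ^+ 2 = w%:R ^+ 2 * x' / x + w'%:R ^+ 2 * x / x'
       - 2 * w%:R * w'%:R by rewrite /y /y'; field; rewrite !gt_eqF.
    rewrite -pq -pq' natrD !natrM -rr.
    have -> : x * (r * s%:R - d%:R) * x' / x = (r * s%:R - d%:R) * x'.
      by field; rewrite gt_eqF.
    have -> : x' * (r * s'%:R - d'%:R) * x / x' = (r * s'%:R - d'%:R) * x.
      by field; rewrite gt_eqF.
    by rewrite /x /x' /p; ring.
  have nn : 0 <= x * x' * (y - y') ^+ 2.
    by rewrite mulr_ge0 ?exprn_even_ge0 // mulr_ge0 // ltW.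
  have le : (d * d' + w * w' <= k * s * s')%N.
    by rewrite -(ler_nat F) -subr_ge0; move: nn; rewrite -Eq pmulr_rge0.
  have := cone_polar_ge C C' ne le; rewrite -(ler_nat F) natrD natrX => ge.
  have {}ge : g%:R ^+ 2 <= x * x' * (y - y') ^+ 2.
    by have : 0 <= g%:R ^+ 2 :> F; [rewrite exprn_ge0|rewrite -Eq; lra].
  have {}ge : (g%:R / P) ^+ 2 <= (y - y') ^+ 2.
    rewrite exprMn exprVn ler_pdivrMr ?exprn_gt0 //; apply: le_trans ge _.
    rewrite mulrC ler_wpM2l ?exprn_even_ge0 // expr2.
    by apply: ler_pM => //; apply: ltW.
  move: ge; rewrite -[(y - y') ^+ 2]real_normK ?num_real // ler_pXn2r //.
    by rewrite nnegrE divr_ge0 ?ler0n // ltW.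
  by rewrite nnegrE normr_ge0.
rewrite lerD2l /P le_eqVlt; apply/orP; left; apply/eqP; rewrite -/r.
have : 16 ^+ j != 0 :> F by rewrite expf_neq0 ?pnatr_eq0.
by move: (16 ^+ j : F) => y y0; field; rewrite y0 !gt_eqF.
Qed.
End Cone.

(** * Summation over the cyclic parameters *)

Section C4sum.
Variable F : realType.

Lemma cnt_exists_const (T : eqType) (L : seq T) (K : eqType) (ks : seq K) (P : K -> Prop)
    (Q : K -> T -> Prop) (c : F) :
  (forall x t, Q x t -> x \in ks /\ P x) -> (forall x t, Q x t -> (cnt L (Q x))%:R <= c) ->
  0 <= c -> (cnt L (fun t => exists x, Q x t))%:R <= (cnt ks P)%:R * c.
Proof.
move=> mem le c0.
apply: le_trans (_ : (\sum_(x <- [seq x <- ks | decb (P x)]) cnt L (Q x))%:R <= _).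
  rewrite ler_nat; apply: cnt_exists => t x /mem[xk Px].
  by rewrite mem_filter xk andbT; apply/decbP.
rewrite natr_sum.
apply: le_trans (_ : \sum_(x <- [seq x <- ks | decb (P x)]) c <= _).
  apply: ler_sum => x _; have [/hasP[t _ /decbP/le//]|no] := boolP (has (fun t => decb (Q x t)) L).
  by rewrite /cnt; move: no; rewrite has_count -leqNgt leqn0 => /eqP ->.
by rewrite big_const_seq count_predT size_filter iter_addr_0 mulr_natl.
Qed.

Variables (H : nat) (L : seq (int * int * int * int)).
Hypotheses (H0 : (0 < H)%N) (uL : uniq L).
Local Notation h := (H%:R : F).
Local Notation ht := (@height F H).
Local Notation spr := (@spread F H).

Lemma c4data_count k m s d w :
  (cnt L (fun t => c4data H t k m s d w))%:R <= 4 * (1 + 22 * spr `|k%:Z * s|).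
Proof.
pose K : finType := (bool * bool)%type.
pose Q (x : K) (t : int * int * int * int) := let: (a, b, c, e) := t in
  c4data H t k m s d w /\ near_centre H `|k%:Z * s| a (sgn x.1 * (m%:R * sqrtC k%:R)
    + sgn x.2 * (2 * sqrtC (((k%:Z * s)%:~R + sgn x.1 * (d%:~R * sqrtC k%:R)) / 2))).
have le1 x : (cnt L (Q x))%:R <= 1 + 22 * spr `|k%:Z * s|.
  apply: (cnt_spread (f := fun t => t.1.1.1)) => //; first by rewrite mulr_ge0 ?spread_ge0.
    move=> [[[a b] c] e] [[[a' b'] c'] e'] [V N] [V' N'] /= Ea.
    by rewrite -{}Ea in V' *; have [-> -> ->] := c4data_inj V V'.
  move=> [[[a b] c] e] [[[a' b'] c'] e'] [V N] [V' N'] /=.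
  exact/le_spread/(near_centre_dist N N').
apply: le_trans (_ : (\sum_(x <- enum K) cnt L (Q x))%:R <= _).
  rewrite ler_nat; apply: leq_trans (@cnt_exists _ K L _ Q _); last by move=> t x _; rewrite mem_enum.
  by apply: cnt_le => -[[[a b] c] e] V; case: (V) => _ _ _ _ [p [q N]]; exists (p, q).
rewrite natr_sum; apply: le_trans (_ : \sum_(x <- enum K) (1 + 22 * spr `|k%:Z * s|) <= _).
  by apply: ler_sum => x _; apply: le1.
rewrite big_const_seq count_predT -cardE !card_prod card_bool iter_addr_0.
by rewrite [X in _ <= X]mulr_natl.
Qed.

(** The factor 16 is 4 for the signs of [s] and [d] times 4 for the two signs in the centre. *)
Lemma c4tuple_count j k g v m :
  (cnt L (c4tuple H j k g v m))%:R <= 16 * (1 + 22 * spr (k * v.1.1)).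
Proof.
pose K : finType := (bool * bool)%type.
pose Q (x : K) t := c4data H t k m (signed x.1 v.1.1) (signed x.2 v.1.2) v.2.
apply: le_trans (_ : (\sum_(x <- enum K) cnt L (Q x))%:R <= _).
  rewrite ler_nat; apply: leq_trans (@cnt_exists _ K L _ Q _); last by move=> t x _; rewrite mem_enum.
  by apply: cnt_le => t [_ [e [f V]]]; exists (e, f).
rewrite natr_sum; apply: le_trans (_ : \sum_(x <- enum K) 4 * (1 + 22 * spr (k * v.1.1)) <= _).
  apply: ler_sum => x _; apply: le_trans (c4data_count _ _ _ _ _) _.
  by rewrite abszM /signed abszMsign.
rewrite big_const_seq count_predT -cardE !card_prod card_bool iter_addr_0.
by rewrite -[X in X <= _]mulr_natl mulrA -natrM.
Qed.

Lemma c4_count_m j k g v : (0 < k)%N ->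
  (cnt L (fun t => exists m, c4tuple H j k g v m t))%:R
  <= 16 * (1 + 22 * spr (k * v.1.1)) * (1 + 79 * h / (ht (k * v.1.1) * Num.sqrt k%:R)).
Proof.
move=> k0; have s0 := spread_ge0 F H (k * v.1.1).
have c0 : 0 <= 16 * (1 + 22 * spr (k * v.1.1)) by rewrite mulr_ge0 // addr_ge0 // mulr_ge0.
have D0 : 0 <= 79 * h / (ht (k * v.1.1) * Num.sqrt k%:R).
  by rewrite divr_ge0 ?mulr_ge0 ?sqrtr_ge0 ?ler0n.
apply: le_trans (cnt_exists_window (a := 1) isT D0 c0 (lexx 0) _ _ _) _.
- by move=> x t /c4tuple_facts[].
- move=> x y t t' Q Q' xy; have [_ _ _ _ b1] := c4tuple_facts Q.
  have [_ _ _ b2 _] := c4tuple_facts Q'; exact: window_real b1 b2 xy.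
- by move=> x t Q; rewrite mul0r addr0 c4tuple_count.
by rewrite mul0r addr0.
Qed.

Variable e : F.
Hypotheses (e1 : 1 <= e) (eh : e ^+ 4 = h).

(** In the range [j] the height is at least [(e * 2 ^ j) ^ 2 / 4], so the spread is at most
    [2 * e / 2 ^ j]. The hypothesis on [2 ^ j] absorbs the term 1: [768 = 16 * (4 + 44)], and
    [316 = 79 * 4]. *)
Lemma c4_count_m_scaled j k g v t m : c4tuple H j k g v m t -> 2 ^+ j <= 4 * e ->
  (cnt L (fun t => exists m, c4tuple H j k g v m t))%:R
  <= 768 * (e / 2 ^+ j) * (1 + 316 * e ^+ 2 / (2 ^+ j) ^+ 2 / Num.sqrt k%:R).
Proof.
move=> Q ye; have [k0 _ _ _ _] := c4tuple_facts Q.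
apply: le_trans (c4_count_m j g v k0) _; move: ye.
have e0 : 0 < e := lt_le_trans ltr01 e1.
have E16 : 16 ^+ j = (2 ^+ j) ^+ 4 :> F by rewrite -exprM mulnC exprM; congr (_ ^+ _); rewrite -natrX.
have y0 : 0 < 2 ^+ j :> F by rewrite exprn_gt0.
have hX : h * 16 ^+ j <= 16 * (k * v.1.1 + H)%:R.
  case: Q => + _; case: v => [[s d] w] [_ _ _ [_ jj] _] /=.
  case: jj => [->|jj]; first by rewrite expr0 mulr1 -natrM ler_nat; lia.
  by rewrite -natrX -!natrM ler_nat; lia.
rewrite E16 in hX; move: (2 ^+ j) y0 hX => y y0 hX ye.
have k1 : 1 <= Num.sqrt k%:R :> F by rewrite -{1}sqrtr1 ler_sqrt ?ler0n // ler1n.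
set X := (k * v.1.1)%N in hX *.
have R0 := height_gt0 F H0 X.
have Rge : e ^+ 2 * y ^+ 2 / 4 <= ht X.
  rewrite -(@ler_pXn2r _ 2) ?nnegrE ?divr_ge0 ?mulr_ge0 ?exprn_ge0 ?(ltW e0) ?(ltW y0) ?sqrtr_ge0 //.
  rewrite sqr_height; have -> : (e ^+ 2 * y ^+ 2 / 4) ^+ 2 = e ^+ 4 * y ^+ 4 / 16 by field.
  by rewrite eh; lra.
have Rlow0 : 0 < e ^+ 2 * y ^+ 2 / 4 by rewrite divr_gt0 ?mulr_gt0 ?exprn_gt0.
have qy : 0 < 2 * (e / y) by rewrite mulr_gt0 // divr_gt0.
have W : spr X <= 2 * (e / y).
  rewrite -(@ler_pXn2r _ 2) ?nnegrE ?spread_ge0 ?(ltW qy) //.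
  rewrite sqr_sqrtr ?divr_ge0 ?ler0n ?(ltW R0) //.
  apply: le_trans (_ : h / (e ^+ 2 * y ^+ 2 / 4) <= _).
    by rewrite ler_wpM2l ?ler0n // lef_pV2 ?posrE.
  by rewrite -eh le_eqVlt; apply/orP; left; apply/eqP; field; rewrite !gt_eqF.
have y4 : 1 <= 4 * (e / y) by rewrite mulrA ler_pdivlMr // mul1r.
apply: ler_pM.
- by rewrite mulr_ge0 // addr_ge0 // mulr_ge0 // spread_ge0.
- by rewrite addr_ge0 // divr_ge0 ?mulr_ge0 ?ler0n ?sqrtr_ge0.
- by lra.
rewrite lerD2l invfM mulrA ler_wpM2r ?invr_ge0 ?sqrtr_ge0 //.
apply: le_trans (_ : 79 * h / (e ^+ 2 * y ^+ 2 / 4) <= _).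
  by rewrite ler_wpM2l ?mulr_ge0 ?ler0n // lef_pV2 ?posrE.
by rewrite -eh le_eqVlt; apply/orP; left; apply/eqP; field; rewrite !gt_eqF.
Qed.

Lemma c4_count_v j k g : (0 < k)%N -> (0 < g)%N -> 2 ^+ j <= 4 * e ->
  (cnt L (fun t => exists v m, c4tuple H j k g v m t))%:R
  <= (1 + 736 * h / (Num.sqrt k%:R * g%:R)) *
   (768 * (e / 2 ^+ j) * (1 + 316 * e ^+ 2 / (2 ^+ j) ^+ 2 / Num.sqrt k%:R)).
Proof.
move=> k0 g0 ye; set c := 768 * _ * _.
have e0 : 0 < e := lt_le_trans ltr01 e1.
have y0 : 0 < 2 ^+ j :> F by rewrite exprn_gt0.
have c0 : 0 <= c.
  rewrite mulr_ge0 //; first by rewrite mulr_ge0 // divr_ge0 // ltW.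
  by rewrite addr_ge0 // divr_ge0 ?sqrtr_ge0 // divr_ge0 ?mulr_ge0 ?exprn_ge0 // ltW.
(* All three coordinates are at most [H * 16 ^ j], because [k * s ^ 2 <= (k * s) ^ 2]. This only
   provides a finite type: the bound on the cone is uniform in [N]. *)
pose N := (H * 16 ^ j).+1; pose K : finType := ('I_N * 'I_N * 'I_N)%type.
pose u (x : K) := (nat_of_ord x.1.1, nat_of_ord x.1.2, nat_of_ord x.2).
pose Q (x : K) t := exists m, c4tuple H j k g (u x) m t.
apply: le_trans (_ : (cnt L (fun t => exists x, Q x t))%:R <= _).
  rewrite ler_nat; apply: cnt_le => t [[[s d] w] [m Qt]].
  have [C _] := Qt; have [_ s0 _ _] := cone_gt0 C; case: C => [E _ _ [ks _] _].
  have sN : (s < N)%N by rewrite ltnS; apply: leq_trans ks; rewrite leq_pmull.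
  have sq : (k * s ^ 2 <= (H * 16 ^ j) ^ 2)%N.
    by apply: leq_trans (_ : (k * s) ^ 2 <= _)%N; rewrite ?leq_sqr // expnMn leq_mul2r -mulnn leq_pmulr // orbT.
  have dN : (d < N)%N by rewrite ltnS -leq_sqr (leq_trans _ sq) // E leq_addr.
  have wN : (w < N)%N by rewrite ltnS -leq_sqr (leq_trans _ sq) // E leq_addl.
  by exists (Ordinal sN, Ordinal dN, Ordinal wN), m.
apply: le_trans (@cnt_exists_const _ L K (enum K) (fun x => cone H k j g (u x)) Q c _ _ c0) _.
- by move=> x t [m [C _]]; rewrite mem_enum.
- by move=> x t [m Qt]; apply: c4_count_m_scaled Qt ye.
by rewrite ler_wpM2r // cone_count.
Qed.

(** The content divides [w], so [g <= 23 * h / sqrt k]. The term 1 contributes the length of this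
    range, also bounded by a harmonic multiple: [759 = 23 + 736]. *)
Lemma c4_count_g j k N : (0 < k)%N -> 2 ^+ j <= 4 * e -> (23 * H <= N)%N ->
  (cnt L (fun t => exists g v m, c4tuple H j k g v m t))%:R
  <= 759 * h * harm F N * (768 * (e / 2 ^+ j)) *
    ((Num.sqrt k%:R)^-1 + 316 * e ^+ 2 / (2 ^+ j) ^+ 2 * k%:R^-1).
Proof.
move=> k0 ye HN; set x := Num.sqrt k%:R.
have e0 : 0 < e := lt_le_trans ltr01 e1.
have y0 : 0 < 2 ^+ j :> F by rewrite exprn_gt0.
have x0 : 0 < x by rewrite sqrtr_gt0 ltr0n.
have x1 : 1 <= x by rewrite /x -{1}sqrtr1 ler_sqrt ?ler0n // ler1n.
have Ex : k%:R = x ^+ 2 by rewrite sqr_sqrtr ?ler0n.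
set c := 768 * (e / 2 ^+ j) * (1 + 316 * e ^+ 2 / (2 ^+ j) ^+ 2 / x).
have c0 : 0 <= c.
  rewrite mulr_ge0 //; first by rewrite mulr_ge0 // divr_ge0 // ltW.
  by rewrite addr_ge0 // divr_ge0 ?(ltW x0) // divr_ge0 ?mulr_ge0 ?exprn_ge0 // ltW.
pose M := 23 * h / x.
have M0 : 0 <= M by rewrite divr_ge0 ?mulr_ge0 ?ler0n // ltW.
have B0 (g : nat) : 0 <= 1 + 736 * h / (x * g%:R).
  by rewrite addr_ge0 // divr_ge0 ?mulr_ge0 ?ler0n // ltW.
apply: le_trans (_ : \sum_(g <- iota 1 (Num.truncn M)) (1 + 736 * h / (x * g%:R)) * c <= _).
  apply: cnt_exists_le.
  - move=> g t [[[s d] w] [m [C _]]]; have [_ _ g0 gw] := cone_gt0 C; split => //.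
    case: C => [_ _ _ _ kw]; rewrite ler_pdivlMr //.
    rewrite -(@ler_pXn2r _ 2) ?nnegrE ?mulr_ge0 ?ler0n ?(ltW x0) // !exprMn -Ex.
    rewrite -!natrX -!natrM ler_nat mulnC.
    apply: leq_trans (_ : k * w ^ 2 <= _)%N; first by rewrite leq_mul2l leq_sqr gw orbT.
    by apply: leq_trans kw _; rewrite leq_mul2r orbC.
  - move=> g t [v [m Qt]]; apply: c4_count_v => //.
    by have [C _] := Qt; case: v C {Qt} => [[s d] w] C; have [] := cone_gt0 C.
  by move=> g _; rewrite mulr_ge0.
rewrite -mulr_suml big_split /= sum_const mul1r.
apply: le_trans (_ : (M * harm F N + 736 * h / x * harm F N) * c <= _); last first.
  rewrite /M /c Ex le_eqVlt; apply/orP; left; apply/eqP.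
  by field; rewrite !gt_eqF.
rewrite ler_wpM2r //; apply: lerD.
  have [E0|n0] := posnP (Num.truncn M).
    by rewrite E0 mulr_ge0 // harm_ge0.
  apply: le_trans (_ : M * 1 <= _); first by rewrite mulr1 truncn_le.
  rewrite ler_wpM2l // harm_ge1 // (leq_trans _ HN) // muln_gt0.
  exact: H0.
apply: le_trans (_ : 736 * h / x * harm F (Num.truncn M) <= _).
  rewrite /harm mulr_sumr; apply: ler_sum_iota => g g0.
  by rewrite invfM mulrA.
rewrite ler_wpM2l ?divr_ge0 ?mulr_ge0 ?ler0n ?(ltW x0) //; apply: harm_le.
apply: leq_trans HN; rewrite -(ler_nat F) natrM; apply: (@le_trans _ _ M).
  by rewrite truncn_le.
by rewrite ler_pdivrMr // ler_peMr ?mulr_ge0 ?ler0n.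
Qed.

(** Over [k <= H * 16 ^ j], the terms [1 / sqrt k] add up to at most [2 * e ^ 2 * 4 ^ j] and the
    terms [1 / k] to a logarithm. After the factor [e / 2 ^ j], one part grows like [2 ^ j] and the
    other decays like [8 ^ - j], so both are geometric in [j]. *)
Lemma c4_count_k j N : 2 ^+ j <= 4 * e -> (23 * H <= N)%N -> (H * 16 ^ j <= N)%N ->
  (cnt L (fun t => exists k g v m, c4tuple H j k g v m t))%:R
  <= 759 * 768 * h * harm F N * (2 * e ^+ 3 * 2 ^+ j + 316 * e ^+ 3 * harm F N * (8 ^+ j)^-1).
Proof.
move=> ye HN HN'; have e0 : 0 < e := lt_le_trans ltr01 e1.
have E16 : 16 ^+ j = (2 ^+ j) ^+ 4 :> F by rewrite -exprM mulnC exprM; congr (_ ^+ _); rewrite -natrX.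
have E8 : 8 ^+ j = (2 ^+ j) ^+ 3 :> F by rewrite -exprM mulnC exprM; congr (_ ^+ _); rewrite -natrX.
have y0 : 0 < 2 ^+ j :> F by rewrite exprn_gt0.
pose K := 759 * h * harm F N * (768 * (e / 2 ^+ j)).
have K0 : 0 <= K.
  rewrite mulr_ge0 //; first by rewrite mulr_ge0 ?harm_ge0 // mulr_ge0 ?ler0n.
  by rewrite mulr_ge0 // divr_ge0 // ltW.
pose M := h * 16 ^+ j.
have M0 : 0 <= M by rewrite mulr_ge0 ?ler0n ?exprn_ge0.
apply: le_trans (_ : \sum_(k <- iota 1 (Num.truncn M)) K * ((Num.sqrt k%:R)^-1
   + 316 * e ^+ 2 / (2 ^+ j) ^+ 2 * k%:R^-1) <= _).
  apply: cnt_exists_le.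
  - move=> k t [g [[[s d] w] [m [C _]]]]; have [k0 s0 _ _] := cone_gt0 C; split => //.
    case: C => [_ _ _ [ks _] _]; rewrite /M -natrX -natrM ler_nat.
    by apply: leq_trans ks; rewrite leq_pmulr.
  - move=> k t [g [v [m Qt]]]; have [k0 _ _ _ _] := c4tuple_facts Qt.
    exact: c4_count_g.
  move=> k _; rewrite mulr_ge0 // addr_ge0 ?invr_ge0 ?sqrtr_ge0 //.
  by rewrite mulr_ge0 ?invr_ge0 // divr_ge0 ?mulr_ge0 ?exprn_ge0 // ltW.
rewrite -mulr_sumr big_split /= -mulr_sumr.
have sM : Num.sqrt M = e ^+ 2 * (2 ^+ j) ^+ 2.
  rewrite /M E16 -eh (_ : e ^+ 4 * _ = (e ^+ 2 * (2 ^+ j) ^+ 2) ^+ 2); last by ring.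
  by rewrite sqrtr_sqr ger0_norm // mulr_ge0 ?exprn_ge0 // ltW.
have s1 := sum_inv_sqrt_truncn M0; rewrite sM in s1.
have s2 : 316 * e ^+ 2 / (2 ^+ j) ^+ 2 * \sum_(k <- iota 1 (Num.truncn M)) k%:R^-1
   <= 316 * e ^+ 2 / (2 ^+ j) ^+ 2 * harm F N.
  rewrite ler_wpM2l; first by [].
    by rewrite divr_ge0 ?mulr_ge0 ?exprn_ge0 // ltW.
  apply: (@harm_le F); apply: leq_trans HN'.
  by rewrite -(ler_nat F) natrM natrX truncn_le.
apply: le_trans (ler_wpM2l K0 (lerD s1 s2)) _.
rewrite /K E8 le_eqVlt; apply/orP; left; apply/eqP.
by field; rewrite gt_eqF.
Qed.

Lemma sum_geometric2 n : \sum_(j <- iota 0 n) 2 ^+ j <= 2 ^+ n :> F.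
Proof.
elim: n => [|n IH]; first by rewrite big_nil expr0.
by rewrite sum_iota_recr add0n exprS; lra.
Qed.

Lemma sum_geometric8 n : \sum_(j <- iota 0 n) (8 ^+ j)^-1 <= 2 :> F.
Proof.
apply: le_trans (_ : 2 - 2 * (8 ^+ n)^-1 <= _); last first.
  by rewrite gerBl mulr_ge0 // invr_ge0 exprn_ge0.
elim: n => [|n IH]; first by rewrite big_nil expr0 invr1; lra.
rewrite sum_iota_recr add0n exprS invfM.
have : 0 <= (8 ^+ n)^-1 :> F by rewrite invr_ge0 exprn_ge0.
by move: (8 ^+ n)^-1 IH => y IH y0; lra.
Qed.

(** For [j > 0], [H * 16 ^ j < 16 * k * s <= 176 * H ^ 2], so only [16 ^ j <= 176 * H] occurs,
    whence [2 ^ j <= 4 * e] by [176 <= 4 ^ 4]. The growing part is governed by the last range and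
    the decaying part, with two logarithms, by the first. *)
Lemma c4_count_total N : (176 * H ^ 2 <= N)%N ->
  (cnt L (fun t => exists j k g v m, c4tuple H j k g v m t))%:R
  <= 759 * 768 * h * harm F N * (16 * h + 632 * e ^+ 3 * harm F N).
Proof.
move=> HN; have e0 : 0 < e := lt_le_trans ltr01 e1.
have HH : (H <= H ^ 2)%N by rewrite -mulnn leq_pmulr.
pose l := trunc_log 16 (176 * H).
have l16 : (16 ^ l <= 176 * H)%N by rewrite trunc_logP // muln_gt0.
have jP j : (j <= l)%N -> [/\ 2 ^+ j <= 4 * e, (23 * H <= N)%N & (H * 16 ^ j <= N)%N].
  move=> jl; have j16 : (16 ^ j <= 176 * H)%N by apply: leq_trans l16; rewrite leq_pexp2l.
  split; last 2 first.
  - by apply: leq_trans HN; lia.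
  - by apply: leq_trans HN; rewrite -mulnn mulnCA leq_mul2l j16 orbT.
  rewrite -(@ler_pXn2r _ 4) ?nnegrE ?exprn_ge0 ?mulr_ge0 ?(ltW e0) //.
  rewrite [X in _ <= X]exprMn eh -exprM mulnC exprM -!natrX -natrM ler_nat.
  by apply: leq_trans j16 _; rewrite leq_mul2r orbC.
apply: le_trans (_ : (\sum_(j <- iota 0 l.+1)
    cnt L (fun t => exists k g v m, c4tuple H j k g v m t))%:R <= _).
  rewrite ler_nat; apply: cnt_exists => t j [k [g [v [m Qt]]]].
  rewrite mem_iota add0n ltnS /=; have [_ _ k11 _ _] := c4tuple_facts Qt.
  case: Qt => + _; case: v k11 => [[s d] w] /= k11 [_ _ _ [_ jj] _].
  case: jj => [->//|jj]; apply: trunc_log_max => //.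
  rewrite -(@leq_pmul2l H) //; apply: leq_trans (ltnW jj) _.
  by rewrite -(mulnn H) in k11; lia.
rewrite natr_sum.
pose K := 759 * 768 * h * harm F N.
have K0 : 0 <= K by rewrite !mulr_ge0 ?ler0n ?harm_ge0.
apply: le_trans (_ : \sum_(j <- iota 0 l.+1) (K * (2 * e ^+ 3) * 2 ^+ j
    + K * (316 * e ^+ 3 * harm F N) * (8 ^+ j)^-1) <= _).
  rewrite big_seq_cond [X in _ <= X]big_seq_cond; apply: ler_sum => j.
  rewrite mem_iota andbT add0n ltnS => /andP[_ /jP[h1 h2 h3]].
  by apply: le_trans (c4_count_k h1 h2 h3) _; rewrite -!(mulrA K) -mulrDr.
rewrite big_split /= -!mulr_sumr.
have e30 : 0 <= e ^+ 3 by rewrite exprn_ge0 // ltW.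
have s1 : K * (2 * e ^+ 3) * (\sum_(j <- iota 0 l.+1) 2 ^+ j) <= K * (2 * e ^+ 3) * (8 * e).
  have k2 : 0 <= K * (2 * e ^+ 3) by apply: mulr_ge0 => //; apply: mulr_ge0.
  rewrite ler_wpM2l //; apply: le_trans (sum_geometric2 _) _.
  by rewrite exprS; have [] := jP l (leqnn _); lra.
have s2 : K * (316 * e ^+ 3 * harm F N) * (\sum_(j <- iota 0 l.+1) (8 ^+ j)^-1)
   <= K * (316 * e ^+ 3 * harm F N) * 2.
  by rewrite ler_wpM2l ?sum_geometric8 // mulr_ge0 // mulr_ge0 ?harm_ge0 // mulr_ge0.
apply: le_trans (lerD s1 s2) _.
rewrite -/K; have -> : 16 * h = 16 * e ^+ 4 by rewrite eh.
rewrite le_eqVlt; apply/orP; left; apply/eqP; ring.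
Qed.

End C4sum.

(** * The total count *)

Lemma mem_box (H : nat) (a : int) : (a \in box H) = (`|a| <= H%:Z).
Proof.
apply/mapP/idP => [[x]|le].
  by rewrite mem_iota add0n => /andP[_ xH] ->; rewrite ler_norml; lia.
exists (absz (a + H%:Z)); first by rewrite mem_iota; lia.
by lia.
Qed.

Lemma uniq_box (H : nat) : uniq (box H).
Proof. by rewrite map_inj_uniq ?iota_uniq // => x y /addIr[]. Qed.

Lemma mem_quad (H : nat) (t : int * int * int * int) : t \in quad H -> box4 H t.
Proof.
case/allpairsP=> -[[a b] [c d]] /= [/allpairsP[[a' b'] /= [Ha Hb [-> ->]]]
  /allpairsP[[c' d'] /= [Hc Hd [-> ->]]] ->].
by rewrite /box4 -!mem_box.
Qed.

Lemma uniq_quad (H : nat) : uniq (quad H).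
Proof.
have U : uniq [seq (a, b) | a <- box H, b <- box H].
  by apply: allpairs_uniq; rewrite ?uniq_box // => -[a b] [a' b'] _ _ [/= -> ->].
apply: allpairs_uniq => // -[[a b] [c d]] [[a' b'] [c' d']] _ _ /=.
by case=> -> -> -> ->.
Qed.

(** Up to sign, this polynomial is the product of [r0 + r1 - r2 - r3] and its two analogues: two of
    the roots have the same sum as the other two. *)
Definition degenerate (t : int * int * int * int) : Prop :=
  let: (a, b, c, d) := t in a ^+ 3 - 4 * a * b + 8 * c = 0.

Section Total.
Variable F : realType.
Variables (H : nat) (L : seq (int * int * int * int)).
Hypotheses (H0 : (0 < H)%N) (uL : uniq L).
Local Notation h := (H%:R : F).

Definition degenerate_at (a d : int) (t : int * int * int * int) : Prop :=
  [/\ t.1.1.1 = a, t.2 = d, box4 H t & degenerate t].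

Lemma degenerate_at_count a d (D : F) : 0 <= D ->
    (forall b b' c c', `|b| <= H%:Z -> `|b'| <= H%:Z -> `|c| <= H%:Z -> `|c'| <= H%:Z ->
       a ^+ 3 - 4 * a * b + 8 * c = 0 -> a ^+ 3 - 4 * a * b' + 8 * c' = 0 ->
       `|b - b'|%N%:R <= D) ->
  (cnt L (degenerate_at a d))%:R <= 1 + D.
Proof.
move=> D0 sp; apply: (cnt_spread (f := fun t => t.1.1.2)) => //.
  move=> [[[a1 b] c] d1] [[[a2 b'] c'] d2] [/= -> -> _ E] [/= -> -> _ E'] /= Eb.
  rewrite -Eb in E' *; congr (_, _, _, _); apply: (@mulfI _ (8 : int)) => //.
  by apply: (addrI (a ^+ 3 - 4 * a * b)); rewrite E E'.
move=> [[[a1 b] c] d1] [[[a2 b'] c'] d2] [/= Ea _ [_ hb hc _] E] [/= Ea' _ [_ hb' hc' _] E'] /=.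
by rewrite Ea in E; rewrite Ea' in E'; apply: sp hb hb' hc hc' E E'.
Qed.

Lemma degenerate_at_count_d a (D : F) : 0 <= D ->
    (forall d, (cnt L (degenerate_at a d))%:R <= D) ->
  (cnt L (fun t => exists d, degenerate_at a d t))%:R <= (2 * h + 1) * D.
Proof.
move=> D0 le.
apply: le_trans (@cnt_exists_const F _ L _ (box H) (fun=> True) _ D _ _ D0) _.
- move=> d [[[a1 b] c] d1] [/= _ <- [_ _ _ hd] _]; split => //.
  by rewrite mem_box.
- by move=> d t _; apply: le.
rewrite ler_wpM2r // -natrM natr1 ler_nat.
by rewrite (leq_trans (count_size _ _)) // size_map size_iota addn1.
Qed.

(** If [a = 0], then [c = 0] while [b] and [d] are free. If [|a| = i > 0], two solutions satisfy
    [a * (b - b') = 2 * (c - c')], so [b] lies in an interval of length [4 * h / i] and determines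
    [c]; the sum over [i] is harmonic. The constant is [39 = 9 + 6 + 24]. *)
Lemma degenerate_count N : (H <= N)%N ->
  (cnt L (fun t => box4 H t /\ degenerate t))%:R <= 39 * h ^+ 2 * harm F N.
Proof.
move=> HN; have h1 : 1 <= h by rewrite ler1n.
pose Q (i : nat) t := (0 < i)%N /\ exists e d, degenerate_at (signed e i) d t.
apply: le_trans (_ : (cnt L (fun t => exists d, degenerate_at 0 d t)
   + cnt L (fun t => exists i, Q i t))%N%:R <= _).
  rewrite ler_nat; apply: leq_trans (cnt_or _ _ _); apply: cnt_le => -[[[a b] c] d] [B E].
  have [a0|a0] := eqVneq a 0; first by left; exists d; split.
  right; exists `|a|%N; split; first by rewrite absz_gt0.
  by exists (a < 0), d; split => //=; rewrite /signed -intEsign.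
have z0 : (cnt L (fun t => exists d, degenerate_at 0 d t))%:R <= (2 * h + 1) * (1 + 2 * h).
  apply: degenerate_at_count_d => [|d]; first by lra.
  apply: degenerate_at_count => [|b b' c c' hb hb' _ _ _ _]; first by lra.
  by rewrite -natrM ler_nat; lia.
have z1 : (cnt L (fun t => exists i, Q i t))%:R <=
    \sum_(i <- iota 1 (Num.truncn h)) 2 * ((2 * h + 1) * (1 + 4 * h / i%:R)).
  apply: cnt_exists_le.
  - move=> i [[[a b] c] d] [i0 [e [d' [/= Ea _ [ha _ _ _] _]]]]; split => //.
    rewrite ler_nat; move: ha; rewrite Ea /signed normrMsign.
    by rewrite ger0_norm.
  - move=> i t [i0 _].
    have D0 : 0 <= 4 * h / i%:R by rewrite divr_ge0 ?mulr_ge0 ?ler0n.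
    have D1 : 0 <= (2 * h + 1) * (1 + 4 * h / i%:R).
      by rewrite mulr_ge0 // addr_ge0 // mulr_ge0.
    apply: le_trans (_ : (cnt L (fun t => exists e : bool, exists d,
        degenerate_at (signed e i) d t))%:R <= _).
      by rewrite ler_nat; apply: cnt_le => t' [].
    apply: le_trans (@cnt_exists_const F _ L bool (enum {: bool}) (fun=> True)
      (fun e t => exists d, degenerate_at (signed e i) d t) _ _ _ D1) _.
    + by move=> e t' _; rewrite mem_enum.
    + move=> e t' _; apply: degenerate_at_count_d => [|d]; first by rewrite addr_ge0.
      apply: degenerate_at_count => // b b' c c' _ _ hc hc' E E'.
      rewrite ler_pdivlMr ?ltr0n // -!natrM ler_nat.
      set s := signed e i in E E'.
      have Es : `|s|%N = i by rewrite /s /signed abszMsign.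
      have key : s * (b - b') = 2 * (c - c').
        have n4 : (4 : int) != 0 by [].
        by apply: (mulfI n4); move: E E'; clear; lra.
      rewrite -Es -abszM mulrC key abszM; lia.
    rewrite ler_wpM2r // ler_nat (leq_trans (count_size _ _)) //.
    by rewrite -cardE card_bool.
  move=> i i0; rewrite !mulr_ge0 // ?addr_ge0 ?mulr_ge0 ?ler0n ?invr_ge0 //.
rewrite natrD; apply: le_trans (lerD z0 z1) _.
rewrite -mulr_sumr -mulr_sumr big_split /= -mulr_sumr sum_const natrK mul1r.
rewrite -/(harm F H).
have L1 : 1 <= harm F N by rewrite harm_ge1 // (leq_trans H0).
have LH : harm F H <= harm F N by apply: harm_le.
apply: le_trans (_ : 3 * h * (3 * h) + 2 * (3 * h * (h + 4 * h * harm F N)) <= _).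
  apply: lerD; first by apply: ler_pM; lra.
  rewrite ler_wpM2l //; apply: ler_pM; rewrite ?addr_ge0 ?mulr_ge0 ?harm_ge0 //; last first.
    by rewrite lerD2l ler_wpM2l // mulr_ge0.
  by lra.
have : h ^+ 2 <= h ^+ 2 * harm F N by rewrite ler_peMr // exprn_ge0.
by lra.
Qed.

Lemma cnt_mem (T : eqType) (s : seq T) (p : pred T) (P : T -> Prop) :
  (forall t, t \in s -> p t -> P t) -> (count p s <= cnt s P)%N.
Proof.
move=> sub; have -> : count p s = count (fun t => (t \in s) && p t) s.
  by apply: eq_in_count => t ->.
by apply: sub_count => t /andP[ts pt]; apply/decbP/sub.
Qed.

End Total.

(** A harmonic number stands for the logarithm. The hypothesis [harm F N <= C * e] says that it
    grows no faster than [H ^ (1/4)]; it absorbs the second logarithm of the cyclic count.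
    Degenerate quartics are charged to both groups, hence [78 = 2 * 39]. *)
Lemma counts_total (F : realType) (C : F) : 0 <= C -> exists2 K : F, 0 <= K &
  forall (H N : nat) (e : F), (0 < H)%N -> (176 * H ^ 2 <= N)%N ->
    1 <= e -> e ^+ 4 = H%:R -> harm F N <= C * e ->
  (N_V4 H + N_C4 H)%N%:R <= K * H%:R ^+ 2 * harm F N.
Proof.
move=> C0.
exists (78 + 3200 * (2 * 3702 + 80 * 100 * 9) + 759 * 768 * (16 + 632 * C)).
  have n0 n : 0 <= n%:R :> F by apply: ler0n.
  exact: addr_ge0 (addr_ge0 (n0 _) (mulr_ge0 (n0 _) (addr_ge0 (mulr_ge0 (n0 _) (n0 _))
    (mulr_ge0 (mulr_ge0 (n0 _) (n0 _)) (n0 _)))))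
    (mulr_ge0 (mulr_ge0 (n0 _) (n0 _)) (addr_ge0 (n0 _) (mulr_ge0 (n0 _) C0))).
move=> H N e H0 HN e1 eh hC; have uL := uniq_quad H.
have HH : (H <= H ^ 2)%N by rewrite -mulnn leq_pmulr.
have HN1 : (H <= N)%N by lia.
have HN30 : (30 * H <= N)%N by lia.
pose deg t := box4 H t /\ degenerate t.
pose v4 t := exists al be m1 m2 ga m3, v4tuple H al be m1 m2 ga m3 t.
pose c4 t := exists j k g v m, c4tuple H j k g v m t.
have le1 : (N_V4 H <= cnt (quad H) deg + cnt (quad H) v4)%N.
  apply: leq_trans (cnt_or _ _ _); apply: cnt_mem => t /mem_quad B /andP[/decbP irr iso].
  have [A1 [A2 [A3 V]]] := V4_data H0 B irr iso.
  have [E|E] := eqVneq (A1 * A2 * A3) 0.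
    left; split => //; case: t V {B irr iso} => [[[a b] c] d] [_ _ _ P _].
    by apply/eqP; rewrite -sqrf_eq0 -P E.
  right; have [al [be [ga [m1 [m2 [m3 [ba ag mm cd]]]]]]] := V4_param V E.
  by exists al, be, m1, m2, ga, m3.
have le2 : (N_C4 H <= cnt (quad H) deg + cnt (quad H) c4)%N.
  apply: leq_trans (cnt_or _ _ _); apply: cnt_mem => t /mem_quad B /andP[/decbP irr iso].
  case: t B irr iso => [[[a b] c] d] B irr iso.
  have [E|[k [m [s [d' [w V]]]]]] := C4_data H0 B irr iso; first by left.
  by right; apply: C4_param V.
have e0 : 0 < e := lt_le_trans ltr01 e1.
have L0 : 0 <= harm F N by apply: harm_ge0.
apply: le_trans (_ : ((cnt (quad H) deg + cnt (quad H) v4)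
   + (cnt (quad H) deg + cnt (quad H) c4))%N%:R <= _).
  by rewrite ler_nat leq_add.
have b1 := @degenerate_count F H (quad H) H0 uL N HN1.
have b2 := @v4_count_total F H (quad H) H0 uL N HN30.
have b3 := @c4_count_total F H (quad H) H0 uL e e1 eh N HN.
rewrite !natrD; apply: le_trans (lerD (lerD b1 b2) (lerD b1 b3)) _.
have b4 : 632 * e ^+ 3 * harm F N <= 632 * C * H%:R.
  apply: le_trans (_ : 632 * e ^+ 3 * (C * e) <= _).
    by rewrite ler_wpM2l // mulr_ge0 ?exprn_ge0 // ltW.
  by rewrite -eh le_eqVlt; apply/orP; left; apply/eqP; ring.
have b5 : 759 * 768 * H%:R * harm F N * (16 * H%:R + 632 * e ^+ 3 * harm F N)
   <= 759 * 768 * H%:R * harm F N * (16 * H%:R + 632 * C * H%:R).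
  by rewrite ler_wpM2l ?lerD2l // !mulr_ge0.
apply: le_trans (lerD (lexx _) (lerD (lexx _) b5)) _.
by rewrite le_eqVlt; apply/orP; left; apply/eqP; ring.
Qed.

(* From harmonic numbers to the natural logarithm *)
From mathcomp Require Import Rstruct.
From Stdlib Require Import Reals Lra.
Local Close Scope ring_scope.
Open Scope R_scope.

Lemma ln_le (x y : R) : 0 < x -> x <= y -> ln x <= ln y.
Proof. by move=> x0 [xy|->]; [apply/Rlt_le/ln_increasing|apply: Rle_refl]. Qed.

(** Each step is [/ (y + 1) <= ln (y + 1) - ln y], which is [1 + x <= exp x] at
    [x = - / (y + 1)]. *)
Lemma harm_le_ln (n : nat) : leq 1 n -> harm R n <= 1 + ln (INR n).
Proof.
elim: n => [//|n IH] _; rewrite harmS -RplusE -RinvE -INRE.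
have [->|n0] := posnP n.
  by rewrite /harm big_nil /= Rinv_1 ln_1 -[GRing.zero]/(IZR 0); Lra.lra.
have Hn : 0 < INR n by apply: lt_0_INR; apply/ssrnat.ltP.
have {IH} := IH n0; move: (harm R n) => x IH.
have E : INR n.+1 = INR n + 1 by rewrite S_INR.
rewrite E; move: (INR n) Hn IH => y y0 IH.
have yu : (y + 1) * / (y + 1) = 1 by apply: Rinv_r; Lra.lra.
have step : / (y + 1) <= ln (y + 1) - ln y.
  have -> : ln y = ln (y + 1) + ln (y / (y + 1)).
    rewrite -ln_mult; [congr ln|Lra.lra|by apply: Rdiv_lt_0_compat; Lra.lra].
    by rewrite /Rdiv -Rmult_assoc (Rmult_comm _ y) Rmult_assoc yu Rmult_1_r.
  suff : ln (y / (y + 1)) <= - / (y + 1) by Lra.lra.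
  rewrite -[X in _ <= X]ln_exp; apply: ln_le; first by apply: Rdiv_lt_0_compat; Lra.lra.
  have := exp_ineq1_le (- / (y + 1)).
  suff -> : y / (y + 1) = 1 + - / (y + 1) by [].
  by rewrite /Rdiv; move: (/ (y + 1)) yu => u yu; Lra.lra.
Lra.lra.
Qed.

Theorem theorem1p6 :
  exists (C : R) (H0 : nat), forall H : nat, leq H0 H ->
    INR (N_V4 H + N_C4 H) <= C * (INR H ^ 2 * ln (INR H)).
Proof.
(* 41 comes from [1 + 10 * ln H = 1 + 40 * ln e <= 41 * e], where [e ^ 4 = H]. *)
have C0 : Order.le (GRing.zero : R) (GRing.natmul 1 41 : R) by apply: Num.Theory.ler0n.
have [K /RleP K0 bound] := counts_total C0.
(* The range starts at 2 because [ln 1 = 0]. For [H >= 2], [1 <= 2 * ln H] turns [1 + 10 * ln H]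
   into [12 * ln H]. *)
exists (K * 12), 2%nat => H H2; have H0 : leq 1 H by apply: ltnW.
pose e := sqrt (sqrt (INR H)); pose N := muln 176 (expn H 2).
have h2 : 2 <= INR H by have := le_INR 2%nat H (elimT ssrnat.leP H2).
have s1 : 1 <= sqrt (INR H) by rewrite -sqrt_1; apply: sqrt_le_1_alt; Lra.lra.
have e1 : 1 <= e by rewrite -sqrt_1; apply: sqrt_le_1_alt; Lra.lra.
have eh : e * e * (e * e) = INR H by rewrite !sqrt_sqrt; Lra.lra.
have lnH : ln (INR H) = 4 * ln e by rewrite -eh !ln_mult; Lra.nra.
have lne : ln e <= e - 1.
  have := exp_ineq1_le (ln e); rewrite exp_ln; Lra.lra.
have ln2 : / 2 <= ln 2 by apply/Rlt_le/ln_lt_2.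
have ln2H : ln 2 <= ln (INR H) by apply: ln_le; Lra.lra.
(* [176 <= 2 ^ 8] and [2 <= H], so the constant costs [8 * ln H] and [H ^ 2] costs [2 * ln H]. *)
have lnN : ln (INR N) <= 10 * ln (INR H).
  have -> : INR N = 176 * (INR H * INR H).
    by rewrite /N -mulnn !INRE !GRing.natrM -!INRE -!RmultE (INR_IZR_INZ 176).
  rewrite (ln_mult 176 (_ * _)) ?(ln_mult (INR H) (INR H)); try Lra.nra.
  suff : ln 176 <= 8 * ln 2 by Lra.lra.
  have -> : 8 * ln 2 = ln 256.
    by rewrite (_ : 256 = 2 * 2 * (2 * 2) * (2 * 2 * (2 * 2))) ?ln_mult; Lra.lra.
  by apply: ln_le; Lra.lra.
have N1 : leq 1 N by rewrite muln_gt0 expn_gt0 H0.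
have hN := harm_le_ln N1.
have hC : harm R N <= 41 * e by Lra.lra.
have {hC} hC : Order.le (harm R N) (GRing.mul (GRing.natmul 1 41) e).
  by apply/RleP; rewrite -INRE (INR_IZR_INZ 41).
have {eh} eh : GRing.exp e 4 = GRing.natmul 1 H :> R.
  by rewrite -INRE -eh -RpowE /=; Lra.lra.
have {e1} e1 : Order.le (GRing.one _ : R) e by apply/RleP.
have /RleP := bound H N e H0 (leqnn _) e1 eh hC.
rewrite -!INRE -!RmultE -RpowE => le; apply: Rle_trans le _.
have le12 : harm R N <= 12 * ln (INR H) by Lra.lra.
have p : 0 <= K * INR H ^ 2 by apply: Rmult_le_pos => //; apply: pow2_ge_0.
apply: Rle_trans (Rmult_le_compat_l _ _ _ p le12) _; apply: Req_le.
by move: (INR H ^ 2) (ln _) => x y; Lra.lra.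
Qed.
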